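(* Let $n\ge 2$ and let $\phi:[0,\infty)\to[0,\infty)$ be a Young function satisfying $$C_\phi:=\sup_{t>0}\frac{t^n}{\phi(t)}\int_0^t\frac{\phi(s)}{s^n}\frac{ds}{s}<\infty .$$ (i) If $\Omega\subset\mathbb{R}^n$ is an Ahlfors $n$-regular domain, then $\Omega$ is a $\dot{\mathbf B}^\phi$-extension domain. (ii) Assume in addition that $\phi$ satisfies $$\limsup_{x\to\infty}\phi(x)e^{-cx}=0\quad\text{for all } c>0 .$$ If a domain $\Omega\subset\mathbb{R}^n$ is a $\dot{\mathbf B}^\phi$-extension domain, then $\Omega$ is Ahlfors $n$-regular.
   Context: A Young function is a convex function $\phi:[0,\infty)\to[0,\infty)$ with $\phi(0)=0$, $\phi(t)>0$ for $t>0$, and $\lim_{t\to\infty}\phi(t)=+\infty$. For a domain $\Omega\subset\mathbb{R}^n$, the Orlicz-Besov space $\dot{\mathbf B}^\phi(\Omega)$ consists of all measurable functions $u$ on $\Omega$ whose semi-norm $$\|u\|_{\dot{\mathbf B}^\phi(\Omega)}:=\inf\left\{\alpha>0:\int_\Omega\int_\Omega\phi\left(\frac{|u(x)-u(y)|}{\alpha}\right)\frac{dx\,dy}{|x-y|^{2n}}\le 1\right\}$$ is finite. A domain $\Omega\subset\mathbb{R}^n$ is Ahlfors $n$-regular if there is a constant $C_A(\Omega)>0$ such that $|B(x,r)\cap\Omega|\ge C_A(\Omega)r^n$ for all $x\in\Omega$ and all $0<r<2\operatorname{diam}\Omega$, where $|\cdot|$ denotes Lebesgue measure. A domain $\Omega\subset\mathbb{R}^n$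 is a $\dot{\mathbf B}^\phi$-extension domain if there exists a bounded linear operator $E:\dot{\mathbf B}^\phi(\Omega)\to\dot{\mathbf B}^\phi(\mathbb{R}^n)$ (bounded with respect to the semi-norms $\|\cdot\|_{\dot{\mathbf B}^\phi(\Omega)}$ and $\|\cdot\|_{\dot{\mathbf B}^\phi(\mathbb{R}^n)}$) such that $Eu|_\Omega=u$ for every $u\in\dot{\mathbf B}^\phi(\Omega)$. *)

(* Defs.v *)
From HB Require Import structures.
From mathcomp Require Import all_boot all_order all_algebra.
From mathcomp Require Import all_classical all_reals all_analysis.

Set Implicit Arguments.
Unset Strict Implicit.
Unset Printing Implicit Defensive.

Import Order.TTheory GRing.Theory Num.Theory.
Import numFieldNormedType.Exports.

Local Open Scope classical_set_scope.
Local Open Scope ring_scope.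

(* Lebesgue measure on R^n: the n-fold product of the one-dimensional Lebesgue
   measure, built on n-tuples, is transported to row vectors and then completed
   (Caratheodory), so that measurable means Lebesgue measurable. *)
Section LebesgueMeasureRn.
Context (R : realType).
Local Notation RR := (measurableTypeR R).

Definition cons_pair n (z : RR * n.-tuple RR) : n.+1.-tuple RR :=
  [tuple of z.1 :: z.2].

Lemma measurable_cons_pair n : measurable_fun [set: _] (@cons_pair n).
Proof. exact: measurable_cons. Qed.

Section ConsMeasure.
Context n (m : {measure set (n.-tuple RR) -> \bar R}).

Definition cons_measure : set (n.+1.-tuple RR) -> \bar R :=
  pushforward (@lebesgue_measure R \x^ m)%E (@cons_pair n).

Let mc := @measurable_cons_pair n.
#[local] Hint Resolve mc : core.

Let cons_measure0 : cons_measure set0 = 0%E.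
Proof. exact: measure0. Qed.

Let cons_measure_ge0 A : (0 <= cons_measure A)%E.
Proof. exact: measure_ge0. Qed.

Let cons_measure_sigma_additive : semi_sigma_additive cons_measure.
Proof. exact: measure_semi_sigma_additive. Qed.

HB.instance Definition _ := isMeasure.Build _ _ _ cons_measure
  cons_measure0 cons_measure_ge0 cons_measure_sigma_additive.
End ConsMeasure.

Fixpoint tuple_lebesgue n : {measure set (n.-tuple RR) -> \bar R} :=
  if n is n'.+1 then cons_measure (tuple_lebesgue n') else dirac [tuple].

Section RowVectors.
Context (n : nat).

Definition tuple_of_row (x : 'rV[R]_n) : n.-tuple RR :=
  [tuple x ord0 i | i < n].

Definition borelRn := g_sigma_algebra_preimageType tuple_of_row.

Definition row_of_tuple (t : n.-tuple RR) : borelRn := \row_i tnth t i.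

Lemma row_of_tupleK : cancel row_of_tuple tuple_of_row.
Proof. by move=> t; apply: eq_from_tnth => i; rewrite tnth_mktuple mxE. Qed.

Lemma measurable_row_of_tuple : measurable_fun [set: _] row_of_tuple.
Proof.
move=> _ _ [B mB <-]; rewrite !setTI.
rewrite (_ : _ @^-1` _ = B)//; apply/seteqP.
by split=> t /=; rewrite row_of_tupleK.
Qed.

Definition borel_lebesgueRn : set borelRn -> \bar R :=
  pushforward (tuple_lebesgue n) row_of_tuple.

Let mr := measurable_row_of_tuple.
#[local] Hint Resolve mr : core.

Let borel_lebesgueRn0 : borel_lebesgueRn set0 = 0%E.
Proof. exact: measure0. Qed.

Let borel_lebesgueRn_ge0 A : (0 <= borel_lebesgueRn A)%E.
Proof. exact: measure_ge0. Qed.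

Let borel_lebesgueRn_sigma_additive : semi_sigma_additive borel_lebesgueRn.
Proof. exact: measure_semi_sigma_additive. Qed.

HB.instance Definition _ := isMeasure.Build _ _ _ borel_lebesgueRn
  borel_lebesgueRn0 borel_lebesgueRn_ge0 borel_lebesgueRn_sigma_additive.

Definition Rn := caratheodory_type (borel_lebesgueRn^*)%mu.

HB.instance Definition _ := Measurable.on Rn.

Definition lebesgueRn : set Rn -> \bar R :=
  @completed_measure_extension _ _ _ borel_lebesgueRn.

HB.instance Definition _ := Measure.on lebesgueRn.
End RowVectors.
End LebesgueMeasureRn.

(* Normalization: the measure of a box is the product of its side lengths. *)
Section LebesgueBox.
Context (R : realType).

Definition tuple_box n (A : 'I_n -> set R) : set (n.-tuple (measurableTypeR R)) :=
  [set t | forall i, A i (tnth t i)].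

Lemma measurable_tuple_box n (A : 'I_n -> set R) :
  (forall i, measurable (A i)) ->
  measurable (tuple_box A).
Proof.
move=> mA.
rewrite (_ : tuple_box A = \bigcap_(i in [set: 'I_n]) ((@tnth n _)^~ i @^-1` A i)).
  apply: fin_bigcap_measurable. exact: finite_finset.
  move=> i _.
  have :=
    @measurable_tnth _ (measurableTypeR R) n i measurableT _ (mA i).
  by rewrite setTI.
by apply/seteqP; split=> [t h i _|t h i]; [exact: h|exact: (h i I)].
Qed.

Lemma tuple_lebesgue_box n (A : 'I_n -> set R) : (forall i, measurable (A i)) ->
  tuple_lebesgue R n (tuple_box A) = (\prod_(i < n) lebesgue_measure (A i))%E.
Proof.
elim: n A => [|n IH] A mA.
  rewrite big_ord0 /= diracE mem_set//; by case.
rewrite big_ord_recl -(IH (fun i => A (lift ord0 i)) (fun i => mA _))/=.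
rewrite -product_measure2E//; last exact: measurable_tuple_box.
rewrite /cons_measure /pushforward; congr (product_measure2 _ _ _).
apply/seteqP; split => -[x t] /=.
  move=> h; split; first by have := h ord0.
  by move=> i; have := h (lift ord0 i); rewrite tnthS.
move=> [h0 h] i; case: (unliftP ord0 i) => [j|] ->; last by [].
by rewrite /cons_pair/= tnthS; apply: h.
exact: mA.
Qed.

Lemma lebesgueRn_box n (a b : 'rV[R]_n) :
  (forall i, a ord0 i <= b ord0 i) ->
  lebesgueRn [set x : Rn R n | forall i, a ord0 i <= x ord0 i <= b ord0 i] =
  (\prod_i (b ord0 i - a ord0 i))%:E.
Proof.
move=> ab.
pose A i : set R := `[a ord0 i, b ord0 i]%classic.
have mA i : measurable (A i) by exact: measurable_itv.
have -> : [set x : Rn R n | forall i, a ord0 i <= x ord0 i <= b ord0 i] =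
    (@tuple_of_row R n) @^-1` (tuple_box A).
  apply/seteqP; split=> x /= h i; have := h i; rewrite /A /= in_itv/=.
    by rewrite tnth_mktuple.
  by rewrite tnth_mktuple.
have mB : measurable (((@tuple_of_row R n) @^-1` (tuple_box A)) : set (borelRn R n)).
  by exists (tuple_box A); [exact: measurable_tuple_box|rewrite setTI].
rewrite /lebesgueRn /completed_measure_extension measurable_mu_extE//.
rewrite /borel_lebesgueRn /pushforward.
have E :
    (@row_of_tuple R n) @^-1` ((@tuple_of_row R n) @^-1` tuple_box A) = tuple_box A
  by apply/seteqP; split=> t /=; rewrite row_of_tupleK.
transitivity (tuple_lebesgue R n (tuple_box A)); first by rewrite -[in RHS]E.
rewrite tuple_lebesgue_box//.
rewrite -prodEFin; apply: eq_bigr => i _.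
rewrite /A lebesgue_measure_itv/= lte_fin.
by case: ltP => //; have := ab i; case: ltgtP => // ->; rewrite subrr.
Qed.
End LebesgueBox.

Section OrliczBesov.
Context (R : realType).

(* The library's norm on row vectors is the sup norm. *)
Definition eucl_norm n (x : 'rV[R]_n) : R := Num.sqrt (\sum_i x ord0 i ^+ 2).

Definition eucl_ball n (x : 'rV[R]_n) (r : R) : set 'rV[R]_n :=
  [set y | eucl_norm (x - y) < r].

Definition diam n (A : set 'rV[R]_n) : \bar R :=
  ereal_sup [set (eucl_norm (p.1 - p.2))%:E | p in A `*` A].

Definition domain n (Omega : set 'rV[R]_n) : Prop :=
  [/\ open Omega, connected Omega & Omega !=set0].

(* A Young function [0, oo) -> [0, oo) is represented by phi : R -> R; its
   values on negative reals are irrelevant. *)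
Definition young_function (phi : R -> R) : Prop :=
  [/\ convex_function (E := R^o) [set t | 0 <= t] phi,
      forall t, 0 <= t -> 0 <= phi t,
      phi 0 = 0,
      forall t, 0 < t -> 0 < phi t &
      phi t @[t --> +oo] --> +oo].

Definition growth_constant n (phi : R -> R) : \bar R :=
  ereal_sup [set ((t ^+ n / phi t)%:E *
    \int[lebesgue_measure]_(s in `]0%R, t[) (phi s / s ^+ n / s)%:E)%E |
    t in [set t | 0 < t]].

Definition subexponential (phi : R -> R) : Prop :=
  forall c : R, 0 < c ->
    limf_esup (fun x : R => (phi x * expR (- (c * x)))%:E) +oo = 0%E.

(* Only the restriction of u : R^n -> R to Omega matters here. *)
Definition modular n (phi : R -> R) (Omega : set (Rn R n)) (u : Rn R n -> R)
    (alpha : R) : \bar R :=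
  (\int[@lebesgueRn R n]_(x in Omega) \int[@lebesgueRn R n]_(y in Omega)
    (phi (`|u x - u y| / alpha) / eucl_norm (x - y) ^+ (2 * n))%:E)%E.

Definition besov_seminorm n (phi : R -> R) (Omega : set (Rn R n))
    (u : Rn R n -> R) : \bar R :=
  ereal_inf [set alpha%:E | alpha in
    [set alpha : R | 0 < alpha /\ (modular phi Omega u alpha <= 1)%E]].

Definition besov n (phi : R -> R) (Omega : set (Rn R n)) : set (Rn R n -> R) :=
  [set u | measurable_fun Omega u /\ (besov_seminorm phi Omega u < +oo)%E].

Definition ahlfors_regular n (Omega : set (Rn R n)) : Prop :=
  exists2 CA : R, 0 < CA & forall (x : 'rV[R]_n) (r : R),
    Omega x -> 0 < r -> (r%:E < 2%:E * diam Omega)%E ->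
    ((CA * r ^+ n)%:E <= lebesgueRn (eucl_ball x r `&` Omega))%E.

(* A function on Omega is represented by any of its extensions to R^n; the
   first clause makes E u depend on the restriction of u to Omega only. *)
Definition extension_domain n (phi : R -> R) (Omega : set (Rn R n)) : Prop :=
  exists E : ('rV[R]_n -> R) -> ('rV[R]_n -> R),
  [/\ forall u v, {in Omega, u =1 v} -> E u = E v,
      forall u, besov phi Omega u -> besov phi [set: Rn R n] (E u),
      forall (a : R) u v, besov phi Omega u -> besov phi Omega v ->
        E (fun x => a * u x + v x) = (fun x => a * E u x + E v x),
      exists2 C : R, 0 < C & forall u, besov phi Omega u ->
        (besov_seminorm phi [set: Rn R n] (E u) <=
           C%:E * besov_seminorm phi Omega u)%E &
      forall u, besov phi Omega u -> {in Omega, E u =1 u}].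

End OrliczBesov.

(* Main.v *)
(* Distances are measured in the sup norm, which is comparable to the Euclidean one
   and makes the volume of a ball explicit.

   Part (i): an averaging extension. If S is open and |B(x,r) /\ S| >= c r^n at all
   scales r, then closure S \ S is null, and E u (x) = int P(x,z) u(z) dz off the
   closure of S, where the density P(x,.) lives on the part of S within 3 dist(x,S) of x.
   P is cut off on those z that are charged by too many x, so that int P(x,z) dx stays
   bounded. For points far apart compared with their distance to S, two applications of
   Jensen's inequality bound the energy of E u by that of u; for nearby points P(x,.) is
   Lipschitz in x and the growth condition makes int phi(a |h|) |h|^(-2n) dh over a ball
   converge. A bounded domain is first completed to a set that is regular at all scales,
   by adding a far exterior on which u is replaced by its mean.

   Part (ii): let u be a cutoff at x between the radii a < b. The growth condition
   bounds the modular of u by |B(x,b) /\ Omega| (b-a)^(-n) phi(2/alpha), up to a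
   constant. The averages of E u over dyadic balls change by at most a constant multiple
   of its semi-norm per step, so passing from {u = 1} to {u = 0} takes a number of steps
   logarithmic in the volume of the smaller set. Since phi is subexponential this gives
   (b-a)^(2n) <= C R^n |B(x,b) /\ Omega| when |B(x,b) /\ Omega| <= 2 |B(x,a) /\ Omega|, and
   a De Giorgi iteration yields the lower volume bound. *)
From HB Require Import structures.
Require Import Defs.
From mathcomp Require Import all_boot all_order all_algebra.
From mathcomp Require Import all_classical all_reals all_analysis.
From mathcomp Require Import measurable_realfun ring lra.

Set Implicit Arguments.
Unset Strict Implicit.
Unset Printing Implicit Defensive.

Import Order.TTheory GRing.Theory Num.Theory.
Import numFieldNormedType.Exports.

Local Open Scope classical_set_scope.
Local Open Scope ring_scope.

(** * Measurability and integration *)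

(** No doubling condition is at hand: phi may grow faster than every power, so phi (k t) is not
    bounded by a multiple of phi t. Constants are moved by convexity instead, phi (t / k) <= phi t /
    k for k >= 1, into the parameter alpha, and averages are taken against densities of mass at most
    one, for which Jensen's inequality loses nothing. The densities P(x,.) stand in for reflected
    Whitney cubes, and the cut-off by the charge for their bounded overlap. Each dyadic range of
    dist(x,S) may put a comparable mass on the same z, so the uncut sum need not be bounded;
    regularity bounds the charge on average, hence a fixed share of every density survives the cut.
    In part (ii) the capacity estimate loses phi of a logarithm of a volume ratio. Subexponential
    growth bounds this loss by the square root of the ratio, which is where the exponent 2n comes
    from; the power that is left still drives the iteration. *)

Section MeasurableOperations.
Context d (T : measurableType d) (R : realType).
Implicit Types (f g : T -> R) (b c : T -> bool) (F G : T -> \bar R).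

Lemma mfD f g : measurable_fun setT f -> measurable_fun setT g ->
  measurable_fun setT (fun x => f x + g x).
Proof. exact: measurable_funD. Qed.

Lemma mfN f : measurable_fun setT f -> measurable_fun setT (fun x => - f x).
Proof. exact: measurable_funN. Qed.

Lemma mfM f g : measurable_fun setT f -> measurable_fun setT g ->
  measurable_fun setT (fun x => f x * g x).
Proof. exact: measurable_funM. Qed.

Lemma mfX f n : measurable_fun setT f -> measurable_fun setT (fun x => f x ^+ n).
Proof. exact: measurable_funX. Qed.

Lemma mf_norm f : measurable_fun setT f -> measurable_fun setT (fun x => `|f x|).
Proof. by move=> mf; apply: (measurableT_comp (@normr_measurable R setT)). Qed.

Lemma measurable_invr : measurable_fun [set: R] (@GRing.inv R).
Proof.
rewrite (_ : setT = [set x | x != 0] `|` [set 0]); last first.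
  by apply/seteqP; split=> x //= _; case: (eqVneq x 0); [right|left].
have m0 : measurable [set x : R | x != 0].
  by rewrite (_ : mkset _ = ~` [set 0]); [exact: measurableC
    |apply/seteqP; split=> x /eqP].
apply/measurable_funU => //; split; last exact: measurable_fun_set1.
apply: open_continuous_measurable_fun.
  rewrite (_ : mkset _ = ~` [set 0]); last by apply/seteqP; split=> x /eqP.
  apply: closed_openC; apply: accessible_closed_set1.
  exact: hausdorff_accessible.
by move=> x; rewrite inE /= => x0; exact: inv_continuous.
Qed.

Lemma mfV f : measurable_fun setT f -> measurable_fun setT (fun x => (f x)^-1).
Proof. exact: measurableT_comp measurable_invr. Qed.

Lemma mf_min f g : measurable_fun setT f -> measurable_fun setT g ->
  measurable_fun setT (fun x => Num.min (f x) (g x)).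
Proof. exact: measurable_minr. Qed.

Lemma mf_max f g : measurable_fun setT f -> measurable_fun setT g ->
  measurable_fun setT (fun x => Num.max (f x) (g x)).
Proof. exact: measurable_maxr. Qed.

Lemma mf_lt f g : measurable_fun setT f -> measurable_fun setT g ->
  measurable_fun setT (fun x => f x < g x).
Proof. exact: measurable_fun_ltr. Qed.

Lemma mf_le f g : measurable_fun setT f -> measurable_fun setT g ->
  measurable_fun setT (fun x => f x <= g x).
Proof. exact: measurable_fun_ler. Qed.

Lemma mf_and b c : measurable_fun setT b -> measurable_fun setT c ->
  measurable_fun setT (fun x => b x && c x).
Proof. exact: measurable_and. Qed.

Lemma mf_neg b : measurable_fun setT b -> measurable_fun setT (fun x => ~~ b x).
Proof. exact: measurable_neg. Qed.

Lemma mf_nat b : measurable_fun setT b -> measurable_fun setT (fun x => (b x)%:R : R).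
Proof.
move=> mb; rewrite (_ : (fun x => _) = fun x => if b x then 1 else 0).
  by apply: measurable_fun_ifT.
by apply/funext => x; case: (b x).
Qed.

Lemma mf_mem (S : set T) : measurable S -> measurable_fun setT (fun x => x \in S).
Proof.
move=> mS; apply: (measurable_fun_bool true).
by rewrite setTI (_ : _ @^-1` _ = S)//; apply/seteqP; split=> x /= => [/set_mem|/mem_set].
Qed.

Lemma mf_ifr b f g : measurable_fun setT b -> measurable_fun setT f ->
  measurable_fun setT g -> measurable_fun setT (fun x => if b x then f x else g x).
Proof. by move=> mb mf mg; apply: measurable_fun_ifT. Qed.

Lemma mf_ife b F G : measurable_fun setT b -> measurable_fun setT F ->
  measurable_fun setT G -> measurable_fun setT (fun x => if b x then F x else G x).
Proof. by move=> mb mf mg; apply: measurable_fun_ifT. Qed.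

Lemma mf_EFin f : measurable_fun setT f -> measurable_fun setT (fun x => (f x)%:E).
Proof. by move=> mf; apply/measurable_EFinP. Qed.

Lemma mf_fine F : measurable_fun setT F -> measurable_fun setT (fun x => fine (F x)).
Proof. by move=> mF; exact: (measurableT_comp (@fine_measurable R setT _)). Qed.

Lemma mfeD F G : measurable_fun setT F -> measurable_fun setT G ->
  measurable_fun setT (fun x => F x + G x)%E.
Proof. exact: emeasurable_funD. Qed.

Lemma mfeM F G : measurable_fun setT F -> measurable_fun setT G ->
  measurable_fun setT (fun x => F x * G x)%E.
Proof. exact: emeasurable_funM. Qed.

Lemma measurable_boolset b : measurable_fun setT b -> measurable [set x | b x].
Proof.
move=> /(_ measurableT [set true]); rewrite setTI.
by rewrite (_ : b @^-1` _ = [set x | b x]) ?inE//; exact.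
Qed.

End MeasurableOperations.

Lemma mf_comp d1 d2 d3 (T1 : measurableType d1) (T2 : measurableType d2)
    (T3 : measurableType d3) (f : T2 -> T3) (g : T1 -> T2) :
  measurable_fun setT f -> measurable_fun setT g ->
  measurable_fun setT (fun x => f (g x)).
Proof. exact: measurableT_comp. Qed.

Lemma mf_comp2 d1 d2 d3 d4 (T1 : measurableType d1) (T2 : measurableType d2)
    (T3 : measurableType d3) (T4 : measurableType d4)
    (f : T2 -> T3 -> T4) (g : T1 -> T2) (h : T1 -> T3) :
  measurable_fun setT (fun p => f p.1 p.2) ->
  measurable_fun setT g -> measurable_fun setT h ->
  measurable_fun setT (fun x => f (g x) (h x)).
Proof.
move=> mf mg mh.
exact: (measurableT_comp mf (measurable_fun_pair mg mh)).
Qed.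

Lemma mf_fst d1 d2 d3 (T1 : measurableType d1) (T2 : measurableType d2)
    (T3 : measurableType d3) (g : T1 -> T2 * T3) :
  measurable_fun setT g -> measurable_fun setT (fun x => (g x).1).
Proof. exact: measurableT_comp measurable_fst. Qed.

Lemma mf_snd d1 d2 d3 (T1 : measurableType d1) (T2 : measurableType d2)
    (T3 : measurableType d3) (g : T1 -> T2 * T3) :
  measurable_fun setT g -> measurable_fun setT (fun x => (g x).2).
Proof. exact: measurableT_comp measurable_snd. Qed.

Lemma mf_pair d1 d2 d3 (T1 : measurableType d1) (T2 : measurableType d2)
    (T3 : measurableType d3) (g : T1 -> T2) (h : T1 -> T3) :
  measurable_fun setT g -> measurable_fun setT h ->
  measurable_fun setT (fun x => (g x, h x)).
Proof. by move=> mg mh; apply: measurable_fun_pair. Qed.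

Section Tonelli.
Context d1 d2 (T1 : measurableType d1) (T2 : measurableType d2) (R : realType).
Variable m1 : {sigma_finite_measure set T1 -> \bar R}.
Variable m2 : {sigma_finite_measure set T2 -> \bar R}.

Lemma mf_int (F : T1 -> T2 -> \bar R) :
  measurable_fun setT (fun p => F p.1 p.2) -> (forall x y, (0 <= F x y)%E) ->
  measurable_fun setT (fun x => \int[m2]_y F x y)%E.
Proof.
move=> mF F0.
exact: (@measurable_fun_fubini_tonelli_F _ _ _ _ _ m2 (fun p => F p.1 p.2)).
Qed.

Lemma tonelli (F : T1 -> T2 -> \bar R) :
  measurable_fun setT (fun p => F p.1 p.2) -> (forall x y, (0 <= F x y)%E) ->
  (\int[m1]_x \int[m2]_y F x y = \int[m2]_y \int[m1]_x F x y)%E.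
Proof.
by move=> mF F0; rewrite (@fubini_tonelli _ _ _ _ _ m1 m2 (fun p => F p.1 p.2)).
Qed.
End Tonelli.

(* Proves measurability structurally; leaves the non-negativity of inner integrands. *)
Ltac mf1 :=
  match goal with
  | |- measurable_fun _ (fun _ => ?c) => exact: measurable_cst
  | |- measurable_fun _ (fun x => x) => exact: measurable_id
  | |- measurable_fun _ (fun x => (_, _)) => apply: mf_pair
  | |- measurable_fun _ (fun x => fst _) => apply: mf_fst
  | |- measurable_fun _ (fun x => snd _) => apply: mf_snd
  | |- measurable_fun _ fst => exact: measurable_fst
  | |- measurable_fun _ snd => exact: measurable_snd
  | |- measurable_fun _ (fun x => EFin _) => apply: mf_EFin
  | |- measurable_fun _ (fun x => fine _) => apply: mf_fine
  | |- measurable_fun _ (fun x => Num.norm _) => apply: mf_norm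
  | |- measurable_fun _ (fun x => andb _ _) => apply: mf_and
  | |- measurable_fun _ (fun x => negb _) => apply: mf_neg
  | |- measurable_fun _ (fun x => mule _ _) => apply: mfeM
  | |- measurable_fun _ (fun x => GRing.mul _ _) => apply: mfM
  | |- measurable_fun _ (fun x => GRing.inv _) => apply: mfV
  | |- measurable_fun _ (fun x => GRing.opp _) => apply: mfN
  | |- measurable_fun _ (fun x => GRing.exp _ _) => apply: mfX
  | |- measurable_fun _ (fun x => Order.min _ _) => apply: mf_min
  | |- measurable_fun _ (fun x => Order.max _ _) => apply: mf_max
  | |- measurable_fun _ (fun x => Order.lt _ _) => apply: mf_lt
  | |- measurable_fun _ (fun x => Order.le _ _) => apply: mf_le
  | |- measurable_fun _ (fun x => GRing.natmul _ (nat_of_bool _)) => apply: mf_nat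
  | |- measurable_fun _ (fun x => GRing.add _ _) => first [apply: mfD | apply: mfeD]
  | |- measurable_fun _ (fun x => if _ then _ else _) => first [apply: mf_ifr | apply: mf_ife]
  | |- measurable_fun _ (fun x => integral _ _ _) => apply: mf_int
  | H : measurable ?S |- measurable_fun _ (fun x => in_mem _ (mem ?S')) =>
       constr_eq S S'; apply: (mf_comp (mf_mem H))
  | H : measurable_fun _ ?u |- measurable_fun _ ?v => constr_eq u v; exact: H
  | H : measurable_fun setT ?u |- measurable_fun _ (fun x => ?v _) =>
      constr_eq u v; apply: (mf_comp H)
  | H : measurable_fun setT (fun p => ?u p.1 p.2) |- measurable_fun _ (fun x => ?v _ _) =>
      constr_eq u v; apply: (mf_comp2 H)
  | H : measurable_fun setT (fun p => ?u p.1 p.2) |- measurable_fun _ (?v ?a) =>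
      constr_eq u v; exact: (mf_comp2 H (measurable_cst a) (@measurable_id _ _ _))
  | |- @measurable_fun _ _ ?T1 ?T2 ?A (?g ?a) => change (@measurable_fun _ _ T1 T2 A (fun x => g a x))
  end.
Ltac mf := repeat mf1.

Section IntegralTools.
Local Open Scope ereal_scope.
Context d (T : measurableType d) (R : realType) (m : {measure set T -> \bar R}).

(** No measurability enters, because the integral of a non-negative function is a supremum over the
    simple functions below it. This permits comparisons with the modular, whose integrand is never
    shown to be measurable here. *)
Lemma ge0_le_int (A : set T) (F G : T -> \bar R) : (forall x, A x -> 0 <= F x) ->
  (forall x, A x -> F x <= G x) ->
  \int[m]_(x in A) F x <= \int[m]_(x in A) G x.
Proof.
move=> F0 FG; have G0 x : A x -> 0 <= G x by move=> Ax; exact: le_trans (F0 _ Ax) (FG _ Ax).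
rewrite !ge0_integralE//; apply: ereal_sup_le => _ [h hF <-].
exists h => // x; apply: le_trans (hF x) _.
by rewrite /patch; case: ifP => // /set_mem; exact: FG.
Qed.

Lemma integral_mkind (A : set T) (F : T -> \bar R) :
  \int[m]_(x in A) F x = \int[m]_x ((x \in A)%:R%:E * F x).
Proof.
rewrite integral_mkcond; apply: eq_integral => x _; rewrite /patch.
by case: (x \in A); rewrite ?mul1e ?mul0e.
Qed.

Lemma integral_bool (b : T -> bool) : measurable_fun setT b ->
  \int[m]_x (b x)%:R%:E = m [set x | b x].
Proof.
move=> mb; have mB := measurable_boolset mb.
rewrite -[X in _ = m X]setIT -(integral_indic m measurableT mB).
apply: eq_integral => x _; rewrite indicE; congr (_%:R%:E).
by congr nat_of_bool; apply/idP/idP => [|/set_mem//] bx; exact/mem_set.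
Qed.

Lemma integralMl (k : R) (F : T -> \bar R) : (0 <= k)%R -> (forall x, 0 <= F x) ->
  measurable_fun setT F -> \int[m]_x (k%:E * F x) = k%:E * \int[m]_x F x.
Proof. by move=> k0 F0 mF; rewrite ge0_integralZl_EFin. Qed.

Lemma integralDT (F G : T -> \bar R) : (forall x, 0 <= F x) -> (forall x, 0 <= G x) ->
  measurable_fun setT F -> measurable_fun setT G ->
  \int[m]_x (F x + G x) = \int[m]_x F x + \int[m]_x G x.
Proof. by move=> F0 G0 mF mG; rewrite ge0_integralD. Qed.

Lemma integralMr (k : \bar R) (F : T -> \bar R) : 0 <= k -> (forall x, 0 <= F x) ->
  measurable_fun setT F -> \int[m]_x (F x * k) = \int[m]_x F x * k.
Proof. by move=> k0 F0 mF; rewrite ge0_integralZr. Qed.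

Lemma integral_bound_trans (f g h : T -> R) (a b c k : R) : (0 <= k)%R ->
  (forall x, 0 <= f x)%R -> (forall x, 0 <= g x)%R -> (forall x, 0 <= h x)%R ->
  measurable_fun setT g -> measurable_fun setT h ->
  (forall x, f x <= g x + k * h x)%R ->
  \int[m]_x (f x)%:E = a%:E -> \int[m]_x (g x)%:E = b%:E ->
  \int[m]_x (h x)%:E = c%:E -> (a <= b + k * c)%R.
Proof.
move=> k0 f0 g0 h0 mg mh fgh fa gb hc.
rewrite -lee_fin EFinD EFinM -fa -gb -hc -integralMl; first last.
- by mf.
- by move=> x; rewrite lee_fin.
- by [].
rewrite -integralDT; first last.
- by mf.
- by mf.
- by move=> x; rewrite -EFinM lee_fin mulr_ge0.
- by move=> x; rewrite lee_fin.
by apply: ge0_le_int => x _; rewrite ?lee_fin// -EFinM -EFinD lee_fin.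
Qed.

End IntegralTools.

(** * Young functions *)

(** Vanishing on the negative half-line makes [phi] monotone on all of R, hence Borel, and removes
    sign conditions from later statements. *)
Record young_on_R (R : realType) (phi : R -> R) : Prop := YoungOnR {
  phi_npos : forall t, t <= 0 -> phi t = 0;
  phi_ndecr : {homo phi : x y / x <= y};
  phi_pos : forall t, 0 < t -> 0 < phi t;
  phi_cvx : forall (a b t : R), 0 <= a -> 0 <= b -> 0 <= t -> t <= 1 ->
    phi (t * a + (1 - t) * b) <= t * phi a + (1 - t) * phi b }.

Section YoungFunction.
Context (R : realType) (phi : R -> R).
Hypothesis Yphi : young_on_R phi.

Lemma phi_ge0 t : 0 <= phi t.
Proof.
case: (leP t 0) => [/(phi_npos Yphi)->//|/(phi_pos Yphi)]; exact: ltW.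
Qed.

Lemma measurable_phi : measurable_fun setT phi.
Proof. by apply: nondecreasing_measurable => // x y xy; exact: phi_ndecr. Qed.

Lemma phi_scale k t : 0 <= k -> k <= 1 -> 0 <= t -> phi (k * t) <= k * phi t.
Proof.
move=> k0 k1 t0; have := phi_cvx Yphi t0 (lexx 0) k0 k1.
by rewrite !mulr0 !addr0 (phi_npos Yphi (lexx 0)) mulr0 addr0.
Qed.

(** Beyond 1 convexity gives phi 1 * t <= phi t, and below 1 the term phi 1 suffices. This linear
    growth yields local integrability from finite energy, and the unboundedness of [phi]. *)
Lemma phi_linear t : 0 <= t -> phi 1 * t <= phi 1 + phi t.
Proof.
move=> t0; have := phi_ge0 1; have := phi_ge0 t; case: (leP t 1) => t1; first by nra.
have t0' : 0 < t by lra.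
have : phi (t^-1 * t) <= t^-1 * phi t by apply: phi_scale; rewrite ?invr_ge0 ?invf_le1//; lra.
rewrite mulVf ?gt_eqF// => h; have : phi 1 * t <= phi t.
  by rewrite -ler_pdivlMr// mulrC.
lra.
Qed.

(** The slope is the supremum of the slopes of chords ending at s from the left; convexity bounds
    these by every chord slope to the right. At s = 0 a horizontal line works. *)
Lemma phi_supporting_line s : 0 <= s ->
  exists2 k, 0 <= k & forall t, 0 <= t -> phi s + k * (t - s) <= phi t.
Proof.
rewrite le_eqVlt => /orP[/eqP <-|s0].
  by exists 0 => // t t0; rewrite (phi_npos Yphi (lexx 0)) mul0r addr0 phi_ge0.
have slope a b : 0 <= a -> a < s -> s < b ->
    (phi s - phi a) / (s - a) <= (phi b - phi s) / (b - s).
  move=> a0 as_ sb.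
  have ba : 0 < b - a by lra.
  have h := @phi_cvx _ _ Yphi a b ((b - s) / (b - a)) a0 _ _ _.
  have : phi s <= (b - s) / (b - a) * phi a + (1 - (b - s) / (b - a)) * phi b.
    have -> : s = (b - s) / (b - a) * a + (1 - (b - s) / (b - a)) * b by field; lra.
    have := h; set k := (b - s) / (b - a).
    have <- : s = k * a + (1 - k) * b by rewrite /k; field; lra.
    apply; [lra| |]; rewrite /k ?divr_ge0//; try lra.
    by rewrite ler_pdivrMr//; lra.
  have -> : (b - s) / (b - a) * phi a + (1 - (b - s) / (b - a)) * phi b =
    ((b - s) * phi a + (s - a) * phi b) / (b - a) by field; lra.
  rewrite ler_pdivlMr// => {}h.
  by rewrite ler_pdivrMr ?subr_gt0// mulrAC ler_pdivlMr ?subr_gt0//; nra.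
pose A := [set (phi s - phi a) / (s - a) | a in [set a | 0 <= a < s]].
have A0 : A (phi s / s) by exists 0; rewrite /= ?lexx// (phi_npos Yphi (lexx 0)) !subr0.
have ubA b : s < b -> ubound A ((phi b - phi s) / (b - s)).
  by move=> sb _ [a /andP[a0 as_] <-]; exact: slope.
have hA : has_sup A.
  by split; [exists (phi s / s)|exists ((phi (s + 1) - phi s) / (s + 1 - s)); apply: ubA; lra].
exists (sup A).
  apply: le_trans (ub_le_sup hA.2 A0).
  by rewrite divr_ge0 ?phi_ge0// ltW.
move=> t t0; case: (ltgtP t s) => [ts|st|->]; last by rewrite subrr mulr0 addr0.
- have : (phi s - phi t) / (s - t) <= sup A.
    by apply: (ub_le_sup hA.2); exists t => //=; rewrite t0.
  by rewrite ler_pdivrMr ?subr_gt0//; nra.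
- have : sup A <= (phi t - phi s) / (t - s).
    by apply: ge_sup; [exact: hA.1|exact: ubA].
  by rewrite ler_pdivlMr ?subr_gt0//; nra.
Qed.

Section Jensen.
Context d (T : measurableType d) (m : {measure set T -> \bar R}).

(** Integrate the supporting line at s against [w]. A total mass below one is harmless: the line is
    non-positive at 0, that is k * s - phi s >= 0, so the missing mass has the right sign. *)
Lemma jensen (w f : T -> R) (s : R) :
  measurable_fun setT w -> measurable_fun setT f ->
  (forall x, 0 <= w x) -> (forall x, 0 <= f x) ->
  (\int[m]_x (w x)%:E <= 1)%E -> (\int[m]_x (w x * f x)%:E = s%:E)%E ->
  ((phi s)%:E <= \int[m]_x (w x * phi (f x))%:E)%E.
Proof.
move=> mw mf_ w0 f0 w1 ws.
have mphi := measurable_phi.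
have s0 : 0 <= s.
  by rewrite -lee_fin -ws; apply: integral_ge0 => x _; rewrite lee_fin mulr_ge0.
have [k k0 hk] := phi_supporting_line s0.
have ks : 0 <= k * s - phi s.
  by have := hk 0 (lexx _); rewrite (phi_npos Yphi (lexx 0)); lra.
have : (\int[m]_x (k%:E * (w x * f x)%:E) <= \int[m]_x ((w x * phi (f x))%:E +
    (k * s - phi s)%:E * (w x)%:E))%E.
  apply: ge0_le_int => x _; first by rewrite -EFinM lee_fin !mulr_ge0.
  rewrite -!EFinM -EFinD lee_fin; have := hk (f x) (f0 x); have := w0 x.
  by move=> w0x h; nra.
rewrite integralDT; first last.
- by mf.
- by mf.
- by move=> x; rewrite -EFinM lee_fin mulr_ge0.
- by move=> x; rewrite lee_fin mulr_ge0 ?phi_ge0.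
rewrite !integralMl ?ws//; first last.
- by mf.
- by move=> x; rewrite lee_fin mulr_ge0.
- by mf.
move=> h; rewrite -(@leeD2rE _ (k * s - phi s)%:E)//.
have -> : ((phi s)%:E + (k * s - phi s)%:E = k%:E * s%:E)%E.
  by rewrite -EFinD -EFinM; congr _%:E; ring.
apply: le_trans h _; rewrite leeD2l//.
rewrite -[leRHS]mule1; apply: lee_wpmul2l => //.
Qed.
End Jensen.

End YoungFunction.

(** * Spaces with the ball volumes of R^n *)

(* The volume (2 r)^n is that of a sup-norm ball of R^n. *)
Record ball_space d (X : measurableType d) (R : realType)
    (mu : {measure set X -> \bar R}) (D : X -> X -> R) (n : nat) : Prop := BallSpace {
  D_refl : forall x, D x x = 0;
  D_eq0 : forall x y, D x y = 0 -> x = y;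
  D_sym : forall x y, D x y = D y x;
  D_tri : forall y x z, D x z <= D x y + D y z;
  D_open : forall A : set X,
    (forall x, A x -> exists2 e, 0 < e & forall y, D x y < e -> A y) -> measurable A;
  D_meas : measurable_fun setT (fun p : X * X => D p.1 p.2);
  D_ball : forall x r, 0 < r -> mu [set y | D x y < r] = ((2 * r) ^+ n)%:E }.

Lemma exists_pow2 (R : realType) (a : R) : exists n, a < 2 ^+ n.
Proof.
have [n an] : exists n, a < n%:R.
  exists (Num.truncn a).+1; exact: truncnS_gt.
exists n; apply: lt_le_trans an _.
by rewrite -natrX ler_nat ltnW// ltn_expl.
Qed.

Lemma dyadic_scale (R : realType) (l t : R) : 0 < l -> l <= t ->
  exists k, 2 ^+ k * l <= t < 2 ^+ k.+1 * l.
Proof.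
move=> l0 lt; have [N] := exists_pow2 (t / l); rewrite ltr_pdivrMr// => hN.
have ex : exists k, t < 2 ^+ k * l by exists N.
case: (ex_minnP ex) => -[|k]; first by rewrite mul1r ltNge lt.
move=> tk mink; exists k; rewrite tk andbT leNgt; apply/negP => /mink.
by rewrite ltnn.
Qed.

Section BallSpace.
Local Open Scope ereal_scope.
Context d (X : measurableType d) (R : realType).
Context (mu : {sigma_finite_measure set X -> \bar R}) (D : X -> X -> R) (n : nat).
Hypothesis BS : ball_space mu D n.

Lemma D_ge0 x y : (0 <= D x y)%R.
Proof.
have := D_tri BS y x x; rewrite (D_refl BS) [X in (_ + X)%R](D_sym BS) => h; lra.
Qed.

Lemma integral_ball x r : (0 < r)%R ->
  \int[mu]_y (D x y < r)%R%:R%:E = ((2 * r) ^+ n)%:E.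
Proof.
move=> r0; have mD := D_meas BS; rewrite integral_bool; last by mf.
exact: (D_ball BS).
Qed.

(** The dyadic shell at radius 2^k r contributes at most 4^n r^(-n) 2^(-k n). As n > 0 this is
    dominated by a geometric series of ratio 1/2, which [epsilon_trick0] sums. *)
Lemma integral_tail x r : (0 < n)%N -> (0 < r)%R ->
  \int[mu]_y ((r <= D x y)%R%:R / D x y ^+ (2 * n))%:E <= (2 * 4 ^+ n / r ^+ n)%:E.
Proof.
move=> n0 r0; have mD := D_meas BS.
pose F k y := ((D x y < 2 ^+ k.+1 * r)%R%:R / (2 ^+ k * r) ^+ (2 * n))%:E.
have F0 k y : 0 <= F k y.
  by rewrite lee_fin divr_ge0// exprn_ge0// mulr_ge0 ?exprn_ge0// ltW.
apply: (@le_trans _ _ (\int[mu]_y \sum_(0 <= k <oo) F k y)).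
  apply: ge0_le_int => y _; first by rewrite lee_fin divr_ge0// exprn_ge0// D_ge0.
  case: (leP r (D x y)) => rD; last by rewrite mul0r; exact: nneseries_ge0.
  have [k /andP[k1 k2]] := dyadic_scale r0 rD.
  apply: le_trans (nneseries_lim_ge k.+1 (fun i _ _ => F0 i y)).
  rewrite big_nat_recr//= -[leLHS]add0e leeD ?sume_ge0// /F k2 lee_fin.
  rewrite !mul1r lef_pV2 ?posrE ?exprn_gt0//; last first.
  - by rewrite mulr_gt0// exprn_gt0.
  - exact: lt_le_trans rD.
  by rewrite lerXn2r// nnegrE; [rewrite mulr_ge0 ?exprn_ge0// ltW|exact: D_ge0].
rewrite integral_nneseries//; last by move=> k; rewrite /F; mf.
have FE k : \int[mu]_y F k y <= (2 * 4 ^+ n / r ^+ n / (2 ^ k.+1)%:R)%:E.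
  rewrite /F; under eq_integral do rewrite mulrC EFinM.
  rewrite integralMl//; first last.
  - by mf.
  - by rewrite invr_ge0 exprn_ge0// mulr_ge0 ?exprn_ge0// ltW.
  rewrite integral_ball ?mulr_gt0 ?exprn_gt0// -EFinM lee_fin.
  have -> : ((2 ^+ k * r) ^- (2 * n) * (2 * (2 ^+ k.+1 * r)) ^+ n =
      4 ^+ n / r ^+ n / (2 ^+ k) ^+ n)%R.
    rewrite exprS mulnC exprM !exprMn -[4%R]/((2 * 2)%:R) natrM exprMn.
    by field; rewrite !expf_neq0// gt_eqF.
  have -> : (2 * 4 ^+ n / r ^+ n / (2 ^ k.+1)%:R = 4 ^+ n / r ^+ n / 2 ^+ k)%R.
    by rewrite natrX exprS; field; rewrite !expf_neq0// gt_eqF.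
  apply: ler_wpM2l; first by rewrite divr_ge0 ?exprn_ge0// ltW.
  rewrite lef_pV2 ?posrE ?exprn_gt0//.
  by rewrite -[leLHS]expr1 ler_weXn2l ?exprn_ege1// ler1n.
apply: le_trans (lee_nneseries _ _) (epsilon_trick0 xpredT _).
- by move=> k _ _; apply: integral_ge0 => y _; exact: F0.
all: try by rewrite divr_ge0 ?exprn_ge0// ?mulr_ge0 ?exprn_ge0// ltW.
by move=> k _; exact: FE.
Qed.

Section Radial.
Context (phi : R -> R) (C : R).
Hypothesis Yphi : young_on_R phi.
Hypothesis growth : forall t, (0 < t)%R ->
  \int[lebesgue_measure]_(s in `]0%R, t[) (phi s / s ^+ n / s)%:E <=
  (C * phi t / t ^+ n)%:E.

Let mphi := measurable_phi Yphi.

Lemma growth_ge0 : (0 <= C)%R.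
Proof.
have := growth ltr01; rewrite expr1n divr1 => h.
have : (0 <= C * phi 1)%R.
  rewrite -lee_fin; apply: le_trans h; apply: integral_ge0 => s /=.
  rewrite in_itv/= => /andP[s0 _]; rewrite lee_fin !divr_ge0 ?(phi_ge0 Yphi) ?exprn_ge0// ltW//.
by rewrite pmulr_lge0// (phi_pos Yphi).
Qed.

(** Monotonicity replaces a point value by an integral over the interval from t to 2 t, to which
    Tonelli's theorem can be applied. The price is that phi is later evaluated at 2 a instead of
    a. *)
Lemma phi_dyadic_average (t : R) : (0 < t)%R -> (phi t / t ^+ (2 * n))%:E <=
  (2 ^+ (2 * n).+1)%:E * \int[lebesgue_measure]_(s in `]t, (2 * t)%R[)
     (phi s / s ^+ (2 * n).+1)%:E.
Proof.
move=> t0.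
have h :
    \int[lebesgue_measure]_(s in `]t, (2 * t)%R[) (phi t / (2 * t) ^+ (2 * n).+1)%:E <=
    \int[lebesgue_measure]_(s in `]t, (2 * t)%R[) (phi s / s ^+ (2 * n).+1)%:E.
  apply: ge0_le_int => s; rewrite /= in_itv/= => /andP[ts st].
    by rewrite lee_fin divr_ge0 ?(phi_ge0 Yphi)// exprn_ge0// mulr_ge0// ltW.
  have s0 : (0 < s)%R by exact: lt_trans ts.
  rewrite lee_fin ler_pM//.
  - exact: (phi_ge0 Yphi).
  - by rewrite invr_ge0 exprn_ge0// mulr_ge0// ltW.
  - exact/(phi_ndecr Yphi)/ltW.
  - by rewrite lef_pV2 ?posrE ?exprn_gt0 ?mulr_gt0// lerXn2r// ?nnegrE ltW// ?mulr_gt0.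
have K0 : 0 <= (2 ^+ (2 * n).+1 : R)%:E by rewrite lee_fin exprn_ge0.
apply: le_trans (lee_wpmul2l K0 h).
rewrite integral_cst//= lebesgue_measure_itv/= lte_fin ifT; last by lra.
rewrite -EFinD -!EFinM lee_fin le_eqVlt; apply/orP; left; apply/eqP.
rewrite exprMn [(t ^+ _.+1)%R]exprS; field.
by rewrite !expf_neq0// gt_eqF.
Qed.

(** A substitute for polar coordinates. With b = a / r, [phi_dyadic_average] at b D(x,y) turns the
    integrand into an integral over s > b D(x,y); after exchanging the order, the integral in y is
    the volume (2 s / b)^n of a ball, and what remains is the growth integral up to 2 a. *)
Lemma integral_radial x (a r : R) : (0 <= a)%R -> (0 < r)%R ->
  \int[mu]_y ((D x y < r)%R%:R * (phi (a * (D x y / r)) / D x y ^+ (2 * n)))%:E <=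
  (2 ^+ (2 * n).+1 * C * phi (2 * a) / r ^+ n)%:E.
Proof.
move=> a0 r0; have mD := D_meas BS.
move: a0; rewrite le_eqVlt => /orP[/eqP <-|a0].
  rewrite integral0_eq; first by rewrite mulr0 (phi_npos Yphi (lexx _)) mulr0 mul0r.
  by move=> y _; rewrite mul0r (phi_npos Yphi (lexx _)) mul0r mulr0.
set K := (2 ^+ (2 * n).+1)%R; have K0 : (0 <= K)%R by exact: exprn_ge0.
have [b bE b0] : exists2 b, (b = a / r)%R & (0 < b)%R.
  by exists (a / r)%R => //; exact: divr_gt0.
pose G (s : R) := ((0 < s < 2 * a)%R%:R * (phi s / s ^+ (2 * n).+1))%R.
have G0 s : (0 <= G s)%R.
  rewrite /G; case: (ltP 0%R s) => [s0|_]; rewrite ?mul0r//=.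
  by rewrite mulr_ge0// divr_ge0 ?(phi_ge0 Yphi)// exprn_ge0// ltW.
have mG : measurable_fun setT G by rewrite /G; mf.
apply: (@le_trans _ _ (\int[mu]_y ((K * b ^+ (2 * n))%:E *
    \int[lebesgue_measure]_s ((b * D x y < s)%R%:R * G s)%:E))).
  apply: ge0_le_int => y _.
    by rewrite lee_fin mulr_ge0// divr_ge0 ?(phi_ge0 Yphi)// exprn_ge0// D_ge0.
  have R0 : 0 <= (K * b ^+ (2 * n))%:E *
    \int[lebesgue_measure]_s ((b * D x y < s)%R%:R * G s)%:E.
    rewrite mule_ge0 ?lee_fin ?mulr_ge0 ?exprn_ge0 ?(ltW b0)//.
    by apply: integral_ge0 => s _; rewrite lee_fin mulr_ge0.
  case: (ltP (D x y) r) => Dr; last by rewrite mul0r.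
  rewrite mul1r; have := D_ge0 x y; rewrite le_eqVlt => /orP[/eqP D0|D0].
    by move: R0; rewrite -D0 mul0r mulr0 (phi_npos Yphi (lexx 0%R)) mul0r; apply.
  have -> : (a * (D x y / r) = b * D x y)%R by rewrite bE; ring.
  have -> : (phi (b * D x y) / D x y ^+ (2 * n) =
      b ^+ (2 * n) * (phi (b * D x y) / (b * D x y) ^+ (2 * n)))%R.
    by rewrite exprMn invfM !mulrA (mulrAC (b ^+ _)%R) divff ?mul1r// expf_neq0// gt_eqF.
  rewrite EFinM [(K * _)%R]mulrC [X in _ <= X * _]EFinM.
  rewrite -muleA lee_wpmul2l ?lee_fin ?exprn_ge0 ?(ltW b0)//.
  apply: le_trans (phi_dyadic_average (mulr_gt0 b0 D0)) _.
  rewrite lee_wpmul2l ?lee_fin// integral_mkind.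
  apply: ge0_le_int => s _; rewrite mem_setE /= in_itv/= -EFinM lee_fin.
    case: (ltP (b * D x y)%R s) => /= [bs|_]; last by rewrite mul0r.
    have s0 : (0 < s)%R by apply: lt_trans bs; exact: mulr_gt0.
    by rewrite mulr_ge0// divr_ge0 ?(phi_ge0 Yphi)// exprn_ge0// ltW.
  case: (ltP (b * D x y)%R s) => /= [bs|_]; last by rewrite !mul0r.
  have s0 : (0 < s)%R by apply: lt_trans bs; exact: mulr_gt0.
  case: (ltP s) => /= [sb|_]; rewrite ?mul0r mul1r//.
  rewrite mul1r /G s0 /= (lt_trans sb) ?mul1r//.
  by rewrite ltr_pM2l// bE -mulrA gtr_pMr// mulrC ltr_pdivrMr// mul1r.
have H0 y s : 0 <= ((b * D x y < s)%R%:R * G s)%:E by rewrite lee_fin mulr_ge0.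
rewrite integralMl; first last.
- by mf.
- by move=> y; apply: integral_ge0.
- by rewrite mulr_ge0// exprn_ge0// ltW.
rewrite tonelli//; last by mf.
have -> : \int[lebesgue_measure]_s \int[mu]_y ((b * D x y < s)%R%:R * G s)%:E =
    \int[lebesgue_measure]_s (((2 / b) ^+ n)%:E *
     ((s \in `]0%R, (2 * a)%R[%classic)%:R%:E * (phi s / s ^+ n / s)%:E)).
  apply: eq_integral => s _; under eq_integral do rewrite EFinM.
  rewrite integralMr ?lee_fin//; last by mf.
  rewrite mem_setE /= in_itv/= -!EFinM /G.
  case: (ltP 0%R s) => s0 /=; last by rewrite !mul0r mule0 mulr0.
  have -> : \int[mu]_y ((b * D x y < s)%R%:R)%:E = ((2 * (s / b)) ^+ n)%:E.
    rewrite -(integral_ball x) ?divr_gt0//; apply: eq_integral => y _.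
    by rewrite ltr_pdivlMr// mulrC.
  rewrite -EFinM; congr EFin.
  case: (s < 2 * a)%R; rewrite ?mul0r ?mulr0//= !mul1r.
  rewrite exprS (mulnC 2%N) muln2 -addnn exprD !exprMn !exprVn; field.
  by rewrite ?expf_neq0// gt_eqF.
have mI : measurable (`]0%R, (2 * a)%R[%classic : set R) by exact: measurable_itv.
have I0 s : 0 <= (s \in `]0%R, (2 * a)%R[%classic)%:R%:E * (phi s / s ^+ n / s)%:E.
  rewrite mem_setE /= in_itv/= -EFinM lee_fin; case: (ltP 0%R s) => s0 /=; last by rewrite mul0r.
  by rewrite mulr_ge0// !divr_ge0 ?(phi_ge0 Yphi)// ?exprn_ge0// ltW.
rewrite integralMl//; first last.
- by mf.
- by rewrite exprn_ge0// divr_ge0// ltW.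
rewrite -integral_mkind muleA -EFinM.
apply: le_trans (lee_wpmul2l _ (growth _)) _.
- by rewrite lee_fin !mulr_ge0// ?exprn_ge0// ?divr_ge0 ?(ltW b0)// ltW.
- by rewrite mulr_gt0.
rewrite -EFinM lee_fin le_eqVlt; apply/orP; left; apply/eqP.
have E : (b ^+ (2 * n) * (2 / b) ^+ n * (C * phi (2 * a) / (2 * a) ^+ n) =
    C * phi (2 * a) * (b / a) ^+ n)%R.
  rewrite mul2n -addnn exprD !exprMn !exprVn; field.
  by rewrite !expf_neq0// gt_eqF.
have -> : (r ^- n = (b / a) ^+ n)%R by rewrite bE mulrAC divff ?gt_eqF// mul1r exprVn.
transitivity (K * (b ^+ (2 * n) * (2 / b) ^+ n * (C * phi (2 * a) / (2 * a) ^+ n)))%R.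
  by rewrite !mulrA.
by rewrite E !mulrA.
Qed.

End Radial.
End BallSpace.

(** * Distance to an open set, and its null boundary *)

Section Distance.
Context d (X : measurableType d) (R : realType).
Context (mu : {sigma_finite_measure set X -> \bar R}) (D : X -> X -> R) (n : nat).
Hypothesis BS : ball_space mu D n.
Implicit Types (A S : set X) (x y z : X) (r : R).

Definition metric_open A := forall x, A x -> exists2 e, 0 < e & forall y, D x y < e -> A y.

Definition setdist S x : R := inf [set D x s | s in S].

Let dset S x := [set D x s | s in S].

Lemma has_inf_dset S x : S !=set0 -> has_inf (dset S x).
Proof.
by move=> [s Ss]; split; [exists (D x s); exists s|exists 0 => _ [z _ <-]; exact: (D_ge0 BS)].
Qed.

Section NonemptySet.
Context (S : set X).
Hypothesis S0 : S !=set0.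

Lemma setdist_le x s : S s -> setdist S x <= D x s.
Proof. by move=> Ss; apply: ge_inf; [exact: (has_inf_dset x S0).2|exists s]. Qed.

Lemma setdist_ge0 x : 0 <= setdist S x.
Proof.
by apply: lb_le_inf; [exact: (has_inf_dset x S0).1|move=> _ [z _ <-]; exact: (D_ge0 BS)].
Qed.

Lemma setdist_lt x r : setdist S x < r -> exists2 s, S s & D x s < r.
Proof. by move=> /(inf_lt (has_inf_dset x S0).1) [_ [s Ss <-]] sr; exists s. Qed.

Lemma setdist_in x : S x -> setdist S x = 0.
Proof.
by move=> Sx; apply/eqP; rewrite eq_le setdist_ge0 andbT -(D_refl BS x) setdist_le.
Qed.

Lemma setdist_tri x y : setdist S x <= D x y + setdist S y.
Proof.
rewrite -lerBlDl; apply: lb_le_inf; first exact: (has_inf_dset y S0).1.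
by move=> _ [s Ss <-]; rewrite lerBlDl (le_trans (setdist_le x Ss))// (D_tri BS).
Qed.

Lemma measurable_setdist : measurable_fun setT (setdist S).
Proof.
apply: (measurability (@RGenInftyO.G R)); first exact: RGenInftyO.measurableE.
move=> _ [_ [r ->] <-]; rewrite setTI; apply: (D_open BS) => x /=.
rewrite in_itv/= => xr; exists (r - setdist S x); first by rewrite subr_gt0.
move=> y xy; rewrite in_itv/=; apply: le_lt_trans (setdist_tri y x) _.
by rewrite -ltrBrDr (D_sym BS).
Qed.

Lemma measurable_metric_open A : metric_open A -> measurable A.
Proof. exact: (D_open BS). Qed.

(** Unlike Ahlfors regularity, this asks for the bound at every scale r > 0, with no restriction by
    the diameter, and in the distance D. *)
Definition inner_regular (c : R) := forall x r, S x -> 0 < r ->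
  ((c * r ^+ n)%:E <= mu [set y | (D x y < r)%R /\ S y])%E.

Context (c : R).
Hypothesis c0 : 0 < c.
Hypothesis oS : metric_open S.
Hypothesis rS : inner_regular c.

Lemma mball x r : measurable [set y | D x y < r].
Proof. by have mD := D_meas BS; apply: measurable_boolset; mf. Qed.

Let bd_part x0 (k : R) := [set x | [/\ setdist S x = 0, ~ S x & D x0 x < k]].

Let measurable_bd_part x0 k : measurable (bd_part x0 k).
Proof.
rewrite (_ : bd_part x0 k = (setdist S @^-1` [set 0] `\` S) `&` [set x | D x0 x < k]).
  apply: measurableI; last exact: mball.
  apply: measurableD; last exact: measurable_metric_open.
  by rewrite -[X in measurable X]setTI; apply: measurable_setdist.
by apply/seteqP; split=> x /=; [case|move=> [[]]].
Qed.

(** A substitute for the density theorem. Count pairs of x in F and y in G r, the part of S within r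
    of F, with D x y < r: regularity at radius r / 2 bounds the count below by a multiple of r^n mu
    F, and the ball volume bounds it above by a multiple of r^n mu (G r). Since S is open and
    disjoint from F, the sets G r decrease to the empty set, so mu F = 0. *)
Lemma boundary_part_null x0 k : mu (bd_part x0 k) = 0%E.
Proof.
set F := bd_part x0 k; have mF : measurable F := measurable_bd_part x0 k.
have mD := D_meas BS.
pose G (r : R) := [set y | S y /\ exists2 x, F x & D x y < r].
have mG r : measurable (G r).
  apply: measurable_metric_open => y [Sy [x Fx xr]]; have [e e0 he] := oS Sy.
  exists (Num.min e (r - D x y)); first by rewrite lt_min e0 subr_gt0.
  move=> z; rewrite lt_min => /andP[/he Sz yz]; split=> //; exists x => //.
  by apply: le_lt_trans (D_tri BS y _ _) _; rewrite -ltrBrDl.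
have key r : 0 < r -> ((c / 4 ^+ n)%:E * mu F <= mu (G r))%E.
  move=> r0.
  have r2 : 0 < r / 2 by lra.
  have cr0 : 0 <= c * (r / 2) ^+ n by rewrite mulr_ge0 ?exprn_ge0 ?(ltW r2) ?(ltW c0).
  have r20 : 0 <= (2 * r) ^+ n by apply: exprn_ge0; lra.
  have lower : ((c * (r / 2) ^+ n)%:E * mu F <=
      \int[mu]_x \int[mu]_y (((x \in F) && ((D x y < r) && (y \in G r)))%:R)%:E)%E.
    rewrite -[X in mu X]setIT -(integral_indic mu measurableT mF) -integralMl; first last.
    - by apply/measurable_EFinP; exact: measurable_indic.
    - by move=> x; rewrite lee_fin indicE.
    - exact: cr0.
    apply: ge0_le_int => x _.
      by apply: mule_ge0; rewrite lee_fin// indicE.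
    rewrite indicE; case: (boolP (x \in F)) => [|_]; last first.
      by rewrite mule0; apply: integral_ge0 => y _; rewrite lee_fin.
    move=> /set_mem Fx; have [dx Sx _] := Fx; rewrite mule1 /=.
    have [s Ss xs] : exists2 s, S s & D x s < r / 2.
      by apply: setdist_lt; rewrite dx divr_gt0.
    apply: (le_trans (rS Ss r2)).
    rewrite integral_bool; last by have := mG r; move: (G r) => Gr mGr; mf.
    apply: le_measure; rewrite ?inE.
    - rewrite (_ : mkset _ = [set y | D s y < r / 2] `&` S)//.
      by apply: measurableI; [exact: mball|exact: measurable_metric_open].
    - by apply: measurable_boolset; have := mG r; move: (G r) => Gr mGr; mf.
    move=> y [sy Sy] /=.
    have xy : D x y < r by apply: le_lt_trans (D_tri BS s _ _) _; lra.
    by rewrite xy /=; apply/mem_set; split=> //; exists x.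
  have upper : (\int[mu]_y \int[mu]_x (((x \in F) && ((D x y < r) && (y \in G r)))%:R)%:E
      <= ((2 * r) ^+ n)%:E * mu (G r))%E.
    rewrite -[X in (_ * mu X)%E]setIT -(integral_indic mu measurableT (mG r)) -integralMl; first last.
    - by apply/measurable_EFinP; exact: measurable_indic.
    - by move=> x; rewrite lee_fin indicE.
    - exact: r20.
    apply: ge0_le_int => y _; first by apply: integral_ge0 => x _; rewrite lee_fin.
    rewrite indicE; case: (boolP (y \in G r)) => [_|_]; last first.
      by rewrite mule0 integral0_eq// => x _; rewrite !andbF.
    rewrite mule1 -(integral_ball BS y r0); apply: ge0_le_int => x _; first by rewrite lee_fin.
    by rewrite lee_fin ler_nat andbT (D_sym BS); case: (x \in F).
  have := @tonelli _ _ _ _ _ mu mu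
     (fun x y => ((x \in F) && ((D x y < r) && (y \in G r)))%:R%:E).
  move=> /(_ ltac:(by have := mG r; move: (G r) => Gr mGr; mf) ltac:(by move=> *; rewrite lee_fin)) E.
  rewrite E in lower; have {lower upper} := le_trans lower upper; move=> {E}.
  have -> : c * (r / 2) ^+ n = (2 * r) ^+ n * (c / 4 ^+ n).
    have -> : (4 = 2 * 2 :> R) by lra.
    by rewrite !exprMn exprVn; field; rewrite expf_neq0.
  rewrite EFinM -muleA lee_pmul2l//.
  by rewrite lte_fin exprn_gt0// mulr_gt0.
have G0 : \bigcap_j G (j.+1%:R^-1) = set0.
  apply/seteqP; split=> // y Gy.
  have [Sy _] := Gy 0%N I; have [e e0 he] := oS Sy.
  have [j _ /(_ j (leqnn j)) /= je] := near_infty_natSinv_lt (PosNum e0).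
  have [_ [x [_ nSx _] xy]] := Gy j I.
  by apply: nSx; apply: he; rewrite (D_sym BS); exact: lt_trans xy je.
have Gdecr : {homo (fun j => G (j.+1%:R^-1)) : m l / (m <= l)%N >-> (l <= m)%O}.
  move=> m l ml; apply/subsetPset => y [Sy [x Fx xy]]; split=> //; exists x => //.
  by apply: lt_le_trans xy _; rewrite lef_pV2 ?posrE// ler_nat.
have Gfin : (mu (G (1%:R^-1)%R) < +oo)%E.
  apply: (@le_lt_trans _ _ (mu [set y | (D x0 y < `|k| + 1)%R])).
    apply: le_measure; rewrite ?inE//; first exact: mball.
    move=> y [_ [x [_ _ xk] xy]] /=; apply: le_lt_trans (D_tri BS x _ _) _.
    rewrite invr1 in xy; have := ler_norm k; lra.
  by rewrite (D_ball BS) ?ltry// ltr_wpDl.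
have cv : mu (G j.+1%:R^-1) @[j --> \oo] --> 0%E.
  rewrite -(measure0 mu) -G0; apply: nonincreasing_cvg_mu => //.
  by rewrite G0.
have : ((c / 4 ^+ n)%:E * mu F <= 0)%E.
  by apply: (cvge_ge _ cv); apply: nearW => j; apply: key; rewrite invr_gt0.
rewrite pmule_rle0; last by rewrite lte_fin divr_gt0// exprn_gt0.
by move=> F0; apply/eqP; rewrite eq_le F0 measure_ge0.
Qed.

Lemma boundary_null : mu [set x | setdist S x = 0 /\ ~ S x] = 0%E.
Proof.
have [x0 _] := S0.
apply/eqP; rewrite eq_le measure_ge0 andbT.
have sub : [set x | setdist S x = 0 /\ ~ S x] `<=` \bigcup_k bd_part x0 k%:R.
  by move=> x [x1 x2]; exists (Num.truncn (D x0 x)).+1 => //; split => //; exact: truncnS_gt.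
have mB : measurable [set x | setdist S x = 0 /\ ~ S x].
  rewrite (_ : mkset _ = setdist S @^-1` [set 0] `\` S)//.
  apply: measurableD; last exact: measurable_metric_open.
  by rewrite -[X in measurable X]setTI; apply: measurable_setdist.
apply: (le_trans (measure_sigma_subadditive mu (fun k => measurable_bd_part x0 k%:R) mB sub)).
by rewrite eseries0// => k _ _; exact: boundary_part_null.
Qed.

End NonemptySet.
End Distance.

(** * Reflection kernel *)

Section Clamp.
Context (R : realType).
Implicit Types s t : R.

Definition clamp t : R := Num.max 0 (Num.min 1 (2 - t)).

Lemma clamp_ge0 t : 0 <= clamp t. Proof. by rewrite /clamp le_max lexx. Qed.

Lemma clamp_le1 t : clamp t <= 1.
Proof. by rewrite /clamp ge_max ler01 ge_min lexx. Qed.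

Lemma clamp1 t : t <= 1 -> clamp t = 1.
Proof. by move=> t1; rewrite /clamp min_l ?max_r//; lra. Qed.

Lemma clamp0 t : 2 <= t -> clamp t = 0.
Proof. by move=> t2; rewrite /clamp min_r ?max_l//; lra. Qed.

Lemma clamp_cases t : [\/ t <= 1 /\ clamp t = 1, 2 <= t /\ clamp t = 0 |
  [/\ 1 < t, t < 2 & clamp t = 2 - t]].
Proof.
case: (leP t 1) => t1; first by constructor 1; rewrite clamp1.
case: (leP 2 t) => t2; first by constructor 2; rewrite clamp0.
by constructor 3; split=> //; rewrite /clamp min_r ?max_r//; lra.
Qed.

Lemma clamp_lip s t : `|clamp s - clamp t| <= `|s - t|.
Proof.
have [[? ->]|[? ->]|[? ? ->]] := clamp_cases s;
have [[? ->]|[? ->]|[? ? ->]] := clamp_cases t;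
case: (leP 0 (s - t)) => h; rewrite ?(ger0_norm h) ?(ltr0_norm h); rewrite ler_norml; lra.
Qed.

Lemma clamp_nincr s t : s <= t -> clamp t <= clamp s.
Proof.
have [[? ->]|[? ->]|[? ? ->]] := clamp_cases s;
have [[? ->]|[? ->]|[? ? ->]] := clamp_cases t; lra.
Qed.

Lemma measurable_clamp : measurable_fun setT clamp.
Proof. by rewrite /clamp; mf. Qed.

End Clamp.

Section Kernel.
Context d (X : measurableType d) (R : realType).
Context (mu : {sigma_finite_measure set X -> \bar R}) (D : X -> X -> R) (n : nat).
Hypothesis BS : ball_space mu D n.
Context (S : set X) (c : R).
Hypothesis S0 : S !=set0.
Hypothesis c0 : 0 < c.
Hypothesis oS : metric_open D S.
Hypothesis rS : inner_regular mu D n S c.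
Implicit Types (x y z : X) (r : R).

Local Notation dist := (setdist D S).
Let mD := D_meas BS.
Let mdist := measurable_setdist BS S0.
Let mclamp := @measurable_clamp R.
Let mS : measurable S := measurable_metric_open BS oS.
Let dist0 x : 0 <= dist x := setdist_ge0 BS S0 x.

Definition wkernel y z : R := (D y z < 3 * dist y)%R%:R / dist y ^+ n.
(** The charge put on z by the points at distance up to about r from S, before thinning. The [clamp]
    in place of an indicator makes it Lipschitz in r, which [thin] passes on to the kernel. *)
Definition load z r : \bar R := (\int[mu]_y (wkernel y z * clamp (dist y / r))%:E)%E.
(** Chosen so that 96^n / load_bound = mass_const: by [load_average] and Chebyshev, points of larger
    load take away at most half of c (r / 2)^n. *)
Definition load_bound : R := 2 * 192 ^+ n / c.
Definition thin x z : R := clamp (fine (load z (dist x)) / load_bound).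
(** The radial factor is 1 for D x z <= 2 dist x and 0 from 3 dist x on. The test 0 < dist x removes
    points of the closure of S, where the quotients would be divisions by zero. *)
Definition weight x z : R :=
  ((0 < dist x) && (z \in S))%R%:R * (clamp (D x z / dist x - 1) * thin x z).
Definition mass x : R := fine (\int[mu]_z (weight x z)%:E)%E.
Definition pkernel x z : R := weight x z / mass x.

Lemma weightE x z : 0 < dist x ->
  weight x z = (z \in S)%:R * (clamp (D x z / dist x - 1) * thin x z).
Proof. by move=> dx; rewrite /weight dx. Qed.

Lemma load_bound_gt0 : 0 < load_bound.
Proof. by rewrite /load_bound divr_gt0// mulr_gt0// exprn_gt0. Qed.

Lemma wkernel_ge0 y z : 0 <= wkernel y z.
Proof. by rewrite /wkernel divr_ge0// exprn_ge0. Qed.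

Lemma measurable_wkernel : measurable_fun setT (fun p : X * X => wkernel p.1 p.2).
Proof. by rewrite /wkernel; mf. Qed.
Let mw := measurable_wkernel.

Let load_fun_ge0 y z r : 0 <= wkernel y z * clamp (dist y / r).
Proof. by rewrite mulr_ge0 ?wkernel_ge0 ?clamp_ge0. Qed.

Lemma load_ge0 z r : (0 <= load z r)%E.
Proof. by apply: integral_ge0 => y _; rewrite lee_fin. Qed.

Lemma measurable_load : measurable_fun setT (fun p : X * R => load p.1 p.2).
Proof. by rewrite /load; mf => p y; rewrite lee_fin. Qed.

Let mload := measurable_load.

Lemma wkernel_gt0_lt y z : wkernel y z != 0 -> D y z < 3 * dist y /\ 0 < dist y.
Proof.
rewrite /wkernel; case: ltP => [h _|_]; last by rewrite mul0r eqxx.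
by split=> //; have := D_ge0 BS y z; lra.
Qed.

(** If the ball of radius e at z lies in S, any y charging z is outside S, hence e <= D z y < 3 dist
    y. This bounds the kernel by (e / 3)^(-n), and the clamp confines y to the ball of radius 6
    r. *)
Lemma load_fin z r : S z -> 0 < r -> load z r \is a fin_num.
Proof.
move=> Sz r0; rewrite ge0_fin_numE ?load_ge0//.
have [e e0 he] := oS Sz.
apply: (@le_lt_trans _ _ (\int[mu]_y (((e / 3) ^+ n)^-1%:E * (D z y < 6 * r)%R%:R%:E)))%E.
  apply: ge0_le_int => y _; first by rewrite lee_fin.
  rewrite -EFinM lee_fin.
  have [->|w0] := eqVneq (wkernel y z) 0.
    by rewrite mul0r mulr_ge0// invr_ge0 exprn_ge0// divr_ge0// ltW.
  have [yz dy] := wkernel_gt0_lt w0.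
  have [yr|ry] := ltP (dist y / r) 2; last first.
    by rewrite clamp0// mulr0 mulr_ge0// invr_ge0 exprn_ge0// divr_ge0// ltW.
  move: yr; rewrite ltr_pdivrMr// => yr.
  have ed : e <= 3 * dist y.
    rewrite leNgt; apply/negP => de.
    have Sy : S y by apply: he; rewrite (D_sym BS); lra.
    by move: dy; rewrite (setdist_in BS S0 Sy) ltxx.
  rewrite (D_sym BS z) (_ : D y z < 6 * r); last by lra.
  rewrite mulr1 -[leRHS]mulr1 ler_pM ?clamp_ge0 ?clamp_le1 ?wkernel_ge0//.
  rewrite /wkernel yz mul1r lef_pV2 ?posrE ?exprn_gt0//; last by lra.
  by rewrite lerXn2r// ?nnegrE//; lra.
rewrite integralMl; first last.
- by mf.
- by move=> y; rewrite lee_fin.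
- by rewrite invr_ge0 exprn_ge0// divr_ge0// ltW.
by rewrite (integral_ball BS) ?mulr_gt0// -EFinM ltry.
Qed.

Lemma load_ndecr z r r' : 0 < r -> r <= r' -> (load z r <= load z r')%E.
Proof.
move=> r0 rr'; apply: ge0_le_int => y _; rewrite lee_fin//.
apply: ler_wpM2l; first exact: wkernel_ge0.
apply: clamp_nincr; apply: ler_wpM2l => //.
by rewrite lef_pV2// posrE; lra.
Qed.

(** The two clamps differ only for r < dist y < 2 r'. There the difference is at most a multiple of
    (r' - r) / r, the kernel is at most r^(-n), and y lies within 12 r of z. *)
Lemma load_lip z r r' : 0 < r -> r <= r' -> r' <= 2 * r ->
  (load z r' <= load z r + (4 * 24 ^+ n * ((r' - r) / r))%:E)%E.
Proof.
move=> r0 rr' r'2.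
have q0 : 0 <= 4 * ((r' - r) / r) / r ^+ n.
  by rewrite divr_ge0 ?exprn_ge0 ?(ltW r0)// mulr_ge0// divr_ge0 ?(ltW r0)//; lra.
apply: (@le_trans _ _ (\int[mu]_y ((wkernel y z * clamp (dist y / r))%:E +
   (4 * ((r' - r) / r) / r ^+ n)%:E * (D z y < 12 * r)%R%:R%:E)))%E.
  apply: ge0_le_int => y _; first by rewrite lee_fin.
  rewrite -EFinM -EFinD lee_fin.
  have [->|w0] := eqVneq (wkernel y z) 0; first by rewrite !mul0r add0r mulr_ge0.
  have [yz dy] := wkernel_gt0_lt w0.
  rewrite -lerBlDl -mulrBr.
  have [yr|yr] := leP (dist y) r.
    rewrite !clamp1; first by rewrite subrr mulr0; apply: mulr_ge0.
    - by rewrite ler_pdivrMr; lra.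
    - by rewrite ler_pdivrMr; lra.
  have [ry|ry] := leP (2 * r') (dist y).
    rewrite !clamp0; first by rewrite subrr mulr0; apply: mulr_ge0.
    - by rewrite ler_pdivlMr; lra.
    - by rewrite ler_pdivlMr; lra.
  rewrite (D_sym BS z) (_ : D y z < 12 * r) ?mulr1; last by lra.
  rewrite mulrC; apply: ler_pM.
  - by rewrite subr_ge0; apply: clamp_nincr; apply: ler_wpM2l => //; rewrite lef_pV2// posrE; lra.
  - exact: wkernel_ge0.
  - apply: (le_trans (ler_norm _)); apply: (le_trans (clamp_lip _ _)).
    rewrite distrC ger0_norm; last first.
      by rewrite subr_ge0; apply: ler_wpM2l => //; rewrite lef_pV2// posrE; lra.
    rewrite -(@ler_pM2r _ (r * r')) ?mulr_gt0//; last by lra.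
    have -> : (dist y / r - dist y / r') * (r * r') = dist y * (r' - r) by field; lra.
    have -> : 4 * ((r' - r) / r) * (r * r') = 4 * r' * (r' - r) by field; lra.
    by apply: ler_wpM2r; lra.
  - rewrite /wkernel yz mul1r lef_pV2 ?posrE ?exprn_gt0//.
    by rewrite lerXn2r// ?nnegrE//; lra.
rewrite integralDT; first last.
- by mf.
- by mf.
- by move=> y; rewrite -EFinM lee_fin mulr_ge0.
- by move=> y; rewrite lee_fin.
rewrite leeD2l// integralMl//; first last.
- by mf.
rewrite (integral_ball BS) ?mulr_gt0// -EFinM lee_fin mulrA -(mulrA _ (r ^+ n)^-1).
have -> : 2 * (12 * r) = 24 * r by ring.
rewrite exprMn mulrCA mulrC le_eqVlt; apply/orP; left; apply/eqP; field.
by rewrite expf_neq0// ?gt_eqF//.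
Qed.

Lemma load_lower z r : 0 < r ->
  (\int[mu]_y (wkernel y z * (dist y <= r)%R%:R)%:E <= load z r)%E.
Proof.
move=> r0; apply: ge0_le_int => y _; first by rewrite lee_fin mulr_ge0 ?wkernel_ge0.
rewrite lee_fin; apply: ler_wpM2l; first exact: wkernel_ge0.
by case: (leP (dist y)) => yr; rewrite ?clamp_ge0// clamp1// ler_pdivrMr// mul1r.
Qed.

(** By Tonelli each y distributes a total mass of at most 6^n, the volume of the ball of radius 3
    dist y over dist y ^ n. Only y with dist y < 2 r count, and these lie within 2 r + 6 r = 8 r of
    x; 96 is 6 * 16. *)
Lemma load_average x r : 0 < r ->
  (\int[mu]_z ((D x z < 2 * r)%R%:R%:E * load z r) <= (96 ^+ n * r ^+ n)%:E)%E.
Proof.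
move=> r0.
have f0 z y : (0 <= ((D x z < 2 * r)%R%:R * (wkernel y z * clamp (dist y / r)))%:E)%E.
  by rewrite lee_fin mulr_ge0.
have -> : (\int[mu]_z ((D x z < 2 * r)%R%:R%:E * load z r) =
   \int[mu]_z \int[mu]_y ((D x z < 2 * r)%R%:R * (wkernel y z * clamp (dist y / r)))%:E)%E.
  apply: eq_integral => z _; rewrite -integralMl//; last by mf.
  by move=> y; rewrite lee_fin.
rewrite tonelli//; last by mf.
apply: (@le_trans _ _ (\int[mu]_y ((6 ^+ n)%:E * (D x y < 8 * r)%R%:R%:E))%E); last first.
  rewrite integralMl; first last.
  - by mf.
  - by move=> y; rewrite lee_fin.
  - by rewrite exprn_ge0.
  rewrite (integral_ball BS) ?mulr_gt0// -EFinM lee_fin -!exprMn.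
  by rewrite (_ : 6 * (2 * (8 * r)) = 96 * r)//; ring.
apply: ge0_le_int => y _; first by apply: integral_ge0 => z _; exact: f0.
apply: (@le_trans _ _ (\int[mu]_z
    (((D x y < 8 * r) && (0 < dist y))%R%:R / dist y ^+ n * (D y z < 3 * dist y)%R%:R)%:E)%E).
  apply: ge0_le_int => z _; first exact: f0.
  rewrite lee_fin.
  have b0 : 0 <= ((D x y < 8 * r) && (0 < dist y))%R%:R / dist y ^+ n * (D y z < 3 * dist y)%R%:R.
    by rewrite mulr_ge0// divr_ge0// exprn_ge0.
  have [->|w0] := eqVneq (wkernel y z) 0; first by rewrite mul0r mulr0.
  have [yz dy] := wkernel_gt0_lt w0.
  have [yr|ry] := ltP (dist y / r) 2; last by rewrite clamp0// !mulr0.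
  move: yr; rewrite ltr_pdivrMr// => yr.
  have [xz|xz] := ltP (D x z); last by rewrite mul0r.
  have xy : D x y < 8 * r.
    by apply: le_lt_trans (D_tri BS z _ _) _; rewrite (D_sym BS z); lra.
  rewrite xy dy yz !mul1r mulr1 -[leRHS]mulr1 ler_pM ?clamp_ge0 ?clamp_le1 ?wkernel_ge0//.
  by rewrite /wkernel yz mul1r.
under eq_integral do rewrite EFinM.
rewrite integralMl; first last.
- by mf.
- by move=> z; rewrite lee_fin.
- by rewrite divr_ge0// exprn_ge0.
have [xy|xy] := ltP (D x y); last by rewrite mul0r mul0e mule0.
have [dy|dy] := ltP 0 (dist y); last by rewrite mul0r mul0e mule1 lee_fin exprn_ge0.
rewrite (integral_ball BS) ?mulr_gt0// -!EFinM lee_fin mul1r mulr1.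
have -> : 2 * (3 * dist y) = 6 * dist y by ring.
by rewrite exprMn mulrCA mulVf ?mulr1// expf_neq0// gt_eqF.
Qed.

Lemma weight_ge0 x z : 0 <= weight x z.
Proof. by rewrite /weight !mulr_ge0// ?clamp_ge0//; exact: clamp_ge0. Qed.

Lemma measurable_thin : measurable_fun setT (fun p : X * X => thin p.1 p.2).
Proof. by rewrite /thin; mf. Qed.
Let mthin := measurable_thin.

Lemma measurable_weight : measurable_fun setT (fun p : X * X => weight p.1 p.2).
Proof. by rewrite /weight; mf. Qed.
Let mweight := measurable_weight.

Lemma weight_neq0 x z : weight x z != 0 ->
  [/\ 0 < dist x, S z, D x z < 3 * dist x & (load z (dist x) < (2 * load_bound)%:E)%E].
Proof.
rewrite /weight; case: ltP => dx; last by rewrite mul0r eqxx.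
have [/set_mem Sz|_] /= := boolP (z \in S); last by rewrite mul0r eqxx.
rewrite mul1r mulf_eq0 negb_or => /andP[w0 t0]; split=> //.
- rewrite ltNge; apply/negP => h; move/eqP: w0; apply; apply: clamp0.
  by rewrite lerBrDr ler_pdivlMr//; lra.
- rewrite ltNge; apply/negP => h; move/eqP: t0; apply; apply: clamp0.
  rewrite ler_pdivlMr ?load_bound_gt0//.
  by rewrite -lee_fin fineK// load_fin.
Qed.

Lemma weight_le1 x z : weight x z <= (D x z < 3 * dist x)%R%:R.
Proof.
have [->|/weight_neq0[_ _ -> _]] := eqVneq (weight x z) 0; first exact: ler0n.
rewrite /weight; case: (_ && _); rewrite ?mul0r ?mul1r//.
by rewrite mulr_ile1 ?clamp_ge0 ?clamp_le1.
Qed.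

Lemma mass_int x : (\int[mu]_z (weight x z)%:E = (mass x)%:E)%E.
Proof.
rewrite fineK// ge0_fin_numE; last by apply: integral_ge0 => z _; rewrite lee_fin weight_ge0.
have [dx|dx] := ltP 0 (dist x); last first.
  rewrite integral0_eq// => z _; rewrite /weight ltNge dx /=; by rewrite mul0r.
apply: (@le_lt_trans _ _ (\int[mu]_z (D x z < 3 * dist x)%R%:R%:E)%E).
  by apply: ge0_le_int => z _; rewrite lee_fin ?weight_ge0 ?weight_le1.
by rewrite (integral_ball BS) ?mulr_gt0// ltry.
Qed.

Definition mass_const : R := c / 2 ^+ n / 2.

Lemma mass_const_gt0 : 0 < mass_const.
Proof. by rewrite /mass_const !divr_gt0// exprn_gt0. Qed.

(* Chebyshev: on a ball of radius dist x / 2 centred in S the load averages to at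
   most half of load_bound times the density of S. *)
Lemma mass_ge x : 0 < dist x -> mass_const * dist x ^+ n <= mass x.
Proof.
move=> dx; set r := dist x in dx *.
(* With 3 / 2 the ball of radius r / 2 at a stays within 2 r of x, where the radial factor of the
   weight is 1. *)
have [a Sa xa] : exists2 a, S a & D x a < 3 / 2 * r.
  by apply: (setdist_lt BS S0); rewrite -/r; lra.
have r2 : 0 < r / 2 by lra.
have := rS Sa r2.
rewrite -[X in mu X](_ : [set y | (D a y < r / 2)%R && (y \in S)] = _); last first.
  by apply/seteqP; split=> y /= => [/andP[? /set_mem]|[-> /mem_set ->]].
rewrite -integral_bool; last by mf.
have avg := load_average x dx.
have -> : c * (r / 2) ^+ n = 2 * mass_const * r ^+ n.
  by rewrite /mass_const expr_div_n; field; rewrite expf_neq0.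
move=> low.
have : (\int[mu]_y ((D a y < r / 2)%R && (y \in S))%R%:R%:E <=
  \int[mu]_z ((weight x z)%:E + load_bound^-1%:E * ((D x z < 2 * r)%R%:R%:E * load z r)))%E.
  apply: ge0_le_int => z _; first by rewrite lee_fin.
  have w0 : (0 <= (weight x z)%:E)%E by rewrite lee_fin weight_ge0.
  have l0 : (0 <= load_bound^-1%:E * ((D x z < 2 * r)%R%:R%:E * load z r))%E.
    by rewrite !mule_ge0 ?load_ge0// lee_fin// invr_ge0 ltW// load_bound_gt0.
  have [az|_] := ltP (D a z); last exact: adde_ge0.
  have [/set_mem Sz|_] /= := boolP (z \in S); last exact: adde_ge0.
  have xz : D x z < 2 * r by apply: le_lt_trans (D_tri BS a _ _) _; lra.
  have lf := load_fin Sz dx.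
  have [ll|ll] := leP (fine (load z r)) load_bound.
    rewrite -[leLHS]adde0 leeD// lee_fin /weight mem_set// -/r dx mul1r.
    rewrite clamp1; last by rewrite lerBlDr ler_pdivrMr//; lra.
    by rewrite mul1r /thin clamp1// -/r ler_pdivrMr ?load_bound_gt0// mul1r.
  rewrite -[leLHS]add0e leeD// xz mul1e -(fineK lf) -EFinM lee_fin.
  by rewrite -ler_pdivrMl ?invr_gt0 ?load_bound_gt0// invrK mulr1 ltW.
rewrite integralDT; first last.
- by mf.
- by mf.
- by move=> z; rewrite !mule_ge0 ?load_ge0// lee_fin// invr_ge0 ltW// load_bound_gt0.
- by move=> z; rewrite lee_fin weight_ge0.
rewrite mass_int integralMl; first last.
- by mf.
- by move=> z; rewrite mule_ge0 ?load_ge0// lee_fin.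
- by rewrite invr_ge0 ltW// load_bound_gt0.
move=> up.
have lb0 : (0 <= load_bound^-1%:E)%E by rewrite lee_fin invr_ge0 ltW// load_bound_gt0.
have := le_trans low (le_trans up (leeD (lexx _) (lee_wpmul2l lb0 avg))).
rewrite -EFinM -EFinD lee_fin.
have -> : load_bound^-1 * (96 ^+ n * r ^+ n) = mass_const * r ^+ n.
  rewrite /mass_const /load_bound.
  have -> : (192 = 96 * 2 :> R) by lra.
  rewrite exprMn; field.
  by rewrite !expf_neq0// gt_eqF.
by rewrite -/r; lra.
Qed.

Lemma mass_gt0 x : 0 < dist x -> 0 < mass x.
Proof.
move=> dx; apply: lt_le_trans (mass_ge dx).
by rewrite mulr_gt0 ?exprn_gt0// mass_const_gt0.
Qed.

Lemma mass_ge0 x : 0 <= mass x.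
Proof. by apply: fine_ge0; apply: integral_ge0 => z _; rewrite lee_fin; exact: weight_ge0. Qed.

Lemma measurable_mass : measurable_fun setT mass.
Proof. by rewrite /mass; mf => x z; rewrite lee_fin; exact: weight_ge0. Qed.

End Kernel.

Global Opaque mass load.

Lemma quot_lip (R : realType) (m0 T V w w' m m' b : R) : 0 < m0 -> 0 <= T -> 0 <= V ->
  m0 <= m -> m0 <= m' -> `|w - w'| <= T * b -> 0 <= w' -> w' <= b ->
  `|m - m'| <= T * V -> `|w / m - w' / m'| <= T * b / m0 + b * (T * V) / (m0 * m0).
Proof.
move=> m00 T0 V0 mx mx' hw w'0 w'1 hm.
have m1 : 0 < m := lt_le_trans m00 mx; have m2 : 0 < m' := lt_le_trans m00 mx'.
have -> : w / m - w' / m' = (w - w') / m + w' * (m' - m) / (m * m').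
  by field; rewrite !gt_eqF.
apply: (le_trans (ler_normD _ _)); apply: lerD.
  rewrite normrM (@ger0_norm _ m^-1) ?invr_ge0 ?(ltW m1)//.
  by apply: ler_pM => //; rewrite ?invr_ge0 ?(ltW m1)// lef_pV2.
rewrite normrM (@ger0_norm _ (_ * _)^-1) ?invr_ge0 ?mulr_ge0 ?(ltW m1) ?(ltW m2)//.
rewrite normrM (ger0_norm w'0) distrC.
apply: ler_pM; rewrite ?mulr_ge0 ?invr_ge0 ?mulr_ge0 ?(ltW m1) ?(ltW m2)//.
  exact: ler_pM.
by rewrite lef_pV2 ?posrE ?mulr_gt0//; apply: ler_pM => //; exact: ltW.
Qed.

(** * Bounded overlap and Lipschitz dependence of the kernel *)

Section KernelProperties.
Context d (X : measurableType d) (R : realType).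
Context (mu : {sigma_finite_measure set X -> \bar R}) (D : X -> X -> R) (n : nat).
Hypothesis BS : ball_space mu D n.
Context (S : set X) (c : R).
Hypothesis S0 : S !=set0.
Hypothesis c0 : 0 < c.
Hypothesis oS : metric_open D S.
Hypothesis rS : inner_regular mu D n S c.
Implicit Types (x y z : X) (r : R).

Local Notation dist := (setdist D S).
Local Notation load := (load mu D n S).
Local Notation weight := (weight mu D n S c).
Local Notation mass := (mass mu D n S c).
Local Notation load_bound := (load_bound n c).
Local Notation mass_const := (mass_const n c).
Local Notation wkernel := (wkernel D n S).
Local Notation P := (pkernel mu D n S c).
Let mD := D_meas BS.
Let mdist := measurable_setdist BS S0.
Let mS : measurable S := measurable_metric_open BS oS.
Let dist0 x : 0 <= dist x := setdist_ge0 BS S0 x.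
Let mweight := measurable_weight BS c S0 oS.
Let mw := measurable_wkernel BS S0.
Let mc0 : 0 < mass_const := mass_const_gt0 n c0.
Let lb0 : 0 < load_bound := load_bound_gt0 n c0.
Let weight0 x z : 0 <= weight x z. Proof. exact: weight_ge0. Qed.

Lemma pkernel_ge0 x z : 0 <= P x z.
Proof. by rewrite divr_ge0 ?mass_ge0. Qed.

Lemma measurable_pkernel : measurable_fun setT (fun p : X * X => P p.1 p.2).
Proof. by have mmass := measurable_mass BS c S0 oS; rewrite /pkernel; mf. Qed.

Lemma pkernel_neq0 x z : P x z != 0 -> [/\ 0 < dist x, S z, D x z < 3 * dist x &
  (load z (dist x) < (2 * load_bound)%:E)%E].
Proof.
by rewrite /pkernel mulf_eq0 negb_or => /andP[w0 _]; exact: (weight_neq0 BS S0 c0 oS).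
Qed.

Lemma pkernel_le x z : P x z <= mass_const^-1 * wkernel x z.
Proof.
have [->|/pkernel_neq0[dx Sz xz _]] := eqVneq (P x z) 0.
  by rewrite mulr_ge0 ?(wkernel_ge0 BS S0)// invr_ge0 ltW.
have M := mass_ge BS S0 c0 oS rS dx.
have h := weight_le1 BS S0 c0 oS x z.
rewrite /pkernel /wkernel mulrCA -invfM; apply: ler_pM => //.
- by rewrite invr_ge0 mass_ge0.
- by rewrite lef_pV2// posrE ?(mass_gt0 BS S0 c0 oS rS)// mulr_gt0// exprn_gt0.
Qed.

Lemma integral_pkernel x : 0 < dist x -> (\int[mu]_z (P x z)%:E = 1)%E.
Proof.
move=> dx; have m0 := mass_gt0 BS S0 c0 oS rS dx.
under eq_integral do rewrite /pkernel mulrC EFinM.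
rewrite integralMl; first last.
- by mf.
- by move=> z; rewrite lee_fin.
- by rewrite invr_ge0 ltW.
by rewrite mass_int// -EFinM mulVf// gt_eqF.
Qed.

(** J is an interval starting at 0 without a largest element, possibly unbounded. An increasing
    sequence exhausting it lets [pkernel_overlap] pass to the limit by monotone convergence. *)
Lemma exists_cofinal (J : set R) : J !=set0 -> (forall r, J r -> 0 < r) ->
  (forall r r', J r -> 0 < r' -> r' <= r -> J r') ->
  (forall r, J r -> exists2 r', J r' & r < r') ->
  exists s : nat -> R, [/\ {homo s : i j / (i <= j)%N >-> i <= j},
    forall i, J (s i) & forall r, J r -> exists i, r <= s i].
Proof.
move=> [a Ja] Jpos Jdown Jopen.
have [bJ|nbJ] := pselect (has_ubound J).
  have hJ : has_sup J by split=> //; exists a.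
  have ltsup r : J r -> r < sup J.
    by move=> /Jopen[r' Jr' rr']; apply: lt_le_trans rr' _; exact: ub_le_sup.
  have s0 : 0 < sup J by apply: lt_trans (ltsup _ Ja); exact: Jpos.
  (* The index [i.+2] keeps the factor positive already at i = 0. *)
  exists (fun i => sup J * (1 - i.+2%:R^-1)); split.
  - move=> i j ij; rewrite ler_pM2l// lerD2l lerN2 lef_pV2 ?posrE// ler_nat.
    by rewrite ltnS ltnS.
  - move=> i; have i1 : (i.+2%:R^-1 : R) < 1 by rewrite invf_lt1// ltr1n.
    have i0 : (0 : R) < i.+2%:R^-1 by rewrite invr_gt0.
    have : sup J * (1 - i.+2%:R^-1) < sup J by rewrite gtr_pMr// gtrBl.
    move=> /(sup_gt (ex_intro _ a Ja))[r Jr sr].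
    by apply: Jdown Jr _ (ltW sr); rewrite mulr_gt0// subr_gt0.
  - move=> r Jr; have e0 : 0 < (sup J - r) / sup J.
      by rewrite divr_gt0// subr_gt0; exact: ltsup.
    have [i _ /(_ i (leqnn i)) /= ie] := near_infty_natSinv_lt (PosNum e0).
    exists i; have : (i.+2%:R^-1 : R) <= (sup J - r) / sup J.
      by apply: le_trans (ltW ie); rewrite lef_pV2 ?posrE// ler_nat.
    by rewrite ler_pdivlMr// mulrC lerBrDr addrC mulrBr mulr1 => h; rewrite lerBrDr.
exists (fun i => i.+1%:R); split.
- by move=> i j ij; rewrite ler_nat.
- move=> i; have [r Jr ir] : exists2 r, J r & i.+1%:R < r.
    apply: contrapT => h; apply: nbJ; exists i.+1%:R => r Jr.
    by rewrite leNgt; apply/negP => ir; apply: h; exists r.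
  by apply: Jdown Jr _ (ltW ir); rewrite ltr0n.
- by move=> r Jr; exists (Num.truncn r); exact/ltW/truncnS_gt.
Qed.

(* The load z restricts the kernel to scales r with load z r < 2 load_bound, and the
   part of the load coming from scales below r already contains the whole overlap. *)
Lemma pkernel_overlap z : S z ->
  (\int[mu]_x (P x z)%:E <= (2 * load_bound / mass_const)%:E)%E.
Proof.
move=> Sz.
pose J := [set r | 0 < r /\ (load z r < (2 * load_bound)%:E)%E].
have [|J0] := pselect (J !=set0); last first.
  rewrite integral0_eq; first by rewrite lee_fin divr_ge0 ?(ltW mc0)// mulr_ge0// ltW.
  move=> x _; congr EFin; apply/eqP/negPn/negP => /pkernel_neq0[dx _ _ l].
  by apply: J0; exists (dist x).
move=> /exists_cofinal[|||s [shomo Js sJ]].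
- by move=> r [].
- move=> r r' [r0 lr] r'0 rr'; split=> //.
  by apply: le_lt_trans lr; exact: load_ndecr.
- move=> r [r0 lr].
  have lf := load_fin BS S0 oS Sz r0.
  have C0 : (0 : R) < 4 * 24 ^+ n by rewrite mulr_gt0// exprn_gt0.
  move: lr; rewrite -(fineK lf) lte_fin => lr.
  (* By [load_lip], enlarging r by the factor 1 + e uses at most half of the gap between the load
     and 2 * load_bound, so J has no largest element. *)
  pose e := Num.min 1 ((2 * load_bound - fine (load z r)) / (4 * 24 ^+ n) / 2).
  have e0 : 0 < e by rewrite lt_min ltr01 /= !divr_gt0// subr_gt0.
  have e1 : e <= 1 by rewrite ge_min lexx.
  have e2 : e <= (2 * load_bound - fine (load z r)) / (4 * 24 ^+ n) / 2.
    by rewrite ge_min lexx orbT.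
  exists (r + r * e); last by rewrite ltrDl mulr_gt0.
  split; first by rewrite addr_gt0// mulr_gt0.
  have rr : r <= r + r * e by rewrite lerDl mulr_ge0// ltW.
  have r2 : r + r * e <= 2 * r by nra.
  apply: le_lt_trans (load_lip BS S0 z r0 rr r2) _.
  rewrite -(fineK lf) -EFinD lte_fin.
  have -> : (r + r * e - r) / r = e by field; rewrite gt_eqF.
  move: e2; rewrite -(ler_pM2l C0) => e2; apply: le_lt_trans (lerD (lexx _) e2) _.
  have -> : 4 * 24 ^+ n * ((2 * load_bound - fine (load z r)) / (4 * 24 ^+ n) / 2) =
      (2 * load_bound - fine (load z r)) / 2 by field; rewrite expf_neq0.
  lra.
pose f i x := (wkernel x z * (dist x <= s i)%R%:R)%:E.
have f0 i x : (0 <= f i x)%E by rewrite lee_fin mulr_ge0// (wkernel_ge0 BS S0).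
have mf_ i : measurable_fun setT (f i) by rewrite /f; mf.
have fhomo x : {homo f^~ x : i j / (i <= j)%N >-> (i <= j)%E}.
  move=> i j ij; rewrite lee_fin; apply: ler_wpM2l; first exact: (wkernel_ge0 BS S0).
  rewrite ler_nat; case: (leP (dist x) (s i)) => // xi.
  by rewrite (le_trans xi)// shomo.
have fcvg x : cvgn (f^~ x) by apply: ereal_nondecreasing_is_cvgn; exact: fhomo.
apply: (@le_trans _ _ (mass_const^-1%:E * \int[mu]_x limn (f^~ x))%E); last first.
  rewrite mulrC EFinM lee_wpmul2l ?lee_fin ?invr_ge0 ?(ltW mc0)//.
  have /= cv := @cvg_monotone_convergence _ _ _ mu _ measurableT _ mf_ (fun i x _ => f0 i x) (fun x _ => fhomo x).
  apply: (cvge_le _ cv); apply: nearW => i; have [si0 /ltW] := Js i.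
  by apply: le_trans; exact: load_lower.
have mlim : measurable_fun setT (fun x => limn (f^~ x)).
  by apply: (emeasurable_fun_cvg f) => // x _.
have lim0 x : (0 <= limn (f^~ x))%E by apply: lime_ge => //; apply: nearW.
rewrite -integralMl ?invr_ge0 ?(ltW mc0)//.
apply: ge0_le_int => x _; first by rewrite lee_fin pkernel_ge0.
have [->|P0] := eqVneq (P x z) 0.
  by rewrite mule_ge0// lee_fin invr_ge0 ltW.
have [dx _ xz lx] := pkernel_neq0 P0.
have [i xi] := sJ (dist x) (conj dx lx).
apply: (@le_trans _ _ (mass_const^-1%:E * f i x)%E).
  by rewrite /f xi mulr1 -EFinM lee_fin pkernel_le.
rewrite lee_wpmul2l ?lee_fin ?invr_ge0 ?(ltW mc0)//.
apply: lime_ge => //; exists i => // j /=; exact: fhomo.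
Qed.

Lemma load_lip_sym z r0 r r' : S z -> 0 < r0 -> r0 <= r -> r0 <= r' ->
  r <= 2 * r0 -> r' <= 2 * r0 ->
  `|fine (load z r) - fine (load z r')| <= 4 * 24 ^+ n * (`|r - r'| / r0).
Proof.
move=> Sz r00; wlog rr' : r r' / r <= r'.
  move=> H rr rr' r2 r'2; have [h|/ltW h] := leP r r'; first exact: H.
  by rewrite distrC (distrC r); apply: H.
move=> rr _ r2 r'2.
have r_gt0 : 0 < r by lra.
have r'0 : 0 < r' by lra.
have lf := load_fin BS S0 oS Sz r_gt0; have lf' := load_fin BS S0 oS Sz r'0.
have r'r : r' <= 2 * r by lra.
have := load_ndecr BS S0 z r_gt0 rr'; have := load_lip BS S0 z r_gt0 rr' r'r.
rewrite -(fineK lf) -(fineK lf') -EFinD !lee_fin => h1 h2.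
rewrite distrC ger0_norm ?subr_ge0// distrC ger0_norm ?subr_ge0// lerBlDl.
apply: le_trans h1 _; rewrite lerD2l ler_pM2l ?mulr_gt0 ?exprn_gt0//.
by apply: ler_wpM2l; [rewrite subr_ge0|rewrite lef_pV2// posrE; lra].
Qed.

(** The radial factor accounts for 11. The thinning factor accounts for the rest: 4 * 24^n from
    [load_lip] at the base scale 2 / 3 * dist x becomes 6 * 24^n. *)
Definition weight_lip_const : R := 11 + 6 * 24 ^+ n / load_bound.

Lemma weight_lip_const_ge0 : 0 <= weight_lip_const.
Proof. by rewrite addr_ge0// divr_ge0 ?(ltW lb0)// mulr_ge0 ?exprn_ge0. Qed.

Section NearbyPoints.
Context (x x' : X).
Hypothesis dx : 0 < dist x.
Hypothesis xx' : D x x' <= dist x / 3.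

Let dist_lower : 2 / 3 * dist x <= dist x'.
Proof. by have := setdist_tri BS S0 x x'; move: xx'; lra. Qed.

Let dist_upper : dist x' <= 4 / 3 * dist x.
Proof. by have := setdist_tri BS S0 x' x; rewrite (D_sym BS x'); move: xx'; lra. Qed.

Let dist_diff : `|dist x - dist x'| <= D x x'.
Proof.
have := setdist_tri BS S0 x x'; have := setdist_tri BS S0 x' x.
by rewrite (D_sym BS x') ler_norml; lra.
Qed.

Let DD : 0 <= D x x'. Proof. exact: (D_ge0 BS). Qed.
Let dx' : 0 < dist x'. Proof. by have := dist_lower; move: dx; lra. Qed.

Lemma weight_lip z : `|weight x z - weight x' z| <=
  weight_lip_const * (D x x' / dist x) * (D x z < 6 * dist x)%R%:R.
Proof.
have dx1 := dx; have xx1 := xx'; have l1 := dist_lower; have u1 := dist_upper.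
have t0 : 0 <= D x x' / dist x by rewrite divr_ge0// ltW.
have rhs0 b : 0 <= weight_lip_const * (D x x' / dist x) * (nat_of_bool b)%:R.
  apply: mulr_ge0; last exact: ler0n.
  by apply: mulr_ge0 => //; exact: weight_lip_const_ge0.
(* Beyond 6 dist x both weights vanish: their supports reach at most 3 dist x' + D x x' <= 13 / 3 *
   dist x from x. *)
have [xz|xz] := ltP (D x z); last first.
  have w0 : weight x z = 0.
    by apply/eqP/negPn/negP => /(weight_neq0 BS S0 c0 oS)[_ _ h _]; lra.
  have w'0 : weight x' z = 0.
    apply/eqP/negPn/negP => /(weight_neq0 BS S0 c0 oS)[_ _ h _].
    by have := D_tri BS x' x z; have := dist_upper; lra.
  by rewrite w0 w'0 subrr normr0 mulr0.
rewrite mulr1 !weightE//; have [/set_mem Sz|_] := boolP (z \in S); last first.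
  rewrite !mul0r subrr normr0; apply: mulr_ge0 => //; exact: weight_lip_const_ge0.
rewrite !mul1r.
set w := clamp _; set w' := clamp (D x' z / _ - 1).
set t := thin _ _ _ _ _ _ _; set t' := thin _ _ _ _ _ _ _.
have hw : `|w - w'| <= 11 * (D x x' / dist x).
  apply: (le_trans (clamp_lip _ _)).
  rewrite (_ : _ - _ = ((D x z - D x' z) * dist x' + D x' z * (dist x' - dist x)) /
    (dist x * dist x')); last by field; rewrite !gt_eqF.
  rewrite normrM (@ger0_norm _ (_ ^-1)) ?invr_ge0 ?mulr_ge0//.
  rewrite ler_pdivrMr ?mulr_gt0//.
  rewrite (_ : 11 * _ * _ = 11 * D x x' * dist x'); last by field; rewrite gt_eqF.
  apply: (le_trans (ler_normD _ _)); rewrite !normrM (ger0_norm (dist0 x')).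
  rewrite (ger0_norm (D_ge0 BS _ _)) (distrC (dist x')).
  have h1 : `|D x z - D x' z| <= D x x'.
    have := D_tri BS x' x z; have := D_tri BS x x' z; rewrite (D_sym BS x' x) ler_norml; lra.
  have h2 : D x' z <= 19 / 3 * dist x.
    by have := D_tri BS x x' z; rewrite (D_sym BS x' x); lra.
  have h3 := D_ge0 BS x' z.
  have := dist_diff; have := dist_lower; have := DD; have := normr_ge0 (dist x - dist x').
  have := normr_ge0 (D x z - D x' z).
  move: (`|D x z - D x' z|) (`|dist x - dist x'|) h1 h2 h3 => a b h1 h2 h3 a0 b0 d0 l u.
  have e1 : a * dist x' <= D x x' * dist x' by apply: ler_wpM2r.
  have e2 : D x' z * b <= 19 / 3 * dist x * D x x' by apply: ler_pM.
  have e3 : 2 / 3 * dist x * D x x' <= dist x' * D x x' by apply: ler_wpM2r.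
  nra.
have ht : `|t - t'| <= 6 * 24 ^+ n / load_bound * (D x x' / dist x).
  apply: (le_trans (clamp_lip _ _)); rewrite -mulrBl normrM.
  rewrite (@ger0_norm _ (load_bound^-1)) ?invr_ge0 ?(ltW lb0)//.
  rewrite mulrAC ler_pdivlMr// -mulrA mulVf ?gt_eqF// mulr1.
  have r0 : 0 < 2 / 3 * dist x by lra.
  apply: (le_trans (load_lip_sym Sz r0 _ _ _ _)); try by have := dist_lower; have := dist_upper; lra.
  rewrite (_ : 6 * 24 ^+ n * (D x x' / dist x) = 4 * 24 ^+ n * (D x x' / (2 / 3 * dist x))).
    by rewrite ler_pM2l ?mulr_gt0 ?exprn_gt0// ler_pM2r ?invr_gt0.
  by field; rewrite gt_eqF.
have -> : w * t - w' * t' = (w - w') * t + w' * (t - t') by ring.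
apply: (le_trans (ler_normD _ _)); rewrite !normrM mulrDl; apply: lerD.
  apply: le_trans hw; rewrite -[leRHS]mulr1; apply: ler_wpM2l => //.
  by rewrite ger0_norm ?clamp_ge0 ?clamp_le1.
apply: le_trans ht; rewrite -[leRHS]mul1r; apply: ler_wpM2r => //.
by rewrite ger0_norm ?clamp_ge0 ?clamp_le1.
Qed.

Lemma mass_lip : `|mass x - mass x'| <=
  weight_lip_const * (D x x' / dist x) * (12 * dist x) ^+ n.
Proof.
have dx1 := dx; have xx1 := xx'; have l1 := dist_lower; have u1 := dist_upper.
have t0 : 0 <= weight_lip_const * (D x x' / dist x).
  by rewrite mulr_ge0 ?weight_lip_const_ge0// divr_ge0// ltW.
have key a b : (forall z, weight a z <= weight b z +
      weight_lip_const * (D x x' / dist x) * (D x z < 6 * dist x)%R%:R) ->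
    mass a <= mass b + weight_lip_const * (D x x' / dist x) * (12 * dist x) ^+ n.
  move=> h.
  have B : (\int[mu]_z (D x z < 6 * dist x)%R%:R%:E = ((12 * dist x) ^+ n)%:E)%E.
    by rewrite (integral_ball BS) ?mulr_gt0//; congr (_ ^+ _)%:E; ring.
  apply: (integral_bound_trans t0 _ _ _ _ _ h (mass_int BS S0 c0 oS a) (mass_int BS S0 c0 oS b) B) => //.
  - by mf.
  - by mf.
rewrite ler_norml; apply/andP; split.
  rewrite lerNl opprB lerBlDl; apply: key => z.
  by rewrite addrC -lerBlDr; apply: le_trans (weight_lip z); rewrite distrC ler_norm.
rewrite lerBlDl; apply: key => z.
by rewrite addrC -lerBlDr; apply: le_trans (weight_lip z); rewrite ler_norm.
Qed.

(** The outcome of [quot_lip] with both masses at least mass_const * (2 / 3 * dist x)^n; 27 = 12 *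
    (3 / 2)^2, where (12 dist x)^n is the volume that enters [mass_lip]. *)
Definition pkernel_lip_const : R :=
  weight_lip_const * ((3 / 2) ^+ n / mass_const + 27 ^+ n / mass_const ^+ 2).

Lemma pkernel_lip z : `|P x z - P x' z| <=
  pkernel_lip_const * (D x x' / dist x) * ((D x z < 6 * dist x)%R%:R / dist x ^+ n).
Proof.
have t0 : 0 <= weight_lip_const * (D x x' / dist x).
  by rewrite mulr_ge0 ?weight_lip_const_ge0// divr_ge0// ltW.
have w'1 : weight x' z <= (D x z < 6 * dist x)%R%:R.
  apply: le_trans (weight_le1 BS S0 c0 oS x' z) _; rewrite ler_nat.
  case: (ltP (D x' z)) => // h; rewrite (_ : D x z < 6 * dist x)//.
  by have := D_tri BS x' x z; move: dx h dist_upper xx'; lra.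
have q0 : 0 < 2 / 3 * dist x by move: dx; lra.
have m00 : 0 < mass_const * (2 / 3 * dist x) ^+ n by rewrite mulr_gt0// exprn_gt0.
have mx : mass_const * (2 / 3 * dist x) ^+ n <= mass x.
  apply: le_trans (mass_ge BS S0 c0 oS rS dx); rewrite ler_pM2l// lerXn2r ?nnegrE ?(ltW q0)//.
  by rewrite ler_piMl//; lra.
have mx' : mass_const * (2 / 3 * dist x) ^+ n <= mass x'.
  by apply: le_trans (mass_ge BS S0 c0 oS rS dx'); rewrite ler_pM2l// lerXn2r ?nnegrE ?(ltW q0).
have V0 : 0 <= (12 * dist x) ^+ n by rewrite exprn_ge0// mulr_ge0.
apply: (le_trans (quot_lip m00 t0 V0 mx mx' (weight_lip z) (weight0 x' z) w'1 mass_lip)).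
rewrite le_eqVlt; apply/orP; left; apply/eqP; rewrite /pkernel_lip_const.
have dn0 : dist x ^+ n != 0 by rewrite expf_neq0// gt_eqF.
have mn0 : mass_const != 0 by rewrite gt_eqF.
have dn1 : dist x != 0 by rewrite gt_eqF.
move: weight_lip_const mass_const (dist x) (D x x') (_ < _)%R%:R dn0 mn0 dn1 => L m e t b dn0 mn0 dn1.
have -> : (27 = 3 * 3 * 3 :> R) by field.
have -> : (12 = 2 * 2 * 3 :> R) by field.
rewrite !exprMn !exprVn.
have e2 : (2 : R) ^+ n != 0 by rewrite expf_neq0.
have e3 : (3 : R) ^+ n != 0 by rewrite expf_neq0.
move: ((2 : R) ^+ n) ((3 : R) ^+ n) (e ^+ n) e2 e3 dn0 => p q en e2 e3 dn0; field.
by rewrite e2 e3 dn0 mn0 dn1.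
Qed.

End NearbyPoints.

End KernelProperties.

(** * Averaging extension *)

(* P x is a probability density on S for x at positive distance from S. The field
   rk_over bounds the mass that all of these densities put at one point, and by
   rk_lip the density moves slowly with x. *)
Record reflection_kernel d (X : measurableType d) (R : realType)
    (mu : {measure set X -> \bar R}) (D : X -> X -> R) (n : nat)
    (S : set X) (dist : X -> R) (P : X -> X -> R) (CP CO LP : R) : Prop :=
  ReflectionKernel {
  rk_mset : measurable S;
  rk_mdist : measurable_fun setT dist;
  rk_dist0 : forall x, 0 <= dist x;
  rk_distS : forall x, S x -> dist x = 0;
  rk_dist_tri : forall x y, dist x <= D x y + dist y;
  rk_muS : (0 < mu S)%E;
  rk_bnd : mu [set x | dist x = 0 /\ ~ S x] = 0%E;
  rk_ge0 : forall x z, 0 <= P x z;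
  rk_meas : measurable_fun setT (fun p : X * X => P p.1 p.2);
  rk_supp : forall x z, P x z != 0 -> [/\ 0 < dist x, S z & D x z < 3 * dist x];
  rk_le : forall x z, P x z <= CP / dist x ^+ n;
  rk_int : forall x, 0 < dist x -> (\int[mu]_z (P x z)%:E = 1)%E;
  rk_over : forall z, (\int[mu]_x (P x z)%:E <= CO%:E)%E;
  rk_CP0 : 0 <= CP;
  rk_CO0 : 0 <= CO;
  rk_LP0 : 0 <= LP;
  rk_lip : forall x x' z, 0 < dist x -> D x x' <= dist x / 3 ->
    `|P x z - P x' z| <=
    LP * (D x x' / dist x) * ((D x z < 6 * dist x)%R%:R / dist x ^+ n) }.

Section Averaging.
Context d (X : measurableType d) (R : realType).
Context (mu : {sigma_finite_measure set X -> \bar R}) (D : X -> X -> R) (n : nat).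
Hypothesis BS : ball_space mu D n.
Context (S : set X) (dist : X -> R) (P : X -> X -> R) (CP CO LP : R).
Hypothesis RK : reflection_kernel mu D n S dist P CP CO LP.
Let mS := rk_mset RK.
Let mdist := rk_mdist RK.
Let dist0 := rk_dist0 RK.
Let P0 := rk_ge0 RK.
Let mP := rk_meas RK.
Let Psupp := rk_supp RK.
Let Pover := rk_over RK.
Let CO0 := rk_CO0 RK.
Let LP0 := rk_LP0 RK.
Let mD := D_meas BS.

(** The extension operator for non-negative extended functions, defined without integrability, so
    that the energy density itself can be averaged in each variable. *)
Definition avg (g : X -> \bar R) (x : X) : \bar R :=
  (if x \in S then g x else \int[mu]_z ((P x z)%:E * g z))%E.

Lemma avg_ge0 g x : (forall z, 0 <= g z)%E -> (0 <= avg g x)%E.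
Proof.
move=> g0; rewrite /avg; case: ifP => // _; apply: integral_ge0 => z _.
by rewrite mule_ge0// lee_fin.
Qed.

Lemma measurable_avg d' (Y : measurableType d') (G : Y -> X -> \bar R) :
  (forall y z, 0 <= G y z)%E -> measurable_fun setT (fun p : Y * X => G p.1 p.2) ->
  measurable_fun setT (fun p : Y * X => avg (G p.1) p.2).
Proof.
move=> G0 mG; rewrite /avg; mf => p z.
by rewrite mule_ge0// lee_fin.
Qed.

Lemma le_avg g h (k : R) x : 0 <= k -> (forall z, 0 <= g z)%E -> (forall z, 0 <= h z)%E ->
  measurable_fun setT h ->
  (forall z, S z -> (D x z <= 3 * dist x)%R -> g z <= k%:E * h z)%E ->
  (avg g x <= k%:E * avg h x)%E.
Proof.
move=> k0 g0 h0 mh gh; rewrite /avg; case: ifPn => [/set_mem Sx|_].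
  by apply: gh => //; rewrite (D_refl BS) mulr_ge0.
rewrite -integralMl//; first last.
- by mf.
- by move=> z; rewrite mule_ge0// lee_fin.
apply: ge0_le_int => z _; first by rewrite mule_ge0// lee_fin.
have [->|/Psupp[_ Sz xz]] := eqVneq (P x z) 0; first by rewrite !mul0e mule0.
by rewrite muleCA lee_wpmul2l ?lee_fin// gh// ltW.
Qed.

(** The identity on S accounts for 1; off S, Tonelli moves the integral onto x, where the overlap
    bound gives CO. *)
Lemma integral_avg g : (forall z, 0 <= g z)%E -> measurable_fun setT g ->
  (\int[mu]_x avg g x <= (1 + CO)%:E * \int[mu]_z g z)%E.
Proof.
move=> g0 mg.
have I0 x : (0 <= \int[mu]_z ((P x z)%:E * g z))%E.
  by apply: integral_ge0 => z _; rewrite mule_ge0// lee_fin.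
apply: (@le_trans _ _ (\int[mu]_x (g x + \int[mu]_z ((P x z)%:E * g z)))%E).
  apply: ge0_le_int => x _; first exact: avg_ge0.
  by rewrite /avg; case: ifP => _; [exact: leeDl|exact: leeDr].
rewrite integralDT//; last by mf => x z; rewrite mule_ge0// lee_fin.
rewrite tonelli; last 2 first.
- by mf.
- by move=> x z; rewrite mule_ge0// lee_fin.
rewrite EFinD ge0_muleDl ?lee_fin// mul1e leeD2l// -integralMl//.
apply: ge0_le_int => z _.
  by apply: integral_ge0 => x _; rewrite mule_ge0// lee_fin.
rewrite integralMr//; last 2 first.
- by move=> x; rewrite lee_fin.
- by mf.
by rewrite lee_wpmul2r.
Qed.

Lemma integral2_avg (H : X -> X -> \bar R) : (forall z w, 0 <= H z w)%E ->
  measurable_fun setT (fun p : X * X => H p.1 p.2) ->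
  (\int[mu]_x \int[mu]_y avg (fun z => avg (H z) y) x <=
   ((1 + CO) ^+ 2)%:E * \int[mu]_z \int[mu]_w H z w)%E.
Proof.
move=> H0 mH.
have mG := measurable_avg H0 mH.
have G0 z y : (0 <= avg (H z) y)%E by apply: avg_ge0.
have mG' : measurable_fun setT (fun p : X * X => avg (H p.2) p.1).
  exact: (mf_comp2 (f := fun z y => avg (H z) y) mG (@measurable_snd _ _ _ _) (@measurable_fst _ _ _ _)).
have mA := measurable_avg (G := fun y z => avg (H z) y) (fun y z => G0 z y) mG'.
have C1 : 0 <= 1 + CO by rewrite addr_ge0.
rewrite tonelli; last 2 first.
- exact: (mf_comp2 (f := fun y x => avg (fun z => avg (H z) y) x) mA
    (@measurable_snd _ _ _ _) (@measurable_fst _ _ _ _)).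
- by move=> x y; apply: avg_ge0.
apply: (@le_trans _ _ (\int[mu]_y ((1 + CO)%:E * \int[mu]_z avg (H z) y))%E).
  apply: ge0_le_int => y _; first by apply: integral_ge0 => x _; exact: avg_ge0.
  apply: integral_avg => //.
  exact: (mf_comp2 (f := fun z y => avg (H z) y) mG (@measurable_id _ _ _) (@measurable_cst _ _ _ _ _ y)).
have I0 z : (0 <= \int[mu]_w H z w)%E by apply: integral_ge0.
rewrite integralMl//; last 2 first.
- by move=> y; apply: integral_ge0.
- exact: (@mf_int _ _ _ _ _ mu (fun y z => avg (H z) y) mG' (fun y z => G0 z y)).
rewrite expr2 EFinM -muleA lee_wpmul2l ?lee_fin//.
rewrite (@tonelli _ _ _ _ _ mu mu (fun y z => avg (H z) y))//.
rewrite -integralMl//; last by mf.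
apply: ge0_le_int => z _; first by apply: integral_ge0.
apply: integral_avg => //.
exact: (mf_comp2 (f := H) mH (@measurable_cst _ _ _ _ _ z) (@measurable_id _ _ _)).
Qed.

End Averaging.

(** * Local integrability of functions of finite energy *)

Section LocalIntegrability.
Context d (X : measurableType d) (R : realType).
Context (mu : {sigma_finite_measure set X -> \bar R}) (D : X -> X -> R) (n : nat).
Hypothesis BS : ball_space mu D n.
Context (S : set X).
Hypothesis mS : measurable S.
Hypothesis muS : (0 < mu S)%E.
Context (phi : R -> R).
Hypothesis Yphi : young_on_R phi.
Let mD := D_meas BS.
Let mphi := measurable_phi Yphi.

(** The restriction to S x S sits in the integrand, so all integrals run over the whole space. On
    the diagonal the value is 0, since phi 0 = 0. *)
Definition quotient_energy (u : X -> R) (al : R) (z w : X) : R :=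
  ((z \in S) && (w \in S))%R%:R * (phi (`|u z - u w| / al) / D z w ^+ (2 * n)).
Local Notation H := quotient_energy.

Definition energy (u : X -> R) (al : R) : \bar R :=
  (\int[mu]_z \int[mu]_w (H u al z w)%:E)%E.

Lemma quotient_energy_ge0 u al z w : 0 <= H u al z w.
Proof. by rewrite mulr_ge0// divr_ge0 ?(phi_ge0 Yphi)// exprn_ge0// (D_ge0 BS). Qed.

Lemma measurable_quotient_energy u al : measurable_fun setT u ->
  measurable_fun setT (fun p : X * X => H u al p.1 p.2).
Proof. by move=> mu_; rewrite /H; mf. Qed.

Section Function.
Context (u : X -> R) (al : R).
Hypothesis mu_ : measurable_fun setT u.
Hypothesis al0 : 0 < al.
Hypothesis fin : (energy u al < +oo)%E.
Let H0 z w : (0 <= (H u al z w)%:E)%E.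
Proof. by rewrite lee_fin quotient_energy_ge0. Qed.
Let mH := measurable_quotient_energy al mu_.

Lemma phi_le_quotient_energy z w k : S z -> S w -> D z w <= k ->
  phi (`|u z - u w| / al) <= k ^+ (2 * n) * H u al z w.
Proof.
move=> Sz Sw zwk; rewrite /H !mem_set//= mul1r.
have := D_ge0 BS z w; rewrite le_eqVlt => /orP[/eqP/esym/(D_eq0 BS)->|Dzw].
  rewrite subrr normr0 mul0r (phi_npos Yphi (lexx 0)) mul0r mulr0//.
rewrite mulrCA -[leLHS]mulr1; apply: ler_wpM2l; first exact: (phi_ge0 Yphi).
rewrite ler_pdivlMr ?exprn_gt0// mul1r; apply: lerXn2r => //; rewrite nnegrE.
  exact: ltW.
by rewrite (le_trans (ltW Dzw)).
Qed.

(** Otherwise the energy would be at least infinity times mu S, which is positive. The point y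
    serves as base point for comparing values of [u]. *)
Lemma exists_finite_section :
  exists2 y, S y & (\int[mu]_w (H u al y w)%:E < +oo)%E.
Proof.
apply: contrapT => h; move: fin; rewrite ltNge => /negP; apply.
have {}h y : S y -> (\int[mu]_w (H u al y w)%:E = +oo)%E.
  move=> Sy; apply/eqP; rewrite -leye_eq leNgt; apply/negP => hy.
  by apply: h; exists y.
apply: (@le_trans _ _ (\int[mu]_(y in S) (cst +oo%E) y)%E).
  by rewrite integral_cst// gt0_mulye//; exact: (rk_muS RK).
rewrite integral_mkind; apply: ge0_le_int => y _; first by apply: mule_ge0; rewrite ?lee_fin//= leey.
case: (boolP (y \in S)) => [/set_mem Sy|_]; first by rewrite mul1e h.
by rewrite mul0e; apply: integral_ge0.
Qed.

Lemma integrable_weight (w : X -> R) (K : R) x r : measurable_fun setT w ->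
  0 <= K -> (forall z, `|w z| <= K * ((z \in S) && (D x z < r))%R%:R) ->
  mu.-integrable setT (EFin \o w).
Proof.
move=> mw K0 hw; apply/integrableP; split; first exact/measurable_EFinP.
(* The radius r may be non-positive, while the ball volume is known for positive radii. *)
apply: (@le_lt_trans _ _ (\int[mu]_z (K%:E * (D x z < `|r| + 1)%R%:R%:E))%E).
  apply: ge0_le_int => z _; first exact: abse_ge0.
  rewrite /= -EFinM lee_fin; apply: (le_trans (hw z)); apply: ler_wpM2l => //.
  rewrite ler_nat; case: (z \in S) => //=; case: (ltP (D x z) r) => //= h.
  by rewrite (_ : D x z < `|r| + 1)//; have := ler_norm r; lra.
rewrite integralMl//; last by mf.
by rewrite (integral_ball BS) ?ltr_wpDl// -EFinM ltry.
Qed.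

(** At a base point y with finite section, [phi_linear] bounds |u z - u y| by al plus a multiple of
    the energy density at (y, z), which is integrable in z. Thus the means of [u] are true integrals
    and depend linearly on [u]. *)
Lemma integrable_weightM (w : X -> R) (K : R) x r : measurable_fun setT w ->
  0 <= K -> (forall z, `|w z| <= K * ((z \in S) && (D x z < r))%R%:R) ->
  mu.-integrable setT (EFin \o (fun z => w z * u z)).
Proof.
move=> mw K0 hw; apply/integrableP; split; first by apply/measurable_EFinP; mf.
have [y Sy fy] := exists_finite_section.
have p1 : 0 < phi 1 by exact: (phi_pos Yphi).
pose B := (D y x + `|r|) ^+ (2 * n).
have B0 : 0 <= B by rewrite exprn_ge0// addr_ge0// (D_ge0 BS).
have A0 : 0 <= K * (`|u y| + al) by rewrite mulr_ge0// addr_ge0// ltW.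
have C0 : 0 <= K * (al / phi 1 * B) by rewrite !mulr_ge0 ?invr_ge0 ?(ltW al0) ?(ltW p1).
apply: (@le_lt_trans _ _ (\int[mu]_z ((K * (`|u y| + al))%:E * (D x z < `|r| + 1)%R%:R%:E +
   (K * (al / phi 1 * B))%:E * (H u al y z)%:E))%E).
  apply: ge0_le_int => z _; first exact: abse_ge0.
  rewrite /= -!EFinM -EFinD lee_fin normrM.
  apply: (le_trans (ler_wpM2r (normr_ge0 _) (hw z))).
  have h0 : 0 <= H u al y z by exact: quotient_energy_ge0.
  have [/set_mem Sz|_] := boolP (z \in S); last by rewrite /= mulr0 mul0r addr_ge0// mulr_ge0.
  have [xz|_] := ltP (D x z); last by rewrite /= mulr0 mul0r addr_ge0// mulr_ge0.
  rewrite (_ : D x z < `|r| + 1); last by have := ler_norm r; lra.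
  rewrite /= !mulr1.
  rewrite (_ : K * _ + _ = K * (`|u y| + (al + al / phi 1 * (B * H u al y z)))); last by ring.
  apply: ler_wpM2l => //.
  have yz : D y z <= D y x + `|r|.
    by apply: le_trans (D_tri BS x _ _) _; rewrite lerD2l (le_trans (ltW xz))// ler_norm.
  have h1 := phi_le_quotient_energy Sy Sz yz.
  have t0 : 0 <= `|u y - u z| / al by rewrite divr_ge0// ltW.
  have h2 t : 0 <= t -> t <= 1 + phi t / phi 1.
    move=> t1; rewrite -(ler_pM2l p1) mulrDr mulr1 [X in _ <= _ + X]mulrC divfK ?gt_eqF//.
    exact: (phi_linear Yphi).
  have h3 : `|u y - u z| <= al + al / phi 1 * (B * H u al y z).
    rewrite -[leLHS](divfK (lt0r_neq0 al0)) mulrC.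
    apply: (le_trans (ler_wpM2l (ltW al0) (h2 _ t0))).
    rewrite mulrDr mulr1 lerD2l (_ : al * (_ / _) = al / phi 1 * phi (`|u y - u z| / al)); last by ring.
    apply: ler_wpM2l h1.
    by rewrite divr_ge0 ?(ltW al0) ?(ltW p1).
  have := ler_normB (u y) (u y - u z); rewrite subKr => h4.
  by apply: le_trans h4 _; rewrite lerD2l.
rewrite integralDT; first last.
- by mf.
- by mf.
- by move=> z; rewrite mule_ge0// lee_fin.
- by move=> z; rewrite mule_ge0// lee_fin.
rewrite !integralMl//; [|by mf|by mf].
rewrite (integral_ball BS) ?ltr_wpDl// -EFinM.
by rewrite lte_add_pinfty ?ltry// lte_mul_pinfty ?lee_fin.
Qed.

Section Weight.
Context (w : X -> R) (K : R) (x : X) (r : R).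
Hypothesis mw : measurable_fun setT w.
Hypothesis K0 : 0 <= K.
Hypothesis w0 : forall z, 0 <= w z.
Hypothesis hw : forall z, w z <= K * ((z \in S) && (D x z < r))%R%:R.

Let hw' z : `|w z| <= K * ((z \in S) && (D x z < r))%R%:R.
Proof. by rewrite ger0_norm. Qed.

Lemma integrable_nnweight : mu.-integrable setT (EFin \o w).
Proof. exact: (integrable_weight mw K0 hw'). Qed.

Lemma integrable_nnweightM : mu.-integrable setT (EFin \o (fun z => w z * u z)).
Proof. exact: (integrable_weightM mw K0 hw'). Qed.

Let integrable_wc (c : R) : mu.-integrable setT (EFin \o (fun z => w z * c)).
Proof.
have := integrableZr measurableT c integrable_nnweight.
by apply: eq_integrable => // z _ /=; rewrite EFinM.
Qed.

Lemma integrable_weight_sub (c : R) : mu.-integrable setT (EFin \o (fun z => w z * (u z - c))).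
Proof.
rewrite (_ : _ \o _ = ((EFin \o (fun z => (w z * u z)%R)) \- (EFin \o (fun z => (w z * c)%R)))%E).
  by apply: integrableB => //; exact: integrable_nnweightM.
by apply/funext => z /=; rewrite -EFinB mulrBr.
Qed.

Lemma integrable_deviation (c : R) :
  mu.-integrable setT (EFin \o (fun z => w z * (`|u z - c| / al))).
Proof.
have := integrableZr measurableT al^-1 (integrable_abse (integrable_weight_sub c)).
apply: eq_integrable => // z _ /=; rewrite -EFinM normrM (ger0_norm (w0 z)).
by rewrite mulrA.
Qed.

Hypothesis w1 : (\int[mu]_z (w z)%:E = 1)%E.

Lemma weighted_mean_sub (c : R) :
  \int[mu]_z (w z * u z) - c = \int[mu]_z (w z * (u z - c)).
Proof.
under [RHS]eq_Rintegral do rewrite mulrBr.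
rewrite RintegralB//; last 1 first.
- exact: integrable_nnweightM.
rewrite RintegralZr//; last exact: integrable_nnweight.
by rewrite /Rintegral /= w1 /= mul1r.
Qed.

Lemma jensen_weight (c : R) : ((phi (`|\int[mu]_z (w z * u z) - c| / al))%:E <=
    \int[mu]_z ((w z)%:E * (phi (`|u z - c| / al))%:E))%E.
Proof.
pose s := \int[mu]_z (w z * (`|u z - c| / al)).
have iabs := integrable_deviation c.
have sE : (\int[mu]_z (w z * (`|u z - c| / al))%:E = s%:E)%E.
  by rewrite /s /Rintegral fineK//; exact: (integrable_fin_num measurableT iabs).
have le_s : `|\int[mu]_z (w z * u z) - c| / al <= s.
  rewrite weighted_mean_sub ler_pdivrMr//.
  apply: (le_trans (le_normr_Rintegral measurableT (integrable_weight_sub c))).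
  rewrite le_eqVlt; apply/orP; left; apply/eqP.
  rewrite /s -RintegralZr//; apply: eq_Rintegral => z _.
  by rewrite normrM (ger0_norm (w0 z)) -!mulrA mulVf ?gt_eqF// mulr1.
apply: (@le_trans _ _ (phi s)%:E); first by rewrite lee_fin (phi_ndecr Yphi).
have muc : measurable_fun setT (fun z => `|u z - c| / al) by mf.
have := jensen Yphi mw muc w0 _ _ sE.
rewrite w1 => /(_ _ (lexx _)) J.
by under eq_integral do rewrite -EFinM; apply: J => z; rewrite divr_ge0// ltW.
Qed.

End Weight.

End Function.
End LocalIntegrability.

(** * Energy of the averaging extension *)

Section ExtensionEstimate.
Context d (X : measurableType d) (R : realType).
Context (mu : {sigma_finite_measure set X -> \bar R}) (D : X -> X -> R) (n : nat).
Hypothesis BS : ball_space mu D n.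
Context (S : set X) (dist : X -> R) (P : X -> X -> R) (CP CO LP : R).
Hypothesis RK : reflection_kernel mu D n S dist P CP CO LP.
Context (phi : R -> R) (Cg : R).
Hypothesis Yphi : young_on_R phi.
Hypothesis growth : forall t, 0 < t ->
  (\int[lebesgue_measure]_(s in `]0%R, t[) (phi s / s ^+ n / s)%:E <=
  (Cg * phi t / t ^+ n)%:E)%E.
Let mS := rk_mset RK.
Let mdist := rk_mdist RK.
Let dist0 := rk_dist0 RK.
Let P0 := rk_ge0 RK.
Let mP := rk_meas RK.
Let CO0 := rk_CO0 RK.
Let LP0 := rk_LP0 RK.
Let mD := D_meas BS.
Let mphi := measurable_phi Yphi.

(** On points outside S at distance 0 every density vanishes and the value is 0; by [rk_bnd] these
    points form a null set. *)
Definition ext (u : X -> R) (x : X) : R :=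
  if x \in S then u x else \int[mu]_z (P x z * u z).

Lemma rk_disjoint x : 0 < dist x -> (x \in S) = false.
Proof.
by move=> dx; apply/negbTE/negP => /set_mem /(rk_distS RK) h; rewrite h ltxx in dx.
Qed.

Local Notation H := (quotient_energy D n S phi).
Local Notation energy := (energy mu D n S phi).
Let muS := rk_muS RK.

Section Function.
Context (u : X -> R) (al : R).
Hypothesis mu_ : measurable_fun setT u.
Hypothesis al0 : 0 < al.
Hypothesis fin : (energy u al < +oo)%E.
Let H0 z w : (0 <= (H u al z w)%:E)%E.
Proof. by rewrite lee_fin (quotient_energy_ge0 BS S Yphi). Qed.
Let mH := measurable_quotient_energy BS mS Yphi al mu_.

Let Pw x z : P x z <= CP / dist x ^+ n * ((z \in S) && (D x z < 3 * dist x))%R%:R.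
Proof.
have [->|Pn0] := eqVneq (P x z) 0.
  by rewrite mulr_ge0// divr_ge0 ?(rk_CP0 RK)// exprn_ge0.
have [_ Sz ->] := rk_supp RK Pn0.
by rewrite mem_set//= mulr1 (rk_le RK).
Qed.

Let CPd x : 0 <= CP / dist x ^+ n.
Proof. by rewrite divr_ge0 ?(rk_CP0 RK)// exprn_ge0. Qed.

Let mPx x : measurable_fun setT (P x). Proof. by mf. Qed.

Lemma integrable_Pu x : mu.-integrable setT (EFin \o (fun z => P x z * u z)).
Proof.
exact: (integrable_nnweightM BS mS muS Yphi mu_ al0 fin (mPx x) (CPd x) (P0 x) (Pw x)).
Qed.

Let integrable_Puc x (c : R) : mu.-integrable setT (EFin \o (fun z => P x z * (u z - c))).
Proof.
exact: (integrable_weight_sub BS mS muS Yphi mu_ al0 fin (mPx x) (CPd x) (P0 x) (Pw x)).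
Qed.

Let ext_sub x (c : R) : 0 < dist x -> ext u x - c = \int[mu]_z (P x z * (u z - c)).
Proof.
move=> dx; rewrite /ext rk_disjoint//.
exact: (weighted_mean_sub BS mS muS Yphi mu_ al0 fin (mPx x) (CPd x) (P0 x) (Pw x) (rk_int RK dx)).
Qed.

Lemma jensen_avg x (c : R) : S x \/ 0 < dist x ->
  ((phi (`|ext u x - c| / al))%:E <=
    avg mu S P (fun z => (phi (`|u z - c| / al))%:E) x)%E.
Proof.
rewrite /avg; case: (boolP (x \in S)) => [xS _|xS []]; first by rewrite /ext xS.
  by move=> /mem_set; rewrite (negbTE xS).
move=> dx; rewrite /ext (negbTE xS).
exact: (jensen_weight BS mS muS Yphi mu_ al0 fin (mPx x) (CPd x) (P0 x) (Pw x) (rk_int RK dx)).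
Qed.

Let inV x := S x \/ 0 < dist x.

Let measurable_avgH2 :
  measurable_fun setT (fun p : X * X => avg mu S P (fun w => (H u al p.1 w)%:E) p.2).
Proof. by apply: (measurable_avg RK (G := fun z w => (H u al z w)%:E)) => //; mf. Qed.

Let measurable_avgH y :
  measurable_fun setT (fun z => avg mu S P (fun w => (H u al z w)%:E) y).
Proof.
exact: (mf_comp2 (f := fun z y => avg mu S P (fun w => (H u al z w)%:E) y) measurable_avgH2
  (@measurable_id _ _ _) (@measurable_cst _ _ _ _ _ y)).
Qed.

(** Jensen's inequality in x and then in y. The averaged points satisfy D x z <= 3 dist x <= 9 D x y
    and, as dist y <= 4 D x y, also D y w <= 12 D x y; hence D z w <= 22 D x y. *)
Lemma far_estimate x y : inV x -> inV y -> dist x <= 3 * D x y ->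
  ((phi (`|ext u x - ext u y| / al) / D x y ^+ (2 * n))%:E <=
   (22 ^+ (2 * n))%:E * avg mu S P (fun z => avg mu S P (fun w => (H u al z w)%:E) y) x)%E.
Proof.
move=> Vx Vy xy.
have AA0 z : (0 <= avg mu S P (fun w => (H u al z w)%:E) y)%E.
  by apply: (avg_ge0 RK).
have A0 : (0 <= avg mu S P (fun z => avg mu S P (fun w => (H u al z w)%:E) y) x)%E.
  by apply: (avg_ge0 RK).
have := D_ge0 BS x y; rewrite le_eqVlt => /orP[/eqP/esym/(D_eq0 BS) exy|Dxy].
  have -> : ext u x = ext u y by rewrite exy.
  rewrite subrr normr0 mul0r (phi_npos Yphi (lexx 0)) mul0r.
  by rewrite mule_ge0// lee_fin exprn_ge0.
have k0 : 0 <= (22 * D x y) ^+ (2 * n) by rewrite exprn_ge0// mulr_ge0// ltW.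
have yx : dist y <= 4 * D x y.
  by have := rk_dist_tri RK y x; rewrite (D_sym BS y); lra.
have key : ((phi (`|ext u x - ext u y| / al))%:E <= ((22 * D x y) ^+ (2 * n))%:E *
    avg mu S P (fun z => avg mu S P (fun w => (H u al z w)%:E) y) x)%E.
  apply: (le_trans (jensen_avg _ Vx)).
  apply: (le_avg BS RK k0) => //.
  - by move=> z; rewrite lee_fin (phi_ge0 Yphi).
  move=> z Sz xz; rewrite distrC; apply: (le_trans (jensen_avg _ Vy)).
  apply: (le_avg BS RK k0) => //.
  - by move=> w; rewrite lee_fin (phi_ge0 Yphi).
  - by mf.
  move=> w Sw yw; rewrite -EFinM lee_fin distrC; apply: (phi_le_quotient_energy BS Yphi) => //.
  have := D_tri BS x z w; have := D_tri BS y x w; rewrite (D_sym BS z x); lra.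
rewrite mulrC EFinM; apply: (le_trans (lee_wpmul2l _ key)).
  by rewrite lee_fin invr_ge0 exprn_ge0// ltW.
rewrite muleA -EFinM lee_wpmul2r// lee_fin exprMn mulrCA mulVf ?mulr1//.
by rewrite expf_neq0// gt_eqF.
Qed.

Lemma measurable_ext : measurable_fun setT (ext u).
Proof.
have mI : measurable_fun setT (fun x => \int[mu]_z (P x z * u z)).
  rewrite (_ : (fun x => _) = (fun x => fine
     (\int[mu]_z (Num.max (P x z * u z) 0)%R%:E - \int[mu]_z (Num.max (- (P x z * u z)) 0)%R%:E)%E)).
    apply: mf_fine; apply: emeasurable_funB; mf => x z; by rewrite lee_fin le_max lexx orbT.
  apply/funext => x; rewrite /Rintegral integralE; congr (fine (_ - _)).
    by apply: eq_integral => z _; rewrite funeposE EFin_max.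
  by apply: eq_integral => z _; rewrite funenegE EFin_max.
by rewrite /ext; mf.
Qed.

Definition ext_const : R := 1 + LP * 12 ^+ n.
(** The constant of [integral_radial] at radius dist x / 3, which gives 3^n, times that of
    [jensen_q]. *)
Definition near_const : R :=
  2 ^+ (2 * n).+1 * Cg * 3 ^+ n * (9 ^+ (2 * n) / 12 ^+ n).

Section Near.
Context (x : X).
Hypothesis dx : 0 < dist x.
Let c := ext u x.
(** The profile of the bound in [rk_lip], divided by the volume of the full ball: its mass is at
    most one, so Jensen's inequality applies to the mean deviation [m]. *)
Let q z : R := ((z \in S) && (D x z < 6 * dist x))%R%:R / (12 * dist x) ^+ n.
Let m := \int[mu]_z (q z * (`|u z - c| / al)).

Let q0 z : 0 <= q z.
Proof. by rewrite divr_ge0// exprn_ge0// mulr_ge0. Qed.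

Let mq : measurable_fun setT q. Proof. by rewrite /q; mf. Qed.

Let r12 : 0 < 12 * dist x. Proof. by rewrite mulr_gt0. Qed.

Let integrable_q : mu.-integrable setT (EFin \o (fun z => q z * (`|u z - c| / al))).
Proof.
apply: (@integrable_deviation _ _ _ _ _ _ BS _ mS muS _ Yphi _ _ mu_ al0 fin q ((12 * dist x) ^+ n)^-1 x (6 * dist x)) => //.
  by rewrite invr_ge0 exprn_ge0// ltW.
by move=> z; rewrite mulrC.
Qed.

Let mE : (\int[mu]_z (q z * (`|u z - c| / al))%:E = m%:E)%E.
Proof. by rewrite /m /Rintegral fineK//; exact: (integrable_fin_num measurableT integrable_q). Qed.

Let m0 : 0 <= m.
Proof. by apply: Rintegral_ge0 => z _; rewrite mulr_ge0// divr_ge0// ltW. Qed.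

(** Both densities have mass one, so the constant c = ext u x can be subtracted from [u]: the
    difference is the integral of (P y - P x) (u - c), and [rk_lip] bounds P y - P x. *)
Lemma ext_lipschitz y : D x y < dist x / 3 ->
  `|ext u x - ext u y| <= LP * 12 ^+ n * (D x y / dist x) * (al * m).
Proof.
move=> xy; have dy : 0 < dist y.
  by have := rk_dist_tri RK x y; move: dx xy; lra.
have D0 : 0 <= D x y / dist x by rewrite divr_ge0 ?(D_ge0 BS).
have k0 : 0 <= LP * 12 ^+ n * (D x y / dist x) * al.
  by rewrite mulr_ge0 ?(ltW al0)// mulr_ge0// mulr_ge0// exprn_ge0.
have i1 := integrable_Puc y c; have i2 := integrable_Puc x c.
rewrite distrC (_ : ext u y - ext u x = \int[mu]_z ((P y z - P x z) * (u z - c))); last first.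
  rewrite -[LHS]subr0 -[X in _ - X](subrr c) [X in _ - X]ext_sub// [X in X - _]ext_sub// -RintegralB//.
  by apply: eq_Rintegral => z _; rewrite mulrBl.
have i3 : mu.-integrable setT (EFin \o (fun z => (P y z - P x z) * (u z - c))).
  have := integrableB measurableT i1 i2.
  by apply: eq_integrable => // z _ /=; rewrite -EFinB mulrBl.
apply: (le_trans (le_normr_Rintegral measurableT i3)).
rewrite mulrA -RintegralZl//; apply: le_Rintegral => //.
- exact: integrable_norm i3.
- have := integrableZl measurableT (LP * 12 ^+ n * (D x y / dist x) * al) integrable_q.
  by apply: eq_integrable => // z _ /=; rewrite EFinM.
move=> z _; rewrite normrM.
have rhs0 : 0 <= LP * 12 ^+ n * (D x y / dist x) * al * (q z * (`|u z - c| / al)).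
  by apply: mulr_ge0 => //; rewrite mulr_ge0// divr_ge0// ltW.
have [zS|zS] := boolP (z \in S); last first.
  have Pz x' : P x' z = 0.
    by apply/eqP/negPn/negP => /(rk_supp RK)[_ /mem_set]; rewrite (negbTE zS).
  by rewrite !Pz subrr normr0 mul0r.
rewrite distrC; apply: (le_trans (ler_wpM2r _ (rk_lip RK z dx (ltW xy)))) => //.
rewrite /q zS /= exprMn le_eqVlt; apply/orP; left; apply/eqP.
have e1 : (12 : R) ^+ n != 0 by rewrite expf_neq0.
have e2 : dist x ^+ n != 0 by rewrite expf_neq0// gt_eqF.
have e3 : dist x != 0 by rewrite gt_eqF.
move: (12 ^+ n : R) (dist x ^+ n) e1 e2 => a b e1 e2; field.
by rewrite e1 e2 e3 gt_eqF.
Qed.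

(** Jensen for [q], then for P x, because c is itself the mean of [u] under P x. The points z and w
    are within 6 + 3 = 9 times dist x of each other. *)
Let jensen_q : ((phi m)%:E <= ((12 * dist x) ^+ n)^-1%:E * ((9 * dist x) ^+ (2 * n))%:E *
  \int[mu]_z \int[mu]_w (P x w * H u al z w)%:E)%E.
Proof.
have muc : measurable_fun setT (fun z => `|u z - c| / al) by mf.
have I0 z : (0 <= \int[mu]_w (P x w * H u al z w)%:E)%E.
  by apply: integral_ge0 => w _; rewrite lee_fin mulr_ge0// (quotient_energy_ge0 BS S Yphi).
have q1 : (\int[mu]_z (q z)%:E <= 1)%E.
  apply: (@le_trans _ _ (\int[mu]_z (((12 * dist x) ^+ n)^-1%:E * (D x z < 6 * dist x)%R%:R%:E))%E).
    apply: ge0_le_int => z _; first by rewrite lee_fin q0.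
    rewrite -EFinM lee_fin /q mulrC; apply: ler_wpM2l; first by rewrite invr_ge0 exprn_ge0// ltW.
    by rewrite ler_nat; case: (z \in S).
  rewrite integralMl ?invr_ge0 ?exprn_ge0 ?(ltW r12)//; last by mf.
  rewrite (integral_ball BS) ?mulr_gt0// -EFinM lee_fin (_ : 2 * (6 * dist x) = 12 * dist x); last by ring.
  by rewrite mulVf// expf_neq0// gt_eqF.
have := jensen Yphi mq muc q0 _ q1 mE.
move=> /(_ (fun z => divr_ge0 (normr_ge0 _) (ltW al0))) J; apply: (le_trans J).
have k0 : 0 <= ((12 * dist x) ^+ n)^-1 * (9 * dist x) ^+ (2 * n).
  by rewrite mulr_ge0 ?invr_ge0 ?exprn_ge0 ?(ltW r12)// mulr_ge0.
rewrite -EFinM -integralMl//; last first.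
  by mf => z w; rewrite lee_fin mulr_ge0// (quotient_energy_ge0 BS S Yphi).
apply: ge0_le_int => z _; first by rewrite lee_fin mulr_ge0// (phi_ge0 Yphi).
have [zS|zS] := boolP (z \in S); last by rewrite /q (negbTE zS) !mul0r mule_ge0.
have [xz|xz] := ltP (D x z) (6 * dist x); last first.
  by rewrite /q ltNge xz andbF !mul0r mule_ge0.
rewrite /q zS xz mul1r [X in (_ <= X * _)%E]EFinM -muleA EFinM.
rewrite lee_wpmul2l ?lee_fin ?invr_ge0 ?exprn_ge0 ?(ltW r12)//.
rewrite distrC; apply: (le_trans (jensen_avg _ (or_intror dx))).
rewrite /avg (rk_disjoint dx) -integralMl ?exprn_ge0 ?mulr_ge0//; first last.
- by mf.
- by move=> w; rewrite lee_fin mulr_ge0// (quotient_energy_ge0 BS S Yphi).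
apply: ge0_le_int => w _; first by rewrite mule_ge0// lee_fin ?(phi_ge0 Yphi).
rewrite -!EFinM lee_fin.
have [->|Pn0] := eqVneq (P x w) 0; first by rewrite !mul0r mulr0.
have [_ Sw xw] := rk_supp RK Pn0.
rewrite mulrCA; apply: ler_wpM2l => //; rewrite distrC; apply: (phi_le_quotient_energy BS Yphi) => //.
  exact: set_mem.
by have := D_tri BS x z w; rewrite (D_sym BS z x); move: xz xw; lra.
Qed.

Lemma near_estimate :
  (\int[mu]_y ((D x y < dist x / 3)%R%:R *
     (phi (`|ext u x - ext u y| / (ext_const * al)) / D x y ^+ (2 * n)))%:E <=
   near_const%:E * \int[mu]_z \int[mu]_w (P x w * H u al z w)%:E)%E.
Proof.
have C0 : 1 <= ext_const by rewrite lerDl mulr_ge0// exprn_ge0.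
have C1 : LP * 12 ^+ n <= ext_const by rewrite lerDr.
have C00 : 0 < ext_const by apply: lt_le_trans C0.
have d3 : 0 < dist x / 3 by rewrite divr_gt0.
(* The slope m / 2 is used because [integral_radial] returns phi at twice its argument and no
   doubling is available; the halving is paid for by the small radius dist x / 3. *)
have m2 : 0 <= m / 2 by rewrite divr_ge0.
have Cg0 : 0 <= Cg.
  have := growth ltr01; rewrite expr1n divr1 => h.
  have : (0 <= Cg * phi 1).
    rewrite -lee_fin; apply: le_trans h; apply: integral_ge0 => s /=.
    rewrite in_itv/= => /andP[s0 _]; rewrite lee_fin !divr_ge0 ?(phi_ge0 Yphi) ?exprn_ge0// ltW//.
  by rewrite pmulr_lge0// (phi_pos Yphi).
apply: (@le_trans _ _ (\int[mu]_y ((D x y < dist x / 3)%R%:R *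
     (phi (m / 2 * (D x y / (dist x / 3))) / D x y ^+ (2 * n)))%:E)%E).
  apply: ge0_le_int => y _.
    by rewrite lee_fin mulr_ge0// divr_ge0 ?(phi_ge0 Yphi)// exprn_ge0// (D_ge0 BS).
  rewrite lee_fin; case: ltP => [xy|_]; last by rewrite !mul0r.
  rewrite !mul1r; apply: ler_wpM2r; first by rewrite invr_ge0 exprn_ge0// (D_ge0 BS).
  apply: (phi_ndecr Yphi); rewrite ler_pdivrMr ?mulr_gt0//.
  apply: (le_trans (ext_lipschitz xy)).
  have D0 : 0 <= D x y / dist x * (al * m).
    by rewrite mulr_ge0 ?divr_ge0 ?(D_ge0 BS)// mulr_ge0// ltW.
  rewrite (_ : m / 2 * _ * _ = 3 / 2 * ext_const * (D x y / dist x * (al * m))); last first.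
    by field; rewrite gt_eqF.
  rewrite -mulrA; apply: ler_wpM2r => //; move: C1 C00; lra.
apply: (le_trans (integral_radial BS Yphi growth x m2 d3)).
rewrite (_ : 2 * (m / 2) = m); last by field.
rewrite (_ : _ * phi m / _ = 2 ^+ (2 * n).+1 * Cg * 3 ^+ n / dist x ^+ n * phi m); last first.
  by rewrite expr_div_n; field; rewrite !expf_neq0// gt_eqF.
have k0 : 0 <= 2 ^+ (2 * n).+1 * Cg * 3 ^+ n / dist x ^+ n.
  by rewrite divr_ge0 ?exprn_ge0// mulr_ge0 ?exprn_ge0// mulr_ge0// exprn_ge0.
rewrite EFinM; apply: (le_trans (lee_wpmul2l _ jensen_q)); first by rewrite lee_fin.
rewrite muleA -!EFinM le_eqVlt; apply/orP; left; apply/eqP; congr (_%:E * _)%E.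
rewrite /near_const !exprMn (_ : dist x ^+ (2 * n) = dist x ^+ n * dist x ^+ n); last first.
  by rewrite mul2n -addnn exprD.
have e1 : (12 : R) ^+ n != 0 by rewrite expf_neq0.
have e2 : dist x ^+ n != 0 by rewrite expf_neq0// gt_eqF.
move: (12 ^+ n : R) (dist x ^+ n) (9 ^+ (2 * n) : R) e1 e2 => p t s e1 e2; field.
by rewrite e1 e2.
Qed.

End Near.

Definition energy_const : R := 22 ^+ (2 * n) * (1 + CO) ^+ 2 + near_const * CO.

Lemma near_const_ge0 : 0 <= near_const.
Proof.
rewrite /near_const !mulr_ge0 ?invr_ge0 ?exprn_ge0//; exact: (growth_ge0 Yphi growth).
Qed.

Let negl : mu.-negligible [set x | ~ inV x].
Proof.
exists [set x | dist x = 0 /\ ~ S x]; split => //.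
- rewrite (_ : mkset _ = dist @^-1` [set 0] `\` S)//; apply: measurableD => //.
  by rewrite -[X in measurable X]setTI; apply: mdist.
- exact: (rk_bnd RK).
move=> x /= h; split; last by move=> Sx; apply: h; left.
apply/eqP; rewrite eq_le dist0 andbT leNgt; apply/negP => dx.
by apply: h; right.
Qed.

(** The pointwise estimates are available only on S and at positive distance from it; the remaining
    points are negligible. *)
Let aeV (F : X -> \bar R) (G : X -> \bar R) : (forall x, 0 <= F x)%E -> (forall x, 0 <= G x)%E ->
  measurable_fun setT F -> measurable_fun setT G -> (forall x, inV x -> F x <= G x)%E ->
  (\int[mu]_x F x <= \int[mu]_x G x)%E.
Proof.
move=> F0 G0 mF mG FG; apply: ae_ge0_le_integral => //.
have [A [mA A0 sA]] := negl; exists A; split => // x /= h; apply: sA => /= Vx.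
by apply: h => _; exact: FG.
Qed.

(** Far pairs cost a double average of the energy density, bounded by [integral2_avg]. For near
    pairs the bound W x contains P x w, and integrating it in x costs CO by the overlap bound. *)
Theorem ext_energy :
  (\int[mu]_x \int[mu]_y (phi (`|ext u x - ext u y| / (ext_const * al)) / D x y ^+ (2 * n))%:E
    <= energy_const%:E * energy u al)%E.
Proof.
have me := measurable_ext.
have C0 : 1 <= ext_const by rewrite lerDl mulr_ge0// exprn_ge0.
have C00 : 0 < ext_const by apply: lt_le_trans C0.
have N0 := near_const_ge0.
pose f x y := phi (`|ext u x - ext u y| / (ext_const * al)) / D x y ^+ (2 * n).
have f0 x y : 0 <= f x y by rewrite divr_ge0 ?(phi_ge0 Yphi)// exprn_ge0// (D_ge0 BS).
have mf_ : measurable_fun setT (fun p : X * X => f p.1 p.2) by rewrite /f; mf.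
pose AA x y := avg mu S P (fun z => avg mu S P (fun w => (H u al z w)%:E) y) x.
have AA1 y z : (0 <= avg mu S P (fun w => (H u al z w)%:E) y)%E by apply: (avg_ge0 RK).
have AA0 x y : (0 <= AA x y)%E by apply: (avg_ge0 RK).
have mAA : measurable_fun setT (fun p : X * X => AA p.1 p.2).
  have mG' : measurable_fun setT (fun p : X * X => avg mu S P (fun w => (H u al p.2 w)%:E) p.1).
    exact: (mf_comp2 (f := fun z y => avg mu S P (fun w => (H u al z w)%:E) y)
      measurable_avgH2 (@measurable_snd _ _ _ _) (@measurable_fst _ _ _ _)).
  have mA := measurable_avg RK (G := fun y z => avg mu S P (fun w => (H u al z w)%:E) y) (fun y z => AA1 y z) mG'.
  exact: (mf_comp2 (f := fun y x => AA x y) mA (@measurable_snd _ _ _ _) (@measurable_fst _ _ _ _)).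
pose W x := (\int[mu]_z \int[mu]_w (P x w * H u al z w)%:E)%E.
have W00 x z : (0 <= \int[mu]_w (P x w * H u al z w)%:E)%E.
  by apply: integral_ge0 => w _; rewrite lee_fin mulr_ge0// (quotient_energy_ge0 BS S Yphi).
have W0 x : (0 <= W x)%E by apply: integral_ge0.
have mW : measurable_fun setT W.
  by rewrite /W; mf; move=> *; first [exact: W00|by rewrite lee_fin mulr_ge0// (quotient_energy_ge0 BS S Yphi)].
pose g x y := ((0 < dist x) && (D x y < dist x / 3))%R%:R * f x y.
have g0 x y : 0 <= g x y by rewrite mulr_ge0.
have mg : measurable_fun setT (fun p : X * X => g p.1 p.2) by rewrite /g; mf.
have I1 x : (0 <= \int[mu]_y AA x y)%E by apply: integral_ge0.
have step x : inV x -> (\int[mu]_y (f x y)%:E <=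
    (22 ^+ (2 * n))%:E * \int[mu]_y AA x y + near_const%:E * W x)%E.
  move=> Vx.
  have e0 : 0 <= (22 : R) ^+ (2 * n) by rewrite exprn_ge0.
  apply: (@le_trans _ _ (\int[mu]_y ((22 ^+ (2 * n))%:E * AA x y + (g x y)%:E))%E).
    apply: aeV.
    - by move=> y; rewrite lee_fin.
    - by move=> y; rewrite adde_ge0 ?lee_fin// mule_ge0// lee_fin.
    - by mf.
    - by mf.
    move=> y Vy; have [near|far] := boolP ((0 < dist x) && (D x y < dist x / 3)).
      by rewrite /g near mul1r -[leLHS]add0e leeD// mule_ge0// lee_fin.
    rewrite -[leLHS]adde0 leeD ?lee_fin//.
    apply: (le_trans _ (far_estimate Vx Vy _)).
      rewrite lee_fin; apply: ler_wpM2r; first by rewrite invr_ge0 exprn_ge0// (D_ge0 BS).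
      apply: (phi_ndecr Yphi); apply: ler_wpM2l => //.
      by rewrite lef_pV2 ?posrE ?mulr_gt0// ler_peMl// ltW.
    move: far; rewrite negb_and -!leNgt => /orP[d0|]; last by lra.
    by rewrite (le_trans d0)// mulr_ge0// (D_ge0 BS).
  rewrite integralDT; first last.
  - by mf.
  - by mf.
  - by move=> y; rewrite lee_fin.
  - by move=> y; rewrite mule_ge0// lee_fin.
  rewrite integralMl//; last by mf.
  rewrite leeD2l//; have [dx|dx] := ltP 0 (dist x); last first.
    rewrite integral0_eq ?mule_ge0 ?lee_fin// => y _.
    by rewrite /g ltNge dx mul0r.
  apply: le_trans (near_estimate dx); rewrite le_eqVlt; apply/orP; left; apply/eqP.
  by apply: eq_integral => y _; rewrite /g dx.
apply: (@le_trans _ _ (\int[mu]_x ((22 ^+ (2 * n))%:E * \int[mu]_y AA x y + near_const%:E * W x))%E).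
  apply: aeV => //.
  - by move=> x; apply: integral_ge0 => y _; rewrite lee_fin; exact: f0.
  - by move=> x; apply: adde_ge0; apply: mule_ge0; rewrite // lee_fin ?exprn_ge0.
  - by mf => x y; rewrite lee_fin; exact: f0.
  - by mf.
rewrite integralDT; first last.
- by mf.
- by mf.
- by move=> x; rewrite mule_ge0// lee_fin.
- by move=> x; apply: mule_ge0; rewrite // lee_fin ?exprn_ge0.
have En0 : (0 <= energy u al)%E by apply: integral_ge0 => z _; apply: integral_ge0.
rewrite [X in (X + _ <= _)%E]integralMl ?exprn_ge0//; last by mf.
rewrite [X in (_ + X <= _)%E]integralMl//.
have N1 : 0 <= near_const * CO by exact: mulr_ge0.
have N2 : 0 <= 22 ^+ (2 * n) * (1 + CO) ^+ 2 :> R.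
  by rewrite mulr_ge0 ?exprn_ge0// addr_ge0.
rewrite /energy_const EFinD ge0_muleDl ?lee_fin//.
apply: leeD.
  rewrite EFinM -muleA lee_wpmul2l ?lee_fin ?exprn_ge0//.
  rewrite /AA /energy.
  by apply: (integral2_avg RK (H := fun z w => (H u al z w)%:E)) => //; mf.
rewrite [(near_const * CO)%:E]EFinM -muleA lee_wpmul2l ?lee_fin//.
rewrite /W tonelli//; last by mf; move=> *; first [exact: W00|by rewrite lee_fin mulr_ge0// (quotient_energy_ge0 BS S Yphi)].
rewrite /energy -integralMl//; first last.
- by mf.
- by move=> z; apply: integral_ge0.
apply: ge0_le_int => z _; first by apply: integral_ge0.
rewrite tonelli; last 2 first.
- by mf.
- by move=> x w; rewrite lee_fin mulr_ge0// (quotient_energy_ge0 BS S Yphi).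
rewrite -integralMl//; last by mf.
apply: ge0_le_int => w _.
  by apply: integral_ge0 => x _; rewrite lee_fin mulr_ge0// (quotient_energy_ge0 BS S Yphi).
under eq_integral do rewrite EFinM.
rewrite integralMr//; last 2 first.
- by move=> x; rewrite lee_fin.
- by mf.
by rewrite lee_wpmul2r// (rk_over RK).
Qed.

End Function.
End ExtensionEstimate.

(** * Sup-norm model of R^n *)

Section EuclideanBallSpace.
Context (R : realType) (n : nat).
Local Notation E := (Rn R n).

Definition supdist (x y : E) : R := `|(x : 'rV[R]_n) - (y : 'rV[R]_n)|.

Lemma rV_norm_lt (v : 'rV[R]_n) (r : R) : 0 < r ->
  reflect (forall i, `|v ord0 i| < r) (`|v| < r).
Proof.
move=> r0; rewrite /Num.norm /= mx_normrE; apply: (iffP idP) => [h i|h].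
  by apply: le_lt_trans h; rewrite (bigmaxD1 (ord0, i))//= le_max lexx.
by apply/bigmax_ltP; split=> // -[i j] _ /=; rewrite (ord1 i); exact: h.
Qed.

Lemma supdist_sym x y : supdist x y = supdist y x.
Proof. exact: distrC. Qed.

Lemma supdist_tri y x z : supdist x z <= supdist x y + supdist y z.
Proof. exact: ler_distD. Qed.

Lemma measurable_preimage_box (A : 'I_n -> set R) : (forall i, measurable (A i)) ->
  measurable ((@tuple_of_row R n @^-1` tuple_box A) : set E).
Proof.
move=> mA; apply: sub_caratheodory; apply: sub_sigma_algebra.
by exists (tuple_box A); [exact: measurable_tuple_box|rewrite setTI].
Qed.

Lemma lebesgueRn_preimage_box (A : 'I_n -> set R) : (forall i, measurable (A i)) ->
  lebesgueRn ((@tuple_of_row R n @^-1` tuple_box A) : set E) =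
  (\prod_(i < n) lebesgue_measure (A i))%E.
Proof.
move=> mA.
have mB : measurable ((@tuple_of_row R n @^-1` tuple_box A) : set (borelRn R n)).
  by exists (tuple_box A); [exact: measurable_tuple_box|rewrite setTI].
rewrite /lebesgueRn /completed_measure_extension measurable_mu_extE//.
rewrite /borel_lebesgueRn /pushforward -tuple_lebesgue_box//; congr (tuple_lebesgue R n _).
by apply/seteqP; split=> t /=; rewrite row_of_tupleK.
Qed.

Lemma supball_preimage_box (x : E) (r : R) : 0 < r ->
  [set y | supdist x y < r] = @tuple_of_row R n @^-1`
    tuple_box (fun i => `](x : 'rV[R]_n) ord0 i - r, (x : 'rV[R]_n) ord0 i + r[%classic).
Proof.
move=> r0; apply/seteqP; split=> y /=.
  move=> /(rV_norm_lt _ r0) h i; have := h i; rewrite !mxE tnth_mktuple /= in_itv/=.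
  by rewrite distrC ltr_distl.
move=> h; apply/(rV_norm_lt _ r0) => i; have := h i; rewrite !mxE tnth_mktuple /= in_itv/=.
by rewrite distrC ltr_distl.
Qed.

Lemma measurable_supball (x : E) (r : R) : measurable [set y | supdist x y < r].
Proof.
have [r0|r0] := ltP 0 r.
  by rewrite supball_preimage_box//; apply: measurable_preimage_box => i; exact: measurable_itv.
rewrite (_ : mkset _ = set0)//; apply/seteqP; split=> y //=.
by rewrite ltNge => /negP; apply; apply: le_trans r0 _; exact: normr_ge0.
Qed.

Lemma lebesgueRn_supball (x : E) (r : R) : 0 < r ->
  lebesgueRn [set y | supdist x y < r] = ((2 * r) ^+ n)%:E.
Proof.
move=> r0; rewrite supball_preimage_box// lebesgueRn_preimage_box; last first.
  by move=> i; exact: measurable_itv.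
under eq_bigr => i _.
  rewrite lebesgue_measure_itv/= lte_fin ifT; last by lra.
  rewrite -EFinD (_ : _ - _ = 2 * r); last by ring.
  over.
by rewrite prodEFin prodr_const card_ord.
Qed.

(** A is the union of the countably many balls with rational centre and radius contained in it; the
    other rational balls are replaced by the empty set. *)
Lemma measurable_supdist_open (A : set E) :
  (forall x, A x -> exists2 e, 0 < e & forall y, supdist x y < e -> A y) -> measurable A.
Proof.
move=> oA.
pose B (p : 'rV[rat]_n * rat) : set E :=
  [set y | supdist (map_mx ratr p.1 : 'rV[R]_n) y < ratr p.2].
pose C (p : 'rV[rat]_n * rat) : set E := if `[< B p `<=` A >] then B p else set0.
rewrite (_ : A = \bigcup_p C p).
  apply: countable_bigcupT_measurable => // p; rewrite /C.
  by case: ifP => // _; exact: measurable_supball.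
apply/seteqP; split=> [x Ax|x [p _]]; last by rewrite /C; case: asboolP => // h /h.
have [e e0 he] := oA x Ax.
have [s] := rat_in_itvoo (divr_gt0 e0 (ltr0n R 2)).
rewrite in_itv/= => /andP[s0 se].
have /choice[f hf] : forall i : 'I_n, exists q : rat,
    `|(x : 'rV[R]_n) ord0 i - ratr q| < ratr s.
  move=> i; have : (x : 'rV[R]_n) ord0 i - ratr s < (x : 'rV[R]_n) ord0 i + ratr s by lra.
  move=> /rat_in_itvoo[q]; rewrite in_itv/= => /andP[h1 h2]; exists q.
  by rewrite ltr_distl; apply/andP; split; lra.
pose q : 'rV[rat]_n := \row_i f i.
have xq : supdist x (map_mx ratr q : 'rV[R]_n) < ratr s.
  by apply/(rV_norm_lt _ s0) => i; rewrite !mxE.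
exists (q, s) => //; rewrite /C; case: asboolP => [_|]; first by rewrite /B /= supdist_sym.
case=> y /= qy; apply: he; apply: le_lt_trans (supdist_tri (map_mx ratr q : 'rV[R]_n) _ _) _.
by apply: lt_trans (ltrD xq qy) _; lra.
Qed.

Lemma lebesgueRn_sigma_finite : sigma_finite [set: E] (@lebesgueRn R n).
Proof.
exists (fun k => [set y | supdist (0 : 'rV[R]_n) y < k.+1%:R]).
  apply/seteqP; split=> // y _; exists (Num.truncn (supdist (0 : 'rV[R]_n) y)) => //=.
  exact: truncnS_gt.
move=> k; split; first exact: measurable_supball.
by rewrite lebesgueRn_supball// ltry.
Qed.

HB.instance Definition _ := @Measure_isSigmaFinite.Build _ _ _ (@lebesgueRn R n)
  lebesgueRn_sigma_finite.

Lemma measurable_coord (i : 'I_n) : measurable_fun [set: E] (fun x : E => (x : 'rV[R]_n) ord0 i).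
Proof.
move=> _ Y mY; rewrite setTI.
rewrite (_ : _ @^-1` Y = @tuple_of_row R n @^-1` tuple_box (fun j => if j == i then Y else setT)).
  by apply: measurable_preimage_box => j; case: ifP.
apply/seteqP; split=> x /= h; last by have := h i; rewrite eqxx tnth_mktuple.
by move=> j; case: eqP => // ->; rewrite tnth_mktuple.
Qed.

Lemma measurable_supdist : measurable_fun setT (fun p : E * E => supdist p.1 p.2).
Proof.
apply: (measurability (@RGenInftyO.G R)); first exact: RGenInftyO.measurableE.
move=> _ [_ [r ->] <-]; rewrite setTI.
have [r0|r0] := ltP 0 r; last first.
  rewrite (_ : _ @^-1` _ = set0)//; apply/seteqP; split=> p //=.
  by rewrite in_itv/= ltNge => /negP; apply; apply: le_trans r0 _; exact: normr_ge0.
rewrite (_ : _ @^-1` _ = \bigcap_(i in [set: 'I_n])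
    [set p : E * E | `|(p.1 : 'rV[R]_n) ord0 i - (p.2 : 'rV[R]_n) ord0 i| < r]).
  apply: fin_bigcap_measurable => [|i _]; first exact: finite_finset.
  have mi := measurable_coord i.
  apply: measurable_boolset; apply: mf_lt; last exact: measurable_cst.
  apply: mf_norm; apply: mfD; first exact: (mf_comp mi (@measurable_fst _ _ _ _)).
  by apply: mfN; exact: (mf_comp mi (@measurable_snd _ _ _ _)).
apply/seteqP; split=> p /=; rewrite in_itv/=.
  by move=> /(rV_norm_lt _ r0) h i _; have := h i; rewrite !mxE.
by move=> h; apply/(rV_norm_lt _ r0) => i; have := h i I; rewrite !mxE.
Qed.

Lemma Rn_ball_space : ball_space (@lebesgueRn R n) supdist n.
Proof.
split.
- by move=> x; rewrite /supdist subrr normr0.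
- by move=> x y /eqP; rewrite normr_eq0 subr_eq0 => /eqP.
- exact: supdist_sym.
- exact: supdist_tri.
- exact: measurable_supdist_open.
- exact: measurable_supdist.
- exact: lebesgueRn_supball.
Qed.

End EuclideanBallSpace.

(** * Regular sets are extension sets *)

Section ReflectionKernel.
Context d (X : measurableType d) (R : realType).
Context (mu : {sigma_finite_measure set X -> \bar R}) (D : X -> X -> R) (n : nat).
Hypothesis BS : ball_space mu D n.
Context (S : set X) (c : R).
Hypothesis S0 : S !=set0.
Hypothesis c0 : 0 < c.
Hypothesis oS : metric_open D S.
Hypothesis rS : inner_regular mu D n S c.

Lemma regular_measure_gt0 : (0 < mu S)%E.
Proof.
have [a Sa] := S0; have mS := measurable_metric_open BS oS.
apply: (@lt_le_trans _ _ (mu [set y | D a y < 1 /\ S y])).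
  by apply: lt_le_trans (rS Sa ltr01); rewrite expr1n mulr1 lte_fin.
apply: le_measure; rewrite ?inE//; last by move=> y [].
rewrite (_ : mkset _ = [set y | D a y < 1] `&` S)//.
by apply: measurableI => //; exact: (mball BS).
Qed.

Lemma reflection_kernelP : reflection_kernel mu D n S (setdist D S)
  (pkernel mu D n S c) (mass_const n c)^-1 (2 * load_bound n c / mass_const n c)
  (pkernel_lip_const n c).
Proof.
have mc0 := mass_const_gt0 n c0; have lb0 := load_bound_gt0 n c0.
have pn := pkernel_neq0 BS S0 c0 oS.
split.
- exact: (measurable_metric_open BS oS).
- exact: (measurable_setdist BS S0).
- exact: (setdist_ge0 BS S0).
- exact: (setdist_in BS S0).
- exact: (setdist_tri BS S0).
- exact: regular_measure_gt0.
- exact: (boundary_null BS S0 c0 oS rS).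
- exact: pkernel_ge0.
- exact: (measurable_pkernel BS c S0 oS).
- by move=> x z /pn[].
- move=> x z; apply: le_trans (pkernel_le BS S0 c0 oS rS x z) _.
  apply: ler_wpM2l; first by rewrite invr_ge0 ltW.
  rewrite /wkernel -[leRHS]mul1r; apply: ler_wpM2r.
    by rewrite invr_ge0 exprn_ge0// (setdist_ge0 BS S0).
  by rewrite lern1; case: (_ < _).
- exact: (integral_pkernel BS S0 c0 oS rS).
- move=> z; have [Sz|nSz] := pselect (S z); first exact: (pkernel_overlap BS S0 c0 oS rS).
  rewrite integral0_eq; first by rewrite lee_fin divr_ge0 ?(ltW mc0)// mulr_ge0// ltW.
  by move=> x _; congr EFin; apply/eqP/negPn/negP => /pn[].
- by rewrite invr_ge0 ltW.
- by rewrite divr_ge0 ?(ltW mc0)// mulr_ge0// ltW.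
- rewrite /pkernel_lip_const mulr_ge0 ?weight_lip_const_ge0// addr_ge0// divr_ge0 ?exprn_ge0//; exact: ltW.
- by move=> x x' z dx xx'; exact: (pkernel_lip BS S0 c0 oS rS).
Qed.

Context (phi : R -> R) (Cg : R).
Hypothesis Yphi : young_on_R phi.
Hypothesis growth : forall t, 0 < t ->
  (\int[lebesgue_measure]_(s in `]0%R, t[) (phi s / s ^+ n / s)%:E <=
  (Cg * phi t / t ^+ n)%:E)%E.

Definition regular_ext (u : X -> R) : X -> R := ext mu S (pkernel mu D n S c) u.

(** The energy constant is absorbed into the parameter: dividing the argument of phi by K >= 1
    divides phi by at least K. *)
Theorem regular_ext_bounded : exists2 C : R, 0 < C & forall u al,
  measurable_fun setT u -> 0 < al -> (energy mu D n S phi u al <= 1)%E ->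
  (\int[mu]_x \int[mu]_y (phi (`|regular_ext u x - regular_ext u y| / (C * al)) /
     D x y ^+ (2 * n))%:E <= 1)%E.
Proof.
have RK := reflection_kernelP.
set EC := energy_const n (2 * load_bound n c / mass_const n c) Cg.
set C1 := ext_const n (pkernel_lip_const n c).
have C10 : 0 < C1 by rewrite /C1 /ext_const ltr_pwDl// mulr_ge0 ?(rk_LP0 RK)// exprn_ge0.
pose K := Num.max 1 EC.
have K1 : 1 <= K by rewrite le_max lexx.
have K0 : 0 < K by apply: lt_le_trans K1.
exists (K * C1); first exact: mulr_gt0.
move=> u al mu_ al0 e1.
have fin : (energy mu D n S phi u al < +oo)%E by apply: le_lt_trans e1 _; rewrite ltry.
have := ext_energy BS RK Yphi growth mu_ al0 fin; rewrite -/EC -/C1 => h.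
have me := measurable_ext RK mu_.
have mphi := measurable_phi Yphi; have mD := D_meas BS.
have f0 k x y : (0 <= (phi (`|ext mu S (pkernel mu D n S c) u x -
   ext mu S (pkernel mu D n S c) u y| / k) / D x y ^+ (2 * n))%:E)%E.
  by rewrite lee_fin divr_ge0 ?(phi_ge0 Yphi)// exprn_ge0// (D_ge0 BS).
rewrite /regular_ext; move: (ext mu S _ u) f0 h me => v f0 h me.
apply: (@le_trans _ _ (\int[mu]_x (K^-1%:E * \int[mu]_y (phi (`|v x - v y| / (C1 * al)) /
     D x y ^+ (2 * n))%:E))%E).
  apply: ge0_le_int => x _; first by apply: integral_ge0.
  rewrite -integralMl ?invr_ge0 ?(ltW K0)//; last by mf.
  apply: ge0_le_int => y _; first exact: f0.
  rewrite -EFinM lee_fin mulrA; apply: ler_wpM2r.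
    by rewrite invr_ge0 exprn_ge0// (D_ge0 BS).
  rewrite -mulrA invfM mulrCA; apply: (phi_scale Yphi).
  - by rewrite invr_ge0 ltW.
  - by rewrite invf_le1.
  - by rewrite divr_ge0// ltW// mulr_gt0.
rewrite integralMl ?invr_ge0 ?(ltW K0)//; last 2 first.
- by move=> x; apply: integral_ge0.
- by mf.
have EC0 : 0 <= EC.
  have N0 := near_const_ge0 Yphi growth; have CO0 := rk_CO0 RK.
  rewrite /EC /energy_const addr_ge0 ?(mulr_ge0 N0)// mulr_ge0 ?exprn_ge0//.
  by rewrite addr_ge0.
apply: (@le_trans _ _ (K^-1%:E * EC%:E)%E).
  rewrite lee_wpmul2l ?lee_fin ?invr_ge0 ?(ltW K0)//.
  apply: le_trans h _; rewrite -[leRHS]mule1 lee_wpmul2l ?lee_fin//.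
by rewrite -EFinM lee_fin mulrC ler_pdivrMr// mul1r /K le_max lexx orbT.
Qed.

End ReflectionKernel.

(** * Adding a far exterior to a bounded set *)

Section AddExterior.
Context d (X : measurableType d) (R : realType).
Context (mu : {sigma_finite_measure set X -> \bar R}) (D : X -> X -> R) (n : nat).
Hypothesis BS : ball_space mu D n.
Hypothesis n0 : (0 < n)%N.
Context (S : set X) (c : R) (x0 : X) (r : R).
Hypothesis c0 : 0 < c.
Hypothesis r0 : 0 < r.
Hypothesis mS : measurable S.
Hypothesis muS : ((c * r ^+ n)%:E <= mu S)%E.
Hypothesis Sr : forall x, S x -> D x0 x <= r.
Context (phi : R -> R).
Hypothesis Yphi : young_on_R phi.
Let mD := D_meas BS.
Let mphi := measurable_phi Yphi.

(** The radius 2 r leaves a gap r between S and the exterior, so cross terms are controlled by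
    [integral_tail] at radius r. *)
Definition exterior : set X := [set x | 2 * r < D x0 x].
Definition mean_value (u : X -> R) : R := \int[mu]_z ((z \in S)%:R / fine (mu S) * u z).
Definition add_mean (u : X -> R) (x : X) : R := if x \in S then u x else mean_value u.

Let mE : measurable exterior.
Proof. by apply: measurable_boolset; mf. Qed.

Let muS_fin : (mu S < +oo)%E.
Proof.
apply: (@le_lt_trans _ _ (mu [set y | D x0 y < 2 * r])).
  by apply: le_measure; rewrite ?inE//; [exact: (mball BS)|move=> x /Sr /=; move: r0; lra].
by rewrite (D_ball BS) ?mulr_gt0// ltry.
Qed.

Let muS0 : (0 < mu S)%E.
Proof. by apply: lt_le_trans muS; rewrite lte_fin mulr_gt0// exprn_gt0. Qed.

Let muSE : mu S = (fine (mu S))%:E.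
Proof. by rewrite fineK// ge0_fin_numE. Qed.

Let fS : c * r ^+ n <= fine (mu S). Proof. by rewrite -lee_fin -muSE. Qed.

Let fS0 : 0 < fine (mu S).
Proof. by apply: lt_le_trans fS; rewrite mulr_gt0// exprn_gt0. Qed.

Let w z : R := (z \in S)%:R / fine (mu S).
Let mw : measurable_fun setT w. Proof. by rewrite /w; mf. Qed.
Let w0 z : 0 <= w z. Proof. by rewrite divr_ge0// ltW. Qed.
Let K0 : 0 <= (fine (mu S))^-1. Proof. by rewrite invr_ge0 ltW. Qed.
Let hw z : w z <= (fine (mu S))^-1 * ((z \in S) && (D x0 z < 2 * r))%R%:R.
Proof.
rewrite /w mulrC; apply: ler_wpM2l => //; rewrite ler_nat.
by case: (boolP (z \in S)) => // /set_mem /Sr h; rewrite (_ : D x0 z < 2 * r)//; move: r0; lra.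
Qed.
Let w1 : (\int[mu]_z (w z)%:E = 1)%E.
Proof.
rewrite /w; under eq_integral do rewrite mulrC EFinM.
rewrite integralMl//; last by mf.
rewrite integral_bool; last by mf.
rewrite (_ : mkset _ = S); last by apply/seteqP; split=> x /= => [/set_mem|/mem_set].
by rewrite [X in (_ * X)%E]muSE -EFinM mulVf// gt_eqF.
Qed.

Section Function.
Context (u : X -> R) (al : R).
Hypothesis mu_ : measurable_fun setT u.
Hypothesis al0 : 0 < al.
Hypothesis fin : (energy mu D n S phi u al < +oo)%E.
Local Notation H := (quotient_energy D n S phi u al).
Let H0 z y : (0 <= (H z y)%:E)%E.
Proof. by rewrite lee_fin (quotient_energy_ge0 BS). Qed.
Let mH := measurable_quotient_energy BS mS Yphi al mu_.
Let HI0 z : (0 <= \int[mu]_y (H z y)%:E)%E. Proof. by apply: integral_ge0. Qed.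

Lemma measurable_add_mean : measurable_fun setT (add_mean u).
Proof. by rewrite /add_mean; mf. Qed.

Lemma integrable_mean : mu.-integrable setT (EFin \o (fun z => w z * u z)).
Proof. exact: (integrable_nnweightM BS mS muS0 Yphi mu_ al0 fin mw K0 w0 hw). Qed.

(** The tail in y costs 2 * 4^n / r^n. Jensen bounds the deviation of u z from the mean by an
    average over S, where mu S >= c r^n and distances are at most 2 r, giving (2 r)^(2 n) / (c r^n).
    The product is 2 * 16^n / c. *)
Let cross z : S z ->
  (\int[mu]_y ((y \in exterior)%:R * (phi (`|u z - mean_value u| / al) / D z y ^+ (2 * n)))%:E
   <= (2 * 16 ^+ n / c)%:E * \int[mu]_y (H z y)%:E)%E.
Proof.
move=> Sz; have p0 : 0 <= phi (`|u z - mean_value u| / al) by exact: (phi_ge0 Yphi).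
apply: (@le_trans _ _ (\int[mu]_y ((phi (`|u z - mean_value u| / al))%:E *
    ((r <= D z y)%R%:R / D z y ^+ (2 * n))%:E))%E).
  apply: ge0_le_int => y _.
    by rewrite lee_fin mulr_ge0// divr_ge0// exprn_ge0// (D_ge0 BS).
  rewrite -EFinM lee_fin mulrCA; apply: ler_wpM2l => //; apply: ler_wpM2r.
    by rewrite invr_ge0 exprn_ge0// (D_ge0 BS).
  rewrite ler_nat; case: (boolP (y \in exterior)) => // /set_mem ye.
  rewrite (_ : r <= D z y)//; have := Sr Sz; have := D_tri BS z x0 y; move: ye; rewrite /exterior /=.
  by move: r0; lra.
rewrite integralMl//; first last.
- by mf.
- by move=> y; rewrite lee_fin divr_ge0// exprn_ge0// (D_ge0 BS).
apply: (le_trans (lee_wpmul2l _ (integral_tail BS z n0 r0))); first by rewrite lee_fin.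
have c1 : 0 <= 2 * 4 ^+ n / r ^+ n by rewrite divr_ge0 ?exprn_ge0 ?(ltW r0)// mulr_ge0// exprn_ge0.
have := jensen_weight BS mS muS0 Yphi mu_ al0 fin mw K0 w0 hw w1 (u z).
rewrite -/(mean_value u) distrC => J.
rewrite muleC; apply: (le_trans (lee_wpmul2l _ J)); first by rewrite lee_fin.
have c2 : 0 <= (2 * r) ^+ (2 * n) / (c * r ^+ n).
  by rewrite divr_ge0 ?exprn_ge0 ?mulr_ge0 ?(ltW r0) ?(ltW c0)// exprn_ge0// ltW.
apply: (@le_trans _ _ ((2 * 4 ^+ n / r ^+ n)%:E *
    (((2 * r) ^+ (2 * n) / (c * r ^+ n))%:E * \int[mu]_y (H z y)%:E))%E).
  rewrite lee_wpmul2l ?lee_fin// -integralMl//; last by mf.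
  apply: ge0_le_int => y _; first by rewrite mule_ge0// lee_fin ?(phi_ge0 Yphi).
  rewrite -!EFinM lee_fin /w; case: (boolP (y \in S)) => [/set_mem Sy|_]; last first.
    by rewrite !mul0r mulr_ge0// (quotient_energy_ge0 BS).
  rewrite mul1r (_ : (2 * r) ^+ (2 * n) / (c * r ^+ n) * H z y =
    (c * r ^+ n)^-1 * ((2 * r) ^+ (2 * n) * H z y)); last by ring.
  have Hzy : phi (`|u y - u z| / al) <= (2 * r) ^+ (2 * n) * H z y.
    rewrite distrC; apply: (phi_le_quotient_energy BS Yphi) => //.
    by have := D_tri BS x0 z y; rewrite (D_sym BS z x0); have := Sr Sz; have := Sr Sy; lra.
  apply: ler_pM => //; first exact: (phi_ge0 Yphi).
  by rewrite lef_pV2// posrE mulr_gt0// exprn_gt0.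
rewrite muleA -EFinM lee_wpmul2r// lee_fin le_eqVlt; apply/orP; left; apply/eqP.
have -> : (16 = 4 * 2 * 2 :> R) by ring.
rewrite mulnC exprM !exprMn expr2; field.
by rewrite !gt_eqF// exprn_gt0.
Qed.

(** The new function is constant on the exterior, so only pairs within S and the two symmetric
    families of cross pairs carry energy. *)
Lemma add_mean_energy : (energy mu D n (S `|` exterior) phi (add_mean u) al <=
  (1 + 4 * 16 ^+ n / c)%:E * energy mu D n S phi u al)%E.
Proof.
pose m := mean_value u.
pose G z y : R := (z \in S)%:R *
  ((y \in exterior)%:R * (phi (`|u z - m| / al) / D z y ^+ (2 * n))).
have G0 z y : (0 <= (G z y)%:E)%E.
  by rewrite lee_fin !mulr_ge0 ?(phi_ge0 Yphi)// invr_ge0 exprn_ge0// (D_ge0 BS).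
have mG : measurable_fun setT (fun p : X * X => G p.1 p.2) by rewrite /G; mf.
have k0 : 0 <= 2 * 16 ^+ n / c by rewrite divr_ge0 ?(ltW c0)// mulr_ge0// exprn_ge0.
have GE : (\int[mu]_z \int[mu]_y (G z y)%:E <= (2 * 16 ^+ n / c)%:E * energy mu D n S phi u al)%E.
  rewrite /energy -integralMl//; last by mf.
  apply: ge0_le_int => z _; first exact: integral_ge0.
  rewrite /G; case: (boolP (z \in S)) => [/set_mem Sz|_]; last first.
    by rewrite integral0_eq ?mule_ge0// => y _; rewrite mul0r.
  by under eq_integral do rewrite mul1r; exact: cross.
have GE' : (\int[mu]_z \int[mu]_y (G y z)%:E <= (2 * 16 ^+ n / c)%:E * energy mu D n S phi u al)%E.
  by rewrite tonelli//; mf.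
have I1 z : (0 <= \int[mu]_y (G z y)%:E)%E by apply: integral_ge0.
have I2 z : (0 <= \int[mu]_y (G y z)%:E)%E by apply: integral_ge0.
apply: (@le_trans _ _ (\int[mu]_z (\int[mu]_y (H z y)%:E +
    (\int[mu]_y (G z y)%:E + \int[mu]_y (G y z)%:E)))%E).
  apply: ge0_le_int => z _.
    by apply: integral_ge0 => y _; rewrite lee_fin (quotient_energy_ge0 BS).
  rewrite -!integralDT//; first last.
  - by mf.
  - by mf.
  - by mf.
  - by mf.
  - by move=> y; rewrite adde_ge0.
  apply: ge0_le_int => y _; first by rewrite lee_fin (quotient_energy_ge0 BS).
  have h := H0 z y; have g := G0 z y; have g' := G0 y z; move: h g g'.
  rewrite -!EFinD !lee_fin => h g g'.
  rewrite {1}/quotient_energy /add_mean !in_setU.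
  have [zS|zS] := boolP (z \in S); have [yS|yS] := boolP (y \in S) => /=.
  - apply: (@le_trans _ _ (H z y)); first by rewrite /quotient_energy zS yS.
    by rewrite lerDl addr_ge0.
  - have [ye|ye] := boolP (y \in exterior) => /=; last by rewrite mul0r !addr_ge0.
    rewrite mul1r; apply: (@le_trans _ _ (G z y)); first by rewrite /G zS ye !mul1r.
    by rewrite addrCA lerDl addr_ge0.
  - have [ze|ze] := boolP (z \in exterior) => /=; last by rewrite mul0r !addr_ge0.
    rewrite mul1r; apply: (@le_trans _ _ (G y z)).
      by rewrite /G yS ze !mul1r distrC (D_sym BS).
    by rewrite addrA lerDr addr_ge0.
  - by rewrite subrr normr0 mul0r (phi_npos Yphi (lexx 0)) mul0r mulr0 !addr_ge0.
rewrite integralDT; first last.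
- by mf.
- by mf.
- by move=> z; rewrite adde_ge0.
- by [].
rewrite [X in (_ + X <= _)%E]integralDT//; [|by mf|by mf].
have En0 : (0 <= energy mu D n S phi u al)%E by apply: integral_ge0.
have -> : 1 + 4 * 16 ^+ n / c = 1 + (2 * 16 ^+ n / c + 2 * 16 ^+ n / c).
  by field; rewrite gt_eqF.
rewrite EFinD ge0_muleDl ?lee_fin ?addr_ge0// mul1e leeD//.
rewrite EFinD ge0_muleDl; [exact: (leeD GE GE')|by rewrite lee_fin|by rewrite lee_fin].
Qed.

End Function.
End AddExterior.

(** * From the modular in the Euclidean norm to the energy in the sup norm *)

Definition nonneg_ext (R : realType) (phi : R -> R) (t : R) : R := phi (Num.max 0 t).

Lemma nonneg_extE (R : realType) (phi : R -> R) t : 0 <= t -> nonneg_ext phi t = phi t.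
Proof. by move=> t0; rewrite /nonneg_ext max_r. Qed.

Lemma young_nonneg_ext (R : realType) (phi : R -> R) :
  young_function phi -> young_on_R (nonneg_ext phi).
Proof.
move=> [cvx ge0 phi0 pos _].
have cvx' (a b t : R) : 0 <= a -> 0 <= b -> 0 <= t -> t <= 1 ->
    phi (t * a + (1 - t) * b) <= t * phi a + (1 - t) * phi b.
  move=> a0 b0 t0 t1; have := cvx (Itv01 t0 t1) a b.
  by rewrite !inE /= !convRE /=; apply.
split.
- by move=> t t0; rewrite /nonneg_ext max_l.
- move=> a b ab; rewrite /nonneg_ext.
  have : 0 <= Num.max 0 a by rewrite le_max lexx.
  have : Num.max 0 a <= Num.max 0 b by rewrite ge_max !le_max lexx ab orbT.
  move: (Num.max 0 a) (Num.max 0 b) => {ab}a {}b ab a0.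
  have b0 : 0 <= b by apply: le_trans ab.
  move: b0; rewrite le_eqVlt => /orP[/eqP b0|b0].
    by rewrite (_ : a = b)//; apply/eqP; rewrite eq_le ab -b0.
  have q0 : 0 <= a / b by rewrite divr_ge0// ltW.
  have q1 : a / b <= 1 by rewrite ler_pdivrMr// mul1r.
  have := cvx' b 0 (a / b) (ltW b0) (lexx _) q0 q1.
  rewrite phi0 !mulr0 !addr0 divfK ?gt_eqF// => h; apply: le_trans h _.
  by rewrite -[leRHS]mul1r; apply: ler_wpM2r => //; apply: ge0; exact: ltW.
- by move=> t t0; rewrite nonneg_extE ?(ltW t0)// pos.
- move=> a b t a0 b0 t0 t1; rewrite !nonneg_extE//; first exact: cvx'.
  by rewrite addr_ge0// mulr_ge0// subr_ge0.
Qed.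

Lemma growth_nonneg_ext (R : realType) (n : nat) (phi : R -> R) :
  young_function phi -> (growth_constant n phi < +oo)%E ->
  exists Cg : R, forall t, 0 < t ->
  (\int[lebesgue_measure]_(s in `]0%R, t[) (nonneg_ext phi s / s ^+ n / s)%:E <=
  (Cg * nonneg_ext phi t / t ^+ n)%:E)%E.
Proof.
move=> [_ ge0 _ pos _] fin; exists (fine (growth_constant n phi)) => t t0.
rewrite (nonneg_extE _ (ltW t0)).
have -> : (\int[lebesgue_measure]_(s in `]0%R, t[) (nonneg_ext phi s / s ^+ n / s)%:E =
   \int[lebesgue_measure]_(s in `]0%R, t[) (phi s / s ^+ n / s)%:E)%E.
  apply: eq_integral => s; rewrite inE /= in_itv/= => /andP[s0 _].
  by rewrite nonneg_extE ?(ltW s0).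
set I := (\int[_]_(s in _) _)%E.
have I0 : (0 <= I)%E.
  apply: integral_ge0 => s /=; rewrite in_itv/= => /andP[s0 _].
  by rewrite lee_fin !divr_ge0 ?ge0 ?exprn_ge0 ?(ltW s0).
have k0 : 0 < t ^+ n / phi t by rewrite divr_gt0 ?exprn_gt0 ?pos.
have hI : ((t ^+ n / phi t)%:E * I <= growth_constant n phi)%E.
  by apply: ereal_sup_ubound; exists t.
have gfin : growth_constant n phi \is a fin_num.
  by rewrite ge0_fin_numE//; apply: le_trans hI; rewrite mule_ge0// lee_fin ltW.
rewrite -(fineK gfin) in hI.
have -> : (fine (growth_constant n phi) * phi t / t ^+ n =
    (t ^+ n / phi t)^-1 * fine (growth_constant n phi)).
  by rewrite invf_div mulrC mulrA [X in X = _]mulrC mulrA.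
by rewrite EFinM lee_pdivlMl.
Qed.

Section EuclideanNorm.
Context (R : realType) (n : nat).
Implicit Types v x y : 'rV[R]_n.

Lemma norm_le_eucl v : `|v| <= eucl_norm v.
Proof.
have e0 : 0 <= eucl_norm v by exact: sqrtr_ge0.
rewrite leNgt; apply/negP => h.
have nv0 : 0 < `|v| by exact: le_lt_trans e0 h.
move: h; rewrite ltNge => /negP; apply; rewrite leNgt; apply/negP => h.
suff : `|v| < `|v| by rewrite ltxx.
apply/(rV_norm_lt _ nv0) => i; apply: le_lt_trans h.
rewrite -sqrtr_sqr ler_sqrt; last by apply: sumr_ge0 => j _; exact: sqr_ge0.
by rewrite (bigD1 i)//= lerDl sumr_ge0// => j _; exact: sqr_ge0.
Qed.

Lemma eucl_sqr v : eucl_norm v ^+ 2 <= n%:R * `|v| ^+ 2.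
Proof.
rewrite sqr_sqrtr; last by apply: sumr_ge0 => i _; exact: sqr_ge0.
apply: (@le_trans _ _ (\sum_(i < n) `|v| ^+ 2)); last first.
  by rewrite sumr_const card_ord mulr_natl.
apply: ler_sum => i _; rewrite -real_normK ?num_real// lerXn2r ?nnegrE//.
rewrite leNgt; apply/negP => h.
have v0 : 0 < `|v ord0 i| by apply: le_lt_trans h.
by have := (rV_norm_lt _ v0 h) i; rewrite ltxx.
Qed.

Lemma eucl_expr_ge v : `|v| ^+ (2 * n) <= eucl_norm v ^+ (2 * n).
Proof. by rewrite lerXn2r ?nnegrE ?sqrtr_ge0// norm_le_eucl. Qed.

Lemma eucl_expr_le v : eucl_norm v ^+ (2 * n) <= n%:R ^+ n * `|v| ^+ (2 * n).
Proof.
rewrite !exprM -exprMn lerXn2r ?nnegrE ?eucl_sqr ?sqr_ge0// mulr_ge0 ?sqr_ge0.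
Qed.

End EuclideanNorm.

Section ModularEnergy.
Context (R : realType) (n : nat) (phi : R -> R).
Hypothesis n0 : (0 < n)%N.
Hypothesis Yphi : young_function phi.
Local Notation E := (Rn R n).
Local Notation psi := (nonneg_ext phi).
Local Notation energy := (energy (@lebesgueRn R n) (@supdist R n) n).
Let Ypsi := young_nonneg_ext Yphi.

(** Since eucl_norm^(2 n) <= n^n supdist^(2 n), the change of norm costs n^n, which convexity
    absorbs by enlarging [al]. The zero extension of [u] gives a function on the whole space. *)
Lemma energy_le_modular (S : set E) (u : E -> R) (al : R) : 0 < al ->
  (modular phi S u al <= 1)%E -> (energy S psi (u \_ S) (n%:R ^+ n * al) <= 1)%E.
Proof.
move=> al0; apply: le_trans; rewrite /modular.
have k0 : 0 < (n%:R : R) ^+ n by rewrite exprn_gt0// ltr0n.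
rewrite [X in (_ <= X)%E]integral_mkind; apply: ge0_le_int => x _.
  by apply: integral_ge0 => y _; rewrite lee_fin (quotient_energy_ge0 (Rn_ball_space R n)).
have [xS|xS] := boolP (x \in S); last first.
  by rewrite integral0_eq ?mul0e// => y _; rewrite /quotient_energy (negbTE xS) mul0r.
rewrite mul1e [X in (_ <= X)%E]integral_mkind; apply: ge0_le_int => y _.
  by rewrite lee_fin (quotient_energy_ge0 (Rn_ball_space R n)).
rewrite /quotient_energy xS /=; have [yS|yS] := boolP (y \in S); last by rewrite mul0r mul0e.
rewrite mul1r mul1e lee_fin /patch xS yS.
have t0 : 0 <= `|u x - u y| / al by rewrite divr_ge0// ltW.
rewrite -(nonneg_extE _ t0).
have h1 : psi (`|u x - u y| / (n%:R ^+ n * al)) <= (n%:R ^+ n)^-1 * psi (`|u x - u y| / al).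
  rewrite invfM mulrCA; apply: (phi_scale Ypsi).
  - by rewrite invr_ge0 ltW.
  - by rewrite invf_le1// exprn_ege1// ler1n.
  - exact: t0.
apply: (@le_trans _ _ ((n%:R ^+ n)^-1 * psi (`|u x - u y| / al) / supdist x y ^+ (2 * n))).
  by apply: ler_wpM2r => //; rewrite invr_ge0 exprn_ge0//; exact: normr_ge0.
rewrite mulrAC mulrC; apply: ler_wpM2l; first exact: (phi_ge0 Ypsi).
have := normr_ge0 ((x : 'rV[R]_n) - y); rewrite -/(supdist x y) le_eqVlt => /orP[/eqP<-|xy].
  (* On the diagonal the left-hand side vanishes: n > 0 makes the power 0, and its inverse is 0 by
     convention. *)
  rewrite [X in _ * X^-1]expr0n muln_eq0 /= (gtn_eqF n0) invr0 mulr0 invr_ge0 exprn_ge0//.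
  exact: sqrtr_ge0.
rewrite -invfM lef_pV2 ?posrE ?mulr_gt0 ?exprn_gt0 ?ltr0n//; first exact: eucl_expr_le.
by apply: lt_le_trans xy _; exact: norm_le_eucl.
Qed.

Lemma modular_le_energy (S : set E) (v : E -> R) (al : R) : 0 < al ->
  (modular phi S v al <=
   \int[@lebesgueRn R n]_(x in S) \int[@lebesgueRn R n]_(y in S)
      (psi (`|v x - v y| / al) / supdist x y ^+ (2 * n))%:E)%E.
Proof.
move=> al0; have [_ ge0 _ _ _] := Yphi.
have t0 x y : 0 <= `|v x - v y| / al by rewrite divr_ge0// ltW.
apply: ge0_le_int => x _.
  by apply: integral_ge0 => y _; rewrite lee_fin divr_ge0 ?ge0// exprn_ge0// sqrtr_ge0.
apply: ge0_le_int => y _; first by rewrite lee_fin divr_ge0 ?ge0// exprn_ge0// sqrtr_ge0.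
rewrite lee_fin nonneg_extE//.
have := normr_ge0 ((x : 'rV[R]_n) - y); rewrite le_eqVlt => /orP[/eqP/esym/eqP|xy].
  rewrite normr_eq0 subr_eq0 => /eqP ->; rewrite subrr normr0 mul0r.
  by rewrite -(nonneg_extE _ (lexx 0)) (phi_npos Ypsi (lexx 0)) !mul0r.
apply: ler_wpM2l; first exact: ge0.
rewrite lef_pV2 ?posrE ?exprn_gt0//; last first.
  by apply: lt_le_trans xy _; exact: norm_le_eucl.
exact: eucl_expr_ge.
Qed.

Lemma besov_modular (S : set E) (u : E -> R) : (besov_seminorm phi S u < +oo)%E ->
  exists2 al, 0 < al & (modular phi S u al <= 1)%E.
Proof. by move=> /ereal_inf_lt[_ [al [al0 hal] <-] _]; exists al. Qed.

Lemma seminorm_le (S : set E) (u : E -> R) (al : R) : 0 < al ->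
  (modular phi S u al <= 1)%E -> (besov_seminorm phi S u <= al%:E)%E.
Proof. by move=> al0 h; apply: ereal_inf_lbound; exists al. Qed.

End ModularEnergy.

Section ExtensionDomain.
Context (R : realType) (n : nat) (phi : R -> R).
Hypothesis n0 : (0 < n)%N.
Hypothesis Yphi : young_function phi.
Local Notation E := (Rn R n).
Local Notation psi := (nonneg_ext phi).
Local Notation energy := (energy (@lebesgueRn R n) (@supdist R n) n).

(** Composing T with extension by zero makes the operator depend on the restriction to Omega only.
    Linearity is needed just for functions of finite energy, where the integrals defining T
    converge. *)
Lemma extension_domain_of_operator (Omega : set E) (T : (E -> R) -> E -> R) (C : R) :
  measurable Omega -> 0 < C ->
  (forall u al, measurable_fun setT u -> 0 < al -> (energy Omega psi u al <= 1)%E ->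
    measurable_fun setT (T u) /\
    (\int[@lebesgueRn R n]_x \int[@lebesgueRn R n]_y
      (psi (`|T u x - T u y| / (C * al)) / supdist x y ^+ (2 * n))%:E <= 1)%E) ->
  (forall u v a b1 b2, measurable_fun setT u -> measurable_fun setT v -> 0 < b1 -> 0 < b2 ->
     (energy Omega psi u b1 <= 1)%E -> (energy Omega psi v b2 <= 1)%E ->
     T (fun x => a * u x + v x) = (fun x => a * T u x + T v x)) ->
  (forall u, {in Omega, T u =1 u}) ->
  extension_domain phi Omega.
Proof.
move=> mO C0 Tbd Tlin Tin.
have k0 : 0 < (n%:R : R) ^+ n by rewrite exprn_gt0// ltr0n.
have main u al : measurable_fun Omega u -> 0 < al -> (modular phi Omega u al <= 1)%E ->
    measurable_fun [set: E] (T (u \_ Omega)) /\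
    (modular phi [set: E] (T (u \_ Omega)) (C * n%:R ^+ n * al) <= 1)%E.
  move=> mu_ al0 hm.
  have mu' : measurable_fun [set: E] (u \_ Omega) by apply/(measurable_restrictT _ mO).
  have al1 : 0 < n%:R ^+ n * al by exact: mulr_gt0.
  have [mT hT] := Tbd _ _ mu' al1 (energy_le_modular n0 Yphi al0 hm).
  split; first exact: mT.
  rewrite -(mulrA C); have Cal : 0 < C * (n%:R ^+ n * al) by exact: mulr_gt0.
  exact: (le_trans (modular_le_energy Yphi setT _ Cal) hT).
exists (fun u => T (u \_ Omega)); split.
- move=> u v uv; congr T; apply/funext => x; rewrite /patch.
  by case: ifPn => // xO; exact: uv.
- move=> u [mu_ /besov_modular[al al0 hal]]; have [mT hT] := main u al mu_ al0 hal; split; first exact: mT.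
  have Cal : 0 < C * n%:R ^+ n * al by rewrite !mulr_gt0.
  exact: (le_lt_trans (seminorm_le Cal hT) (ltry _)).
- move=> a u v [mu_ /besov_modular[al al0 hal]] [mv /besov_modular[be be0 hbe]].
  have -> : (fun x => a * u x + v x) \_ Omega = (fun x => a * (u \_ Omega) x + (v \_ Omega) x).
    by apply/funext => x; rewrite /patch; case: ifP => // _; rewrite /point/= mulr0 addr0.
  have al1 : 0 < n%:R ^+ n * al by exact: mulr_gt0.
  have be1 : 0 < n%:R ^+ n * be by exact: mulr_gt0.
  have mu' : measurable_fun [set: E] (u \_ Omega) by apply/(measurable_restrictT _ mO).
  have mv' : measurable_fun [set: E] (v \_ Omega) by apply/(measurable_restrictT _ mO).
  exact: (Tlin _ _ a _ _ mu' mv' al1 be1 (energy_le_modular n0 Yphi al0 hal)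
    (energy_le_modular n0 Yphi be0 hbe)).
- have Ck : 0 < C * n%:R ^+ n by exact: mulr_gt0.
  exists (C * n%:R ^+ n) => // u [mu_ _].
  rewrite -lee_pdivrMl//; apply: le_ereal_inf_tmp => _ [al [al0 hal] <-].
  rewrite lee_pdivrMl// -EFinM; apply: seminorm_le; first exact: mulr_gt0.
  by have [_] := main u al mu_ al0 hal.
- move=> u _ x xO; rewrite Tin// /patch; by rewrite xO.
Qed.

End ExtensionDomain.

Lemma energy_scale d (R : realType) (X : measurableType d)
  (mu : {sigma_finite_measure set X -> \bar R}) (D : X -> X -> R) (n : nat)
  (phi : R -> R) (S : set X) (u : X -> R) (al K : R) :
  ball_space mu D n -> young_on_R phi -> measurable S ->
  measurable_fun setT u -> 0 < al -> 1 <= K ->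
  (energy mu D n S phi u (K * al) <= K^-1%:E * energy mu D n S phi u al)%E.
Proof.
move=> BS Yphi mS mu_ al0 K1; have K0 : 0 < K by apply: lt_le_trans K1.
have Ki0 : 0 <= K^-1 by rewrite invr_ge0 ltW.
have mH := measurable_quotient_energy BS mS Yphi al mu_.
have H0 z w : (0 <= (quotient_energy D n S phi u al z w)%:E)%E.
  by rewrite lee_fin (quotient_energy_ge0 BS).
have H1 z w : (0 <= (quotient_energy D n S phi u (K * al) z w)%:E)%E.
  by rewrite lee_fin (quotient_energy_ge0 BS).
rewrite /energy -integralMl; first last.
- by mf.
- by move=> z; apply: integral_ge0 => w _; exact: H0.
- exact: Ki0.
apply: ge0_le_int => z _; first by apply: integral_ge0 => w _; exact: H1.
rewrite -integralMl; first last.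
- by mf.
- exact: H0.
- exact: Ki0.
apply: ge0_le_int => w _; first exact: H1.
rewrite -EFinM lee_fin /quotient_energy [leRHS]mulrCA; apply: ler_wpM2l => //.
rewrite [leRHS]mulrA; apply: ler_wpM2r; first by rewrite invr_ge0 exprn_ge0// (D_ge0 BS).
rewrite invfM [X in phi X]mulrCA; apply: (phi_scale Yphi); first exact: Ki0.
  by rewrite invf_le1.
by rewrite divr_ge0// ltW.
Qed.

Lemma Rintegral_weight_linear d (R : realType) (X : measurableType d)
  (mu : {measure set X -> \bar R}) (w u v : X -> R) (a : R) :
  mu.-integrable setT (EFin \o (fun z => w z * u z)) ->
  mu.-integrable setT (EFin \o (fun z => w z * v z)) ->
  \int[mu]_z (w z * (a * u z + v z)) =
  a * (\int[mu]_z (w z * u z)) + \int[mu]_z (w z * v z).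
Proof.
move=> iu iv; have iau : mu.-integrable setT (EFin \o (fun z => a * (w z * u z))).
  have := integrableZl measurableT a iu.
  by apply: eq_integrable => // z _ /=; rewrite EFinM.
rewrite -RintegralZl// -RintegralD//; apply: eq_Rintegral => z _.
by rewrite mulrDr mulrCA.
Qed.

Lemma regular_ext_linear d (R : realType) (X : measurableType d)
  (mu : {sigma_finite_measure set X -> \bar R}) (D : X -> X -> R) (n : nat)
  (phi : R -> R) (S : set X) (c : R) (u v : X -> R) (a b1 b2 : R) :
  ball_space mu D n -> young_on_R phi -> S !=set0 -> 0 < c -> metric_open D S ->
  inner_regular mu D n S c ->
  measurable_fun setT u -> measurable_fun setT v -> 0 < b1 -> 0 < b2 ->
  (energy mu D n S phi u b1 < +oo)%E -> (energy mu D n S phi v b2 < +oo)%E ->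
  regular_ext mu D n S c (fun x => a * u x + v x) =
  (fun x => a * regular_ext mu D n S c u x + regular_ext mu D n S c v x).
Proof.
move=> BS Yphi S0 c0 oS rS mu_ mv b10 b20 eu ev; apply/funext => x.
have RK := reflection_kernelP BS S0 c0 oS rS.
rewrite /regular_ext /ext; case: ifP => // _.
have iu := integrable_Pu BS RK Yphi mu_ b10 eu x.
by rewrite (Rintegral_weight_linear a iu (integrable_Pu BS RK Yphi mv b20 ev x)).
Qed.

Section AddMean.
Context d (X : measurableType d) (R : realType).
Context (mu : {sigma_finite_measure set X -> \bar R}) (D : X -> X -> R) (n : nat).
Hypothesis BS : ball_space mu D n.
Hypothesis n0 : (0 < n)%N.
Context (S : set X) (c : R) (x0 : X) (r : R).
Hypothesis c0 : 0 < c.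
Hypothesis r0 : 0 < r.
Hypothesis mS : measurable S.
Hypothesis muS : ((c * r ^+ n)%:E <= mu S)%E.
Hypothesis Sr : forall x, S x -> D x0 x <= r.
Context (phi : R -> R).
Hypothesis Yphi : young_on_R phi.

Lemma add_mean_linear (u v : X -> R) (a b1 b2 : R) :
  measurable_fun setT u -> measurable_fun setT v -> 0 < b1 -> 0 < b2 ->
  (energy mu D n S phi u b1 < +oo)%E -> (energy mu D n S phi v b2 < +oo)%E ->
  add_mean mu S (fun x => a * u x + v x) =
  (fun x => a * add_mean mu S u x + add_mean mu S v x).
Proof.
move=> mu_ mv b10 b20 eu ev; apply/funext => x; rewrite /add_mean; case: ifP => // _.
have iu := integrable_mean BS c0 r0 mS muS Sr Yphi mu_ b10 eu.
exact: (Rintegral_weight_linear a iu (integrable_mean BS c0 r0 mS muS Sr Yphi mv b20 ev)).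
Qed.

Lemma add_mean_bounded : exists2 K : R, 1 <= K & forall u al,
  measurable_fun setT u -> 0 < al -> (energy mu D n S phi u al <= 1)%E ->
  (energy mu D n (S `|` exterior D x0 r) phi (add_mean mu S u) al <= K%:E)%E /\
  (energy mu D n (S `|` exterior D x0 r) phi (add_mean mu S u) (K * al) <= 1)%E.
Proof.
have q0 : 0 <= 4 * 16 ^+ n / c by rewrite divr_ge0 ?(ltW c0)// mulr_ge0// exprn_ge0.
exists (1 + 4 * 16 ^+ n / c) => [|u al mu_ al0 e1]; first by rewrite lerDl.
set K := 1 + _; have K1 : 1 <= K by rewrite lerDl.
have K0 : 0 < K by apply: lt_le_trans K1.
have hK : (energy mu D n (S `|` exterior D x0 r) phi (add_mean mu S u) al <= K%:E)%E.
  apply: (le_trans (add_mean_energy BS n0 c0 r0 mS muS Sr Yphi mu_ al0 (le_lt_trans e1 (ltry 1)))).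
  by rewrite -[leRHS]mule1; apply: lee_wpmul2l; rewrite ?lee_fin// ltW.
split; first exact: hK.
apply: (le_trans (energy_scale BS Yphi _ (measurable_add_mean mu mS mu_) al0 K1)).
  by apply: measurableU => //; apply: measurable_boolset; have mD := D_meas BS; mf.
apply: (le_trans (lee_wpmul2l _ hK)); first by rewrite lee_fin invr_ge0 ltW.
by rewrite -EFinM mulVf// gt_eqF.
Qed.

End AddMean.

(** * Regular domains are extension domains *)

Section RegularDomain.
Context (R : realType) (n : nat) (phi : R -> R).
Hypothesis n0 : (0 < n)%N.
Hypothesis Yphi : young_function phi.
Hypothesis gfin : (growth_constant n phi < +oo)%E.
Local Notation E := (Rn R n).
Local Notation psi := (nonneg_ext phi).
Local Notation D := (@supdist R n).
Local Notation mu := (@lebesgueRn R n).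
Local Notation energy := (energy mu D n).
Let Ypsi := young_nonneg_ext Yphi.
Let BS := Rn_ball_space R n.

Lemma le_lebesgueRn (A B : set E) : A `<=` B -> (mu A <= mu B)%E.
Proof. exact: (@le_mu_ext _ _ R (@borel_lebesgueRn R n) A B). Qed.

Lemma open_metric_open (A : set E) : open (A : set 'rV[R]_n) -> metric_open D A.
Proof.
move=> oA x Ax; have : nbhs (x : 'rV[R]_n) A by apply: open_nbhs_nbhs.
by move=> /nbhs_normP[e /= e0 he]; exists e => // y xy; exact: he.
Qed.

Lemma exterior_metric_open (x0 : E) (r : R) : metric_open D (exterior D x0 r).
Proof.
move=> x; rewrite /exterior /= => hx; exists (D x0 x - 2 * r); first by rewrite subr_gt0.
by move=> y; have := supdist_tri y x0 x; rewrite (supdist_sym y x); lra.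
Qed.

Lemma ahlfors_sup (Omega : set E) (c r : R) (x : E) :
  ((c * r ^+ n)%:E <= mu (eucl_ball x r `&` Omega))%E ->
  ((c * r ^+ n)%:E <= mu [set y | (D x y < r)%R /\ Omega y])%E.
Proof.
move=> h; apply: (le_trans h); apply: le_lebesgueRn => y [xy Oy]; split => //.
by apply: le_lt_trans xy; exact: norm_le_eucl.
Qed.

Lemma supdist_shift (x : E) (t : R) : 0 <= t ->
  exists p : E, D x p = t.
Proof.
move=> t0; exists ((x : 'rV[R]_n) + const_mx t); rewrite /supdist opprD addrA subrr add0r normrN.
apply/eqP; rewrite eq_le; apply/andP; split.
  rewrite leNgt; apply/negP => h.
  move: t0; rewrite le_eqVlt => /orP[/eqP t0|t0].
    by move: h; rewrite -t0 (_ : const_mx 0 = 0) ?normr0 ?ltxx//; apply/matrixP => i j; rewrite !mxE.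
  have : `|const_mx t : 'rV[R]_n| < `|const_mx t : 'rV[R]_n|.
    by apply/(rV_norm_lt _ (lt_trans t0 h)) => i; rewrite mxE ger0_norm// ltW.
  by rewrite ltxx.
rewrite leNgt; apply/negP => h.
have t1 : 0 < t by apply: le_lt_trans h.
by have := (rV_norm_lt _ t1 h) (Ordinal n0); rewrite mxE ger0_norm ?ltxx// ltW.
Qed.

(* Moving outwards from x along a coordinate realizing the sup norm of x - x0. *)
Lemma outward_ball (x0 x : E) (r : R) : 0 < r -> exists p : E, forall y,
  D p y < r / 2 -> D x y < r /\ D x0 x <= D x0 y.
Proof.
move=> r0.
have [i hi] : exists i : 'I_n, D x0 x = `|(x0 : 'rV[R]_n) ord0 i - (x : 'rV[R]_n) ord0 i|.
  have [x00|/mx_norm_neq0[[a i] /= h]] := eqVneq (D x0 x) 0; last first.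
    by exists i; rewrite [LHS]h !mxE (ord1 a).
  exists (Ordinal n0); rewrite x00; move/eqP: x00.
  by rewrite normr_eq0 subr_eq0 => /eqP ->; rewrite subrr normr0.
pose sg : R := if (x0 : 'rV[R]_n) ord0 i <= (x : 'rV[R]_n) ord0 i then 1 else -1.
pose p : 'rV[R]_n := (x : 'rV[R]_n) + \row_j (if j == i then sg * (r / 2) else 0).
have r2 : 0 < r / 2 by lra.
have xp : D x p <= r / 2.
  rewrite leNgt; apply/negP => h.
  have : D x p < D x p.
    apply/(rV_norm_lt _ (lt_trans r2 h)) => j; apply: le_lt_trans h.
    rewrite !mxE opprD addrA subrr add0r normrN; case: eqP => _; last by rewrite normr0 ltW.
    by rewrite /sg; case: ifP => _; rewrite ?mul1r ?mulN1r ?normrN ger0_norm// ltW.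
  by rewrite ltxx.
exists p => y py; split.
  by have := supdist_tri p x y; lra.
have /(_ i) := rV_norm_lt _ r2 py; rewrite !mxE eqxx ltr_norml => /andP[h1 h2].
have : `|(x0 : 'rV[R]_n) ord0 i - (y : 'rV[R]_n) ord0 i| <= D x0 y.
  rewrite leNgt; apply/negP => h.
  have h0 : 0 < `|(x0 : 'rV[R]_n) ord0 i - (y : 'rV[R]_n) ord0 i|.
    by apply: le_lt_trans h; exact: normr_ge0.
  by have /(_ i) := rV_norm_lt _ h0 h; rewrite !mxE ltxx.
apply: le_trans; rewrite hi; move: h1 h2; rewrite /sg.
case: ifP => [h|/negbT]; rewrite -?ltNge ?mul1r ?mulN1r => h1 h2; last move=> h3.
  by rewrite ler0_norm ?subr_le0// ler0_norm ?subr_le0//; lra.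
by rewrite gtr0_norm ?subr_gt0// gtr0_norm ?subr_gt0//; lra.
Qed.

(** At x in S, radii below 2 Dm use the hypothesis and radii up to 16 Dm use it at radius Dm. For
    larger r, a ball of radius r / 4 centred at distance r / 2 from x0 lies in the ball at x and
    beyond 2 Dm from x0. At an exterior point, [outward_ball] provides a ball of radius r / 2. *)
Lemma with_exterior_regular (S : set E) (c Dm : R) (x0 : E) :
  0 < c -> 0 < Dm -> (forall x, S x -> D x0 x <= Dm) ->
  (forall x r, S x -> 0 < r -> r < 2 * Dm ->
    ((c * r ^+ n)%:E <= mu [set y | (D x y < r)%R /\ S y])%E) ->
  inner_regular mu D n (S `|` exterior D x0 Dm) (Num.min (c / 16 ^+ n) (2 ^+ n)^-1).
Proof.
move=> c0 Dm0 SD rS x r [Sx|ex] r0.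
  have [rD|rD] := leP r (16 * Dm).
    have [rD2|rD2] := ltP r (2 * Dm).
      apply: (@le_trans _ _ (c * r ^+ n)%:E).
        rewrite lee_fin ler_pM2r ?exprn_gt0//; apply: (@le_trans _ _ (c / 16 ^+ n)).
          by rewrite ge_min lexx.
        by rewrite ler_pdivrMr ?exprn_gt0// ler_peMr ?(ltW c0)// exprn_ege1// ler1n.
      apply: (le_trans (rS x r Sx r0 rD2)); apply: le_lebesgueRn => y [xy Sy].
      by split=> //; left.
    have Dm2 : Dm < 2 * Dm by lra.
    apply: (@le_trans _ _ (c * Dm ^+ n)%:E).
      rewrite lee_fin; apply: (@le_trans _ _ (c / 16 ^+ n * r ^+ n)).
        by rewrite ler_pM2r ?exprn_gt0// ge_min lexx.
      rewrite -mulrA ler_pM2l// mulrC -expr_div_n lerXn2r ?nnegrE ?divr_ge0 ?(ltW r0) ?(ltW Dm0)//.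
      by rewrite ler_pdivrMr// mulrC.
    apply: (le_trans (rS x Dm Sx Dm0 Dm2)); apply: le_lebesgueRn => y [xy Sy].
    by split; [lra|left].
  have [p x0p] := supdist_shift x0 (divr_ge0 (ltW r0) (ler0n R 2)).
  have r4 : 0 < r / 4 by lra.
  apply: (@le_trans _ _ (mu [set y | (D p y < r / 4)%R])).
    rewrite lebesgueRn_supball// lee_fin (_ : 2 * (r / 4) = 2^-1 * r); last by field.
    by rewrite exprMn exprVn ler_pM2r ?exprn_gt0// ge_min lexx orbT.
  apply: le_lebesgueRn => y /= py; have := SD x Sx.
  have := supdist_tri p x0 y; have := supdist_tri x0 x y; have := supdist_tri y x0 p.
  rewrite (supdist_sym x x0) (supdist_sym y p) x0p => h1 h2 h3 h4; split; first lra.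
  by right; rewrite /exterior /=; lra.
have [p hp] := outward_ball x0 x r0; have r2 : 0 < r / 2 by lra.
apply: (@le_trans _ _ (mu [set y | (D p y < r / 2)%R])).
  rewrite lebesgueRn_supball// lee_fin (_ : 2 * (r / 2) = r); last by field.
  rewrite -[leRHS]mul1r ler_pM2r ?exprn_gt0//; apply: (@le_trans _ _ (2 ^+ n)^-1).
    by rewrite ge_min lexx orbT.
  by rewrite invf_le1 ?exprn_gt0// exprn_ege1// ler1n.
apply: le_lebesgueRn => y /hp[xy x0y]; split=> //; right.
by move: ex; rewrite /exterior /= => /lt_le_trans; apply.
Qed.

Theorem regular_extension_domain (Omega : set E) :
  domain (Omega : set 'rV[R]_n) -> ahlfors_regular Omega -> extension_domain phi Omega.
Proof.
move=> [oO _ O0] [c c0 rO].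
have moO := open_metric_open oO.
have mO := measurable_supdist_open moO.
have [Cg growth] := growth_nonneg_ext Yphi gfin.
have [Dfin|Dinf] := ltP (diam (Omega : set 'rV[R]_n)) +oo%E; last first.
  have rS : inner_regular mu D n Omega c.
    move=> x r Ox r0; apply: ahlfors_sup; apply: rO => //.
    by rewrite (@leye_eq _ _) in Dinf; rewrite (eqP Dinf) gt0_muley ?lte_fin// ltry.
  have RK := reflection_kernelP BS O0 c0 moO rS.
  have [C C0 bd] := regular_ext_bounded BS O0 c0 moO rS Ypsi growth.
  apply: (extension_domain_of_operator n0 Yphi mO C0 (T := regular_ext mu D n Omega c)).
  - move=> u al mu_ al0 e1; split; last exact: bd.
    exact: (measurable_ext RK mu_).
  - move=> u v a b1 b2 mu_ mv b10 b20 eu ev.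
    exact: (regular_ext_linear a BS Ypsi O0 c0 moO rS mu_ mv b10 b20
      (le_lt_trans eu (ltry 1)) (le_lt_trans ev (ltry 1))).
  - by move=> u x xO; rewrite /regular_ext /ext xO.
have [x0 Ox0] := O0.
have Dle x y : Omega x -> Omega y -> ((eucl_norm ((x : 'rV[R]_n) - y))%:E <= diam (Omega : set 'rV[R]_n))%E.
  by move=> Ox Oy; apply: ereal_sup_ubound; exists (x, y).
set Dm := fine (diam (Omega : set 'rV[R]_n)).
have Dm_fin : diam (Omega : set 'rV[R]_n) \is a fin_num.
  rewrite ge0_fin_numE//; apply: le_trans (Dle _ _ Ox0 Ox0).
  by rewrite lee_fin sqrtr_ge0.
have DmE : diam (Omega : set 'rV[R]_n) = Dm%:E by rewrite /Dm fineK.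
have SD x : Omega x -> D x0 x <= Dm.
  move=> Ox; apply: le_trans (norm_le_eucl _) _.
  by have := Dle _ _ Ox0 Ox; rewrite DmE lee_fin.
have Dm0 : 0 < Dm.
  have [e e0 he] := moO _ Ox0.
  have [p x0p] := supdist_shift x0 (divr_ge0 (ltW e0) (ler0n R 2)).
  apply: (@lt_le_trans _ _ (D x0 p)); first by rewrite x0p; lra.
  by apply: SD; apply: he; rewrite x0p; lra.
have rS1 x r : Omega x -> 0 < r -> r < 2 * Dm ->
    ((c * r ^+ n)%:E <= mu [set y | (D x y < r)%R /\ Omega y])%E.
  move=> Ox r0 rD; apply: ahlfors_sup; apply: rO => //.
  by rewrite DmE -EFinM lte_fin.
set S := Omega `|` exterior D x0 Dm.
set c' := Num.min (c / 16 ^+ n) (2 ^+ n)^-1.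
have rS : inner_regular mu D n S c' by exact: with_exterior_regular.
have c'0 : 0 < c' by rewrite lt_min divr_gt0 ?exprn_gt0// invr_gt0 exprn_gt0.
have S0 : S !=set0 by exists x0; left.
have moS : metric_open D S.
  move=> x [Ox|ex].
    by have [e e0 he] := moO _ Ox; exists e => // y /he; left.
  by have [e e0 he] := exterior_metric_open ex; exists e => // y /he; right.
have muO : ((c * Dm ^+ n)%:E <= mu Omega)%E.
  have Dm2 : Dm < 2 * Dm by lra.
  by apply: (le_trans (rS1 x0 Dm Ox0 Dm0 Dm2)); apply: le_lebesgueRn => y [].
have RK := reflection_kernelP BS S0 c'0 moS rS.
have [C C0 bd] := regular_ext_bounded BS S0 c'0 moS rS Ypsi growth.
have [K K1 mean_fin] := add_mean_bounded BS n0 c0 Dm0 mO muO SD Ypsi.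
have K0 : 0 < K by apply: lt_le_trans K1.
have CK0 := mulr_gt0 C0 K0.
apply: (extension_domain_of_operator n0 Yphi mO CK0
  (T := fun u => regular_ext mu D n S c' (add_mean mu Omega u))).
- move=> u al mu_ al0 e1; have ma := measurable_add_mean mu mO mu_.
  have [_ h] := mean_fin u al mu_ al0 e1.
  split; first exact: (measurable_ext RK ma).
  by rewrite -mulrA; exact: (bd _ _ ma (mulr_gt0 K0 al0) h).
- move=> u v a b1 b2 mu_ mv b10 b20 eu ev.
  have [hu _] := mean_fin u b1 mu_ b10 eu.
  have [hv _] := mean_fin v b2 mv b20 ev.
  have muadd := measurable_add_mean mu mO mu_; have mvadd := measurable_add_mean mu mO mv.
  rewrite (add_mean_linear BS c0 Dm0 mO muO SD Ypsi a mu_ mv b10 b20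
    (le_lt_trans eu (ltry 1)) (le_lt_trans ev (ltry 1))).
  exact: (regular_ext_linear a BS Ypsi S0 c'0 moS rS muadd mvadd b10 b20
    (le_lt_trans hu (ltry K)) (le_lt_trans hv (ltry K))).
- move=> u x xO; rewrite /regular_ext /ext /add_mean xO.
  by rewrite in_setU xO.
Qed.

End RegularDomain.

(** * Oscillation and cutoff functions *)

Section Oscillation.
Context d (X : measurableType d) (R : realType).
Context (mu : {sigma_finite_measure set X -> \bar R}) (D : X -> X -> R) (n : nat).
Hypothesis BS : ball_space mu D n.
Hypothesis muX : (0 < mu setT)%E.
Context (phi : R -> R).
Hypothesis Yphi : young_on_R phi.
Context (v : X -> R) (be : R).
Hypothesis mv : measurable_fun setT v.
Hypothesis be0 : 0 < be.
Hypothesis e1 : (energy mu D n setT phi v be <= 1)%E.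
Let mD := D_meas BS.
Let mphi := measurable_phi Yphi.
Local Notation H := (quotient_energy D n setT phi v be).
Let fin : (energy mu D n setT phi v be < +oo)%E := le_lt_trans e1 (ltry 1).
Let H0 z w : (0 <= (H z w)%:E)%E.
Proof. by rewrite lee_fin (quotient_energy_ge0 BS). Qed.
Let mH : measurable_fun setT (fun p : X * X => H p.1 p.2).
Proof. exact: (measurable_quotient_energy BS measurableT Yphi be mv). Qed.
Let HI0 z : (0 <= \int[mu]_y (H z y)%:E)%E. Proof. by apply: integral_ge0. Qed.

Definition ball_weight (c : X) (r : R) (z : X) : R := (D c z < r)%R%:R / (2 * r) ^+ n.
Definition ball_avg (c : X) (r : R) : R := \int[mu]_z (ball_weight c r z * v z).

Section BallWeight.
Context (c : X) (r : R).
Hypothesis r0 : 0 < r.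
Let rn0 : 0 < (2 * r) ^+ n. Proof. by rewrite exprn_gt0// mulr_gt0. Qed.

Lemma measurable_ball_weight : measurable_fun setT (ball_weight c r).
Proof. by rewrite /ball_weight; mf. Qed.

Lemma ball_weight_ge0 z : 0 <= ball_weight c r z.
Proof. by rewrite divr_ge0// ltW. Qed.

Lemma integral_ball_weight : (\int[mu]_z (ball_weight c r z)%:E = 1)%E.
Proof.
under eq_integral do rewrite /ball_weight mulrC EFinM.
rewrite integralMl; first last.
- by mf.
- by move=> x; rewrite lee_fin.
- by rewrite invr_ge0 ltW.
by rewrite (integral_ball BS)// -EFinM mulVf// gt_eqF.
Qed.

Lemma jensen_ball (k : R) : ((phi (`|ball_avg c r - k| / be))%:E <=
  \int[mu]_z ((ball_weight c r z)%:E * (phi (`|v z - k| / be))%:E))%E.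
Proof.
have Ki : 0 <= ((2 * r) ^+ n)^-1 by rewrite invr_ge0 ltW.
have hw z : ball_weight c r z <= ((2 * r) ^+ n)^-1 * ((z \in [set: X]) && (D c z < r))%R%:R.
  by rewrite in_setT /= mulrC.
exact: (jensen_weight BS measurableT muX Yphi mv be0 fin measurable_ball_weight Ki
  ball_weight_ge0 hw integral_ball_weight).
Qed.

Lemma ball_weight_phi (y z : X) (k : R) : (D c z < r -> D y z <= k) ->
  ball_weight c r z * phi (`|v z - v y| / be) <= k ^+ (2 * n) / (2 * r) ^+ n * H y z.
Proof.
rewrite /ball_weight; case: ltP => [_ /(_ isT) yz|_ _]; last first.
  rewrite !mul0r mulr_ge0 ?(quotient_energy_ge0 BS)// divr_ge0 ?(ltW rn0)//.
  by rewrite mulnC exprM sqr_ge0.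
rewrite mul1r mulrAC mulrC; apply: ler_wpM2r; first by rewrite invr_ge0 ltW.
rewrite distrC; exact: (phi_le_quotient_energy BS Yphi).
Qed.

Lemma phi_point_avg (y : X) (k : R) : (forall z, D c z < r -> D y z <= k) ->
  ((phi (`|v y - ball_avg c r| / be))%:E <=
   (k ^+ (2 * n) / (2 * r) ^+ n)%:E * \int[mu]_z (H y z)%:E)%E.
Proof.
move=> yk; rewrite distrC; apply: (le_trans (jensen_ball _)).
rewrite -integralMl; first last.
- by mf.
- exact: H0.
- by rewrite divr_ge0 ?(ltW rn0)// mulnC exprM sqr_ge0.
apply: ge0_le_int => z _; first by rewrite mule_ge0// lee_fin ?ball_weight_ge0// (phi_ge0 Yphi).
by rewrite -!EFinM lee_fin; exact: (ball_weight_phi (yk z)).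
Qed.

End BallWeight.

Lemma phi_ball_avg_sub (c c' : X) (r r' k : R) : 0 < r -> 0 < r' ->
  (forall y z, D c y < r -> D c' z < r' -> D y z <= k) ->
  phi (`|ball_avg c r - ball_avg c' r'| / be) <=
  k ^+ (2 * n) / ((2 * r) ^+ n * (2 * r') ^+ n).
Proof.
move=> r0 r'0 yzk; rewrite -lee_fin; apply: (le_trans (jensen_ball _ r0 _)).
have rn0 : 0 < (2 * r) ^+ n by rewrite exprn_gt0// mulr_gt0.
have rn'0 : 0 < (2 * r') ^+ n by rewrite exprn_gt0// mulr_gt0.
have K0 : 0 <= k ^+ (2 * n) / ((2 * r) ^+ n * (2 * r') ^+ n).
  by rewrite divr_ge0 ?mulr_ge0 ?(ltW rn0) ?(ltW rn'0)// mulnC exprM sqr_ge0.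
apply: (@le_trans _ _ ((k ^+ (2 * n) / ((2 * r) ^+ n * (2 * r') ^+ n))%:E *
    energy mu D n setT phi v be)%E); last first.
  by rewrite -[leRHS]mule1; apply: lee_wpmul2l; rewrite ?lee_fin.
rewrite /energy -integralMl; first last.
- by mf.
- exact: HI0.
- exact: K0.
apply: ge0_le_int => y _.
  by rewrite mule_ge0// lee_fin ?ball_weight_ge0// (phi_ge0 Yphi).
rewrite /ball_weight; case: (ltP (D c y) r) => [cy|_]; last first.
  by rewrite mul0r mul0e mule_ge0// lee_fin.
have h := phi_point_avg r'0 (yzk y ^~ cy).
rewrite mul1r; apply: (le_trans (lee_wpmul2l _ h)); first by rewrite lee_fin invr_ge0 ltW.
rewrite muleA -EFinM le_eqVlt; apply/orP; left; apply/eqP; congr (_%:E * _)%E.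
by rewrite invfM mulrCA.
Qed.

(* Along the dyadic radii R0 / 2^j the averages move by at most T * be per step. *)
Lemma oscillation (T R0 m : R) (x : X) (k : nat) (E1 E0 : set X) :
  (0 < n)%N -> 0 < R0 -> 0 <= T -> 4 ^+ n < phi T -> (R0 / 2 ^+ k) ^+ n <= m ->
  measurable E1 -> measurable E0 -> (m%:E <= mu E1)%E -> (m%:E <= mu E0)%E ->
  (forall z, E1 z -> D x z < R0 /\ v z = 1) ->
  (forall z, E0 z -> D x z < R0 /\ v z = 0) ->
  1 <= (2 * k%:R + 3) * (T * be).
Proof.
move=> n0 R00 T0 phiT Rm mE1 mE0 mE1m mE0m hE1 hE0.
pose r j := R0 / 2 ^+ j.
have r0 j : 0 < r j by rewrite divr_gt0// exprn_gt0.
have rS j : r j.+1 = r j / 2 by rewrite /r exprS invfM; ring.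
(* All comparisons below bound phi by at most 4^n: 2^n for one dyadic step, 4^n for two centres at
   radius R0, and 4^n for a point against its smallest ball. *)
have small t : phi (t / be) <= 4 ^+ n -> t <= T * be.
  move=> ht; rewrite leNgt; apply/negP => h.
  have : phi T <= phi (t / be) by apply: (phi_ndecr Yphi); rewrite ler_pdivlMr// ltW.
  by lra.
have step z j : `|ball_avg z (r j.+1) - ball_avg z (r j)| <= T * be.
  apply: small; apply: (le_trans (phi_ball_avg_sub (k := 2 * r j) (r0 _) (r0 _) _)).
    move=> y w; rewrite rS => zy zw; have := D_tri BS z y w; rewrite (D_sym BS y z).
    by have := r0 j; lra.
  rewrite rS (_ : 2 * (r j / 2) = r j); last by field.
  have := r0 j; move: (r j) => s s0.
  rewrite mulnC exprM expr2 (_ : (2 * s) ^+ n ^+ 2 / _ = 2 ^+ n); last first.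
    rewrite !exprMn; field.
    by rewrite !gt_eqF// exprn_gt0.
  by apply: lerXn2r; rewrite ?nnegrE//; lra.
have chain z j : `|ball_avg z (r j) - ball_avg z (r 0%N)| <= j%:R * (T * be).
  elim: j => [|j IH]; first by rewrite subrr normr0 mul0r.
  apply: (le_trans (ler_distD (ball_avg z (r j)) _ _)).
  rewrite -[j.+1%:R]natr1 mulrDl mul1r [leRHS]addrC.
  exact: (lerD (step z j) IH).
have start z w : D x z < R0 -> D x w < R0 ->
    `|ball_avg z (r 0%N) - ball_avg w (r 0%N)| <= T * be.
  move=> xz xw; apply: small; rewrite /r expr0 divr1.
  apply: (le_trans (phi_ball_avg_sub (k := 4 * R0) R00 R00 _)).
    move=> y y' zy wy'; have := D_tri BS z y y'; have := D_tri BS x z y'.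
    by have := D_tri BS w x y'; rewrite (D_sym BS y z) (D_sym BS z x); lra.
  rewrite le_eqVlt; apply/orP; left; apply/eqP.
  rewrite mulnC exprM expr2 -!exprMn -expr_div_n; congr (_ ^+ n).
  by field; rewrite gt_eqF.
(* Chebyshev: if every point of E were far from its average at radius r k, each section of the
   energy would be at least 8^n / r_k^n, and integrating over E, of measure at least r_k^n, would
   make the energy exceed 1. *)
have good E : measurable E -> (m%:E <= mu E)%E ->
    exists2 z, E z & `|v z - ball_avg z (r k)| <= T * be.
  move=> mE mEm; apply: contrapT => bad.
  have lb z : E z -> ((4 ^+ n)%:E <= (r k ^+ n / 2 ^+ n)%:E * \int[mu]_y (H z y)%:E)%E.
    move=> Ez; apply: (@le_trans _ _ (phi (`|v z - ball_avg z (r k)| / be))%:E).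
      rewrite lee_fin leNgt; apply/negP => h; apply: bad; exists z => //.
      by apply: small; exact: ltW.
    apply: (le_trans (phi_point_avg (k := r k) (r0 k) _)).
      by move=> y; exact: ltW.
    rewrite le_eqVlt; apply/orP; left; apply/eqP; congr (_%:E * _)%E.
    have := r0 k; move: (r k) => s s0; rewrite mulnC exprM exprMn expr2; field.
    by rewrite !gt_eqF// exprn_gt0.
  have r2 : 0 <= r k ^+ n / 2 ^+ n by rewrite divr_ge0// exprn_ge0// ltW.
  have up : ((4 ^+ n)%:E * mu E <= (r k ^+ n / 2 ^+ n)%:E)%E.
    rewrite -integral_cst//.
    apply: (@le_trans _ _ (\int[mu]_z ((r k ^+ n / 2 ^+ n)%:E * \int[mu]_y (H z y)%:E))%E); last first.
      rewrite integralMl; first last.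
      - by mf.
      - exact: HI0.
      - exact: r2.
      by rewrite -[leRHS]mule1; apply: lee_wpmul2l; rewrite ?lee_fin.
    rewrite integral_mkind; apply: ge0_le_int => z _.
      by rewrite mule_ge0 ?lee_fin//= exprn_ge0.
    case: (boolP (z \in E)) => [/set_mem Ez|_]; first by rewrite mul1e; exact: lb.
    by rewrite mul0e mule_ge0// lee_fin.
  have m0 : 0 < m by apply: lt_le_trans Rm; rewrite exprn_gt0// divr_gt0// exprn_gt0.
  have : ((4 ^+ n)%:E * m%:E <= (r k ^+ n / 2 ^+ n)%:E)%E.
    by apply: le_trans up; apply: lee_wpmul2l; rewrite ?lee_fin ?exprn_ge0.
  rewrite -EFinM lee_fin => h.
  have h2 : r k ^+ n / 2 ^+ n <= m / 2 ^+ n.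
    by apply: ler_wpM2r => //; rewrite invr_ge0 exprn_ge0.
  have h3 : m / 2 ^+ n <= m.
    rewrite ler_pdivrMr ?exprn_gt0// ler_peMr ?(ltW m0)// exprn_ege1//; lra.
  have h4 : 1 < (4 : R) ^+ n by rewrite exprn_egt1 -?lt0n//; lra.
  by move: h; rewrite leNgt => /negP; apply; apply: (le_lt_trans (le_trans h2 h3)); rewrite ltr_pMl.
have [z1 E1z1 h1] := good E1 mE1 mE1m.
have [z0 E0z0 h0] := good E0 mE0 mE0m.
have [xz1 v1] := hE1 _ E1z1; have [xz0 v0] := hE0 _ E0z0.
have c1 := chain z1 k; have c0 := chain z0 k; have s := start _ _ xz1 xz0.
rewrite v1 in h1; rewrite v0 in h0.
move: h1 h0 c1 c0 s; rewrite !ler_norml => /andP[? ?] /andP[? ?] /andP[? ?] /andP[? ?] /andP[? ?].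
(* The count 2 k + 3: k dyadic steps at each of the two points, two comparisons of a point with an
   average, and one change of centre. *)
rewrite mulrDl -mulrA; lra.
Qed.

End Oscillation.

Section Cutoff.
Context d (X : measurableType d) (R : realType).
Context (mu : {sigma_finite_measure set X -> \bar R}) (D : X -> X -> R) (n : nat).
Hypothesis BS : ball_space mu D n.
Hypothesis n0 : (0 < n)%N.
Context (phi : R -> R) (Cg : R).
Hypothesis Yphi : young_on_R phi.
Hypothesis growth : forall t, 0 < t ->
  (\int[lebesgue_measure]_(s in `]0%R, t[) (phi s / s ^+ n / s)%:E <=
  (Cg * phi t / t ^+ n)%:E)%E.
Let mD := D_meas BS.
Let mphi := measurable_phi Yphi.

Definition cutoff_const : R := 2 * (2 ^+ (2 * n).+1 * Cg + 2 * 4 ^+ n).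

Lemma cutoff_const_gt0 : 0 < cutoff_const.
Proof.
rewrite mulr_gt0// ltr_wpDl ?mulr_gt0 ?exprn_gt0//.
by rewrite mulr_ge0 ?(growth_ge0 Yphi growth)// exprn_ge0.
Qed.

Section Estimate.
Context (S : set X) (x : X) (a b al : R).
Hypothesis mS : measurable S.
Hypothesis ab : a < b.
Hypothesis al0 : 0 < al.
Let r := b - a.
Let r0 : 0 < r. Proof. by rewrite subr_gt0. Qed.

Definition cutoff (z : X) : R := clamp (1 + (D x z - a) / (b - a)).
Let mclamp := @measurable_clamp R.

Lemma measurable_cutoff : measurable_fun setT cutoff.
Proof. by rewrite /cutoff; mf. Qed.

Lemma cutoff1 z : D x z <= a -> cutoff z = 1.
Proof.
by move=> h; apply: clamp1; rewrite gerDl pmulr_lle0 ?invr_gt0// subr_le0.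
Qed.

Lemma cutoff0 z : b <= D x z -> cutoff z = 0.
Proof.
move=> h; apply: clamp0; rewrite -[leLHS]/(1 + 1) lerD2l ler_pdivlMr// mul1r.
by rewrite lerD2r.
Qed.

Lemma cutoff_lip z w : `|cutoff z - cutoff w| <= Num.min 1 (D z w / r).
Proof.
rewrite le_min; apply/andP; split.
  have := clamp_ge0 (1 + (D x z - a) / (b - a)); have := clamp_le1 (1 + (D x z - a) / (b - a)).
  have := clamp_ge0 (1 + (D x w - a) / (b - a)); have := clamp_le1 (1 + (D x w - a) / (b - a)).
  rewrite /cutoff; move: (clamp _) => s; move: (clamp _) => t *; rewrite ler_norml; lra.
apply: (le_trans (clamp_lip _ _)).
rewrite (_ : _ - _ = (D x z - D x w) / r); last by rewrite /r; field; rewrite gt_eqF.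
rewrite normrM (gtr0_norm (_ : 0 < r^-1)) ?invr_gt0// ler_pM2r ?invr_gt0//.
rewrite ler_norml; have := D_tri BS z x w; have := D_tri BS w x z.
by rewrite (D_sym BS w z); lra.
Qed.

(** If neither point lies in the ball of radius b, the cutoff vanishes at both. Every other pair is
    charged to one of its points in that ball, so the total is proportional to the volume of the
    ball within S. *)
Let G z w : R := ((z \in S) && (D x z < b))%R%:R *
  (phi (al^-1 * Num.min 1 (D z w / r)) / D z w ^+ (2 * n)).
Let G0 z w : 0 <= G z w.
Proof. by rewrite mulr_ge0// divr_ge0 ?(phi_ge0 Yphi)// exprn_ge0// (D_ge0 BS). Qed.
Let mG : measurable_fun setT (fun p : X * X => G p.1 p.2).
Proof. by rewrite /G; mf. Qed.

Let H_le z w : quotient_energy D n S phi cutoff al z w <= G z w + G w z.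
Proof.
rewrite /quotient_energy.
have [/set_mem Sz|] := boolP (z \in S); last by rewrite /= mul0r addr_ge0.
have [/set_mem Sw|] := boolP (w \in S); last by rewrite /= mul0r addr_ge0.
rewrite /= mul1r.
have le1 : phi (`|cutoff z - cutoff w| / al) / D z w ^+ (2 * n) <=
    phi (al^-1 * Num.min 1 (D z w / r)) / D z w ^+ (2 * n).
  apply: ler_wpM2r; first by rewrite invr_ge0 exprn_ge0// (D_ge0 BS).
  by apply: (phi_ndecr Yphi); rewrite mulrC ler_pM2l ?invr_gt0//; exact: cutoff_lip.
have [zb|zb] := ltP (D x z) b.
  have -> : G z w = phi (al^-1 * Num.min 1 (D z w / r)) / D z w ^+ (2 * n).
    by rewrite /G mem_set// zb /= mul1r.
  by apply: (le_trans le1); rewrite lerDl; exact: G0.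
have [wb|wb] := ltP (D x w) b.
  have -> : G w z = phi (al^-1 * Num.min 1 (D z w / r)) / D z w ^+ (2 * n).
    by rewrite /G mem_set// wb /= mul1r (D_sym BS w z).
  by apply: (le_trans le1); rewrite lerDr; exact: G0.
by rewrite !cutoff0// subrr normr0 mul0r (phi_npos Yphi (lexx 0)) mul0r addr_ge0.
Qed.

(** Pairs closer than r see the Lipschitz bound and fall under [integral_radial]; the others see the
    bound 1 and fall under [integral_tail]. *)
Let G_inner z : (\int[mu]_w (G z w)%:E <=
  (2 ^+ (2 * n).+1 * Cg * phi (2 * al^-1) / r ^+ n + phi (2 * al^-1) * (2 * 4 ^+ n / r ^+ n))%:E *
  ((z \in S) && (D x z < b))%R%:R%:E)%E.
Proof.
have ai0 : 0 <= al^-1 by rewrite invr_ge0 ltW.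
have D0 w : 0 <= (D z w ^+ (2 * n))^-1 by rewrite invr_ge0 exprn_ge0// (D_ge0 BS).
rewrite /G; case: ((z \in S) && (D x z < b)); last first.
  by rewrite mule0 integral0_eq// => w _; rewrite mul0r.
rewrite mule1.
pose F1 w := ((D z w < r)%R%:R * (phi (al^-1 * (D z w / r)) / D z w ^+ (2 * n)))%:E.
pose F2 w := ((r <= D z w)%R%:R / D z w ^+ (2 * n))%:E.
have F10 w : (0 <= F1 w)%E by rewrite lee_fin mulr_ge0// mulr_ge0 ?(phi_ge0 Yphi).
have F20 w : (0 <= F2 w)%E by rewrite lee_fin mulr_ge0.
have mF1 : measurable_fun setT F1 by rewrite /F1; mf.
have mF2 : measurable_fun setT F2 by rewrite /F2; mf.
have p0 : 0 <= phi (2 * al^-1) by exact: (phi_ge0 Yphi).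
apply: (@le_trans _ _ (\int[mu]_w (F1 w + (phi (2 * al^-1))%:E * F2 w))%E).
  apply: ge0_le_int => w _; first by rewrite lee_fin mul1r mulr_ge0 ?(phi_ge0 Yphi).
  rewrite /F1 /F2 -EFinM -EFinD lee_fin mul1r; case: (ltP (D z w) r) => zw.
    rewrite mul1r mul0r mulr0 addr0 min_r// ler_pdivrMr// mul1r; exact: ltW.
  rewrite mul0r add0r mul1r min_l ?mulr1; last by rewrite ler_pdivlMr// mul1r.
  apply: ler_wpM2r => //; apply: (phi_ndecr Yphi).
  by rewrite ler_peMl//; lra.
rewrite integralDT; first last.
- by apply: mfeM => //; exact: measurable_cst.
- exact: mF1.
- by move=> w; rewrite mule_ge0.
- exact: F10.
rewrite integralMl//.
rewrite EFinD [X in (_ <= _ + X)%E]EFinM; apply: leeD; first exact: (integral_radial BS Yphi growth).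
by apply: lee_wpmul2l; [rewrite lee_fin|exact: (integral_tail BS)].
Qed.

Lemma cutoff_energy : (energy mu D n S phi cutoff al <=
  (cutoff_const * phi (2 / al) / r ^+ n)%:E * mu [set z | S z /\ (D x z < b)%R])%E.
Proof.
have c0 : 0 <= 2 ^+ (2 * n).+1 * Cg * phi (2 * al^-1) / r ^+ n + phi (2 * al^-1) * (2 * 4 ^+ n / r ^+ n).
  have rn0 : 0 <= (r ^+ n)^-1 by rewrite invr_ge0 exprn_ge0// ltW.
  by rewrite addr_ge0// !mulr_ge0 ?(growth_ge0 Yphi growth) ?(phi_ge0 Yphi)// exprn_ge0.
have IG : (\int[mu]_z \int[mu]_w (G z w)%:E <=
    (2 ^+ (2 * n).+1 * Cg * phi (2 * al^-1) / r ^+ n + phi (2 * al^-1) * (2 * 4 ^+ n / r ^+ n))%:E *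
    mu [set z | S z /\ (D x z < b)%R])%E.
  rewrite (_ : [set z | _] = [set z | (z \in S) && (D x z < b)]); last first.
    by apply/seteqP; split => z /= => [[/mem_set -> ->]|/andP[/set_mem ? ?]].
  rewrite -integral_bool; last by mf.
  rewrite -integralMl; first last.
  - by mf.
  - by [].
  - exact: c0.
  by apply: ge0_le_int => z _; [apply: integral_ge0 => w _; rewrite lee_fin|exact: G_inner].
have GG0 z w : (0 <= (G z w)%:E)%E by rewrite lee_fin.
have IGT : (\int[mu]_z \int[mu]_w (G w z)%:E = \int[mu]_z \int[mu]_w (G z w)%:E)%E.
  rewrite (@tonelli _ _ _ _ _ mu mu (fun z w => (G w z)%:E))//.
  by apply: mf_EFin; apply: (mf_comp2 (f := G) mG); mf.
apply: (@le_trans _ _ (\int[mu]_z (\int[mu]_w (G z w)%:E + \int[mu]_w (G w z)%:E))%E).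
  apply: ge0_le_int => z _.
    by apply: integral_ge0 => w _; rewrite lee_fin (quotient_energy_ge0 BS).
  rewrite -integralDT; first last.
  - by apply: mf_EFin; apply: (mf_comp2 (f := G) mG); mf.
  - by mf.
  - by move=> w; rewrite lee_fin.
  - by move=> w; rewrite lee_fin.
  apply: ge0_le_int => w _; first by rewrite lee_fin (quotient_energy_ge0 BS).
  by rewrite -EFinD lee_fin; exact: H_le.
rewrite integralDT; first last.
- by apply: mf_int => [|z w]; [apply: mf_EFin; apply: (mf_comp2 (f := G) mG); mf|exact: GG0].
- by mf.
- by move=> z; apply: integral_ge0.
- by move=> z; apply: integral_ge0.
rewrite IGT; apply: (le_trans (leeD IG IG)).
rewrite -ge0_muleDl; [|by rewrite lee_fin|by rewrite lee_fin].
apply: lee_wpmul2r; first exact: measure_ge0.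
rewrite -EFinD lee_fin /cutoff_const le_eqVlt.
by apply/orP; left; apply/eqP; ring.
Qed.

End Estimate.
End Cutoff.

Lemma young_unbounded (R : realType) (phi : R -> R) (M : R) : young_on_R phi -> 0 <= M ->
  exists2 T, 0 < T & M < phi T.
Proof.
move=> Yphi M0; have p1 : 0 < phi 1 by exact: (phi_pos Yphi).
have T0 : 0 < (phi 1 + M + 1) / phi 1 by rewrite divr_gt0//; lra.
exists ((phi 1 + M + 1) / phi 1) => //.
have := phi_linear Yphi (ltW T0); rewrite mulrC divfK ?gt_eqF//; lra.
Qed.

(** * Capacity estimate in extension domains *)

Section Capacity.
Context (R : realType) (n : nat) (phi : R -> R).
Hypothesis n0 : (0 < n)%N.
Hypothesis Yphi : young_function phi.
Hypothesis gfin : (growth_constant n phi < +oo)%E.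
Local Notation E := (Rn R n).
Local Notation psi := (nonneg_ext phi).
Local Notation D := (@supdist R n).
Local Notation mu := (@lebesgueRn R n).
Let Ypsi := young_nonneg_ext Yphi.
Let BS := Rn_ball_space R n.

Lemma lebesgueRn_setT_gt0 : (0 < mu setT)%E.
Proof.
apply: (@lt_le_trans _ _ (mu [set y | D 0 y < 1])); last exact: le_lebesgueRn.
by rewrite lebesgueRn_supball// lte_fin mulr1 exprn_gt0.
Qed.

Lemma besov_extend (Omega : set E) (u : E -> R) (al : R) (Ext : (E -> R) -> E -> R) (C : R) :
  measurable Omega -> 0 < al -> 0 < C -> measurable_fun setT u ->
  (energy mu D n Omega psi u al <= 1)%E ->
  (forall u, besov phi Omega u -> besov phi setT (Ext u)) ->
  (forall u, besov phi Omega u ->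
    (besov_seminorm phi setT (Ext u) <= C%:E * besov_seminorm phi Omega u)%E) ->
  besov phi Omega u /\ measurable_fun setT (Ext u) /\
  exists be, [/\ 0 < be, be < n%:R ^+ n * (2 * C * al) &
    (energy mu D n setT psi (Ext u) be <= 1)%E].
Proof.
move=> mO al0 C0 mu_ e1 Emap Ebd.
have mod1 : (modular phi Omega u al <= 1)%E.
  apply: (le_trans (modular_le_energy Yphi Omega u al0)); apply: le_trans e1.
  rewrite /energy [X in (X <= _)%E]integral_mkind; apply: ge0_le_int => x _.
    rewrite mule_ge0//; apply: integral_ge0 => y _.
    by rewrite lee_fin divr_ge0 ?(phi_ge0 Ypsi)// exprn_ge0// normr_ge0.
  case: (boolP (x \in Omega)) => xO; last first.
    by rewrite mul0e; apply: integral_ge0 => y _; rewrite lee_fin (quotient_energy_ge0 BS).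
  rewrite mul1e integral_mkind; apply: ge0_le_int => y _.
    by rewrite mule_ge0// lee_fin divr_ge0 ?(phi_ge0 Ypsi)// exprn_ge0// normr_ge0.
  by rewrite /quotient_energy xO -EFinM.
have sem := seminorm_le al0 mod1.
have bu : besov phi Omega u.
  by split; [exact: measurable_funTS|exact: le_lt_trans (ltry al)].
have [mEu _] := Emap u bu.
split=> //; split=> //.
(* The factor 2 makes the bound strict, so an admissible [be] exists even if the infimum is not
   attained. *)
have : (besov_seminorm phi setT (Ext u) < (2 * C * al)%:E)%E.
  apply: (le_lt_trans (Ebd u bu)); apply: (@le_lt_trans _ _ (C%:E * al%:E)%E).
    by apply: lee_wpmul2l; rewrite ?lee_fin ?(ltW C0).
  by rewrite -EFinM lte_fin -mulrA ltr_pMl ?mulr_gt0//; lra.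
move=> /ereal_inf_lt[_ [be [be0 hbe] <-]]; rewrite lte_fin => beal.
have k0 : 0 < (n%:R : R) ^+ n by rewrite exprn_gt0// ltr0n.
exists (n%:R ^+ n * be); split; first exact: mulr_gt0.
  by rewrite ltr_pM2l.
by have := energy_le_modular n0 Yphi be0 hbe; rewrite patch_setT.
Qed.

(** If the bound failed, the cutoff would have energy at most 1 at a parameter [al] of order 1 / (2
    k + 3), and its extension at a comparable [be]. That is too small for the 2 k + 3 steps of
    [oscillation] to lead from value 1 to value 0. *)
Lemma capacity (Omega : set E) : measurable Omega -> extension_domain phi Omega ->
  exists C1 C2 : R, [/\ 0 < C1, 0 < C2 &
  forall (x : E) (a b R0 m : R) (k : nat) (Z : set E),
    a < b -> a <= R0 -> 0 < R0 -> (R0 / 2 ^+ k) ^+ n <= m ->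
    measurable Z -> (forall z, Z z -> [/\ Omega z, D x z < R0 & b <= D x z]) ->
    (m%:E <= mu [set z | Omega z /\ (D x z < a)%R])%E -> (m%:E <= mu Z)%E ->
    (((b - a) ^+ n)%:E <=
      (C1 * psi (C2 * k.+2%:R))%:E * mu [set z | Omega z /\ (D x z < b)%R])%E].
Proof.
move=> mO [Ext [_ Emap _ [C C0 Ebd] Eid]].
have [Cg growth] := growth_nonneg_ext Yphi gfin.
have [T T0 phiT] := young_unbounded Ypsi (exprn_ge0 n (ler0n R 4)).
have nn0 : 0 < (n%:R : R) ^+ n by rewrite exprn_gt0// ltr0n.
have c10 := cutoff_const_gt0 Ypsi growth.
pose B : R := 2 * C * n%:R ^+ n * T.
have B0 : 0 < B by rewrite !mulr_gt0.
exists (cutoff_const n Cg), (4 * B); split=> //; first by rewrite mulr_gt0.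
move=> x a b R0 m k Z ab aR R00 Rm mZ hZ mE mZm.
rewrite leNgt; apply/negP => small.
have r0 : 0 < (b - a) ^+ n by rewrite exprn_gt0// subr_gt0.
have k3 : 0 < 2 * k%:R + 3 :> R by have := ler0n R k; lra.
(* Then (2 k + 3) T n^n (2 C al) = 1, the contradictory value, while 2 / al = B (4 k + 6) <= 4 B (k
   + 2) explains the second constant. *)
pose al := (B * (2 * k%:R + 3))^-1.
have al0 : 0 < al by rewrite invr_gt0 mulr_gt0.
have e1 : (energy mu D n Omega psi (cutoff D x a b) al <= 1)%E.
  apply: (le_trans (cutoff_energy BS n0 Ypsi growth x mO ab al0)).
  apply: (@le_trans _ _ (((b - a) ^+ n)^-1%:E * ((cutoff_const n Cg * psi (4 * B * k.+2%:R))%:E *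
      mu [set z | Omega z /\ (D x z < b)%R]))%E).
    rewrite muleA; apply: lee_wpmul2r; first exact: measure_ge0.
    rewrite -EFinM lee_fin mulrC ler_pM2l ?invr_gt0// ler_pM2l//.
    apply: (phi_ndecr Ypsi); rewrite /al invrK.
    rewrite -[k.+2]addn2 natrD; have := ler0n R k; move: (k%:R : R) => t t0.
    rewrite (_ : 2 * (B * (2 * t + 3)) = B * (4 * t + 6)); last by ring.
    rewrite (_ : 4 * B * (t + 2) = B * (4 * t + 8)); last by ring.
    by rewrite ler_pM2l//; lra.
  by rewrite lee_pdivrMl// mule1; exact: ltW.
have [bu [mEu [be [be0 beal ev]]]] := besov_extend mO al0 C0 (measurable_cutoff BS x a b) e1 Emap Ebd.
have osc := oscillation BS lebesgueRn_setT_gt0 Ypsi mEu be0 ev n0 R00 (ltW T0) phiT Rm.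
have mE1 : measurable [set z | Omega z /\ (D x z < a)%R].
  rewrite (_ : [set z | _] = Omega `&` [set z | D x z < a])//.
  by apply: measurableI => //; exact: (mball BS).
have := osc x _ Z mE1 mZ mE mZm _ _.
have inO z : Omega z -> Ext (cutoff D x a b) z = cutoff D x a b z.
  by move=> Oz; apply: (Eid _ bu); rewrite mem_set.
move=> h.
have {h} : 1 <= (2 * k%:R + 3) * (T * be).
  apply: h => z.
    move=> [Oz xz]; split; first exact: lt_le_trans aR.
    by rewrite inO// cutoff1// ltW.
  by move=> /hZ[Oz xz bz]; split=> //; rewrite inO// cutoff0.
apply/negP; rewrite -ltNge.
apply: (@lt_le_trans _ _ ((2 * k%:R + 3) * (T * (n%:R ^+ n * (2 * C * al))))).
  by rewrite !ltr_pM2l.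
rewrite le_eqVlt; apply/orP; left; apply/eqP; rewrite /al /B.
move: (2 * k%:R + 3 : R) k3 (n%:R ^+ n) nn0 => s s0 q q0.
by field; rewrite !gt_eqF.
Qed.

End Capacity.

(** * Extension sets are regular *)

Section Subexponential.
Context (R : realType) (phi : R -> R).
Hypothesis Yphi : young_function phi.
Hypothesis sub : subexponential phi.
Local Notation psi := (nonneg_ext phi).
Let Ypsi := young_nonneg_ext Yphi.

Lemma subexponential_bound (c : R) : 0 < c ->
  exists2 A, 0 < A & forall t, 0 <= t -> psi t <= A * expR (c * t).
Proof.
move=> c0; have : (limf_esup (fun x : R => (phi x * expR (- (c * x)))%:E) (+oo)%R < 1%:E)%E.
  by rewrite sub// lte_fin.
move=> /ereal_inf_lt[_ [B [M [_ hM]] <-] hB].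
have big x : M < x -> phi x <= expR (c * x).
  move=> /hM Bx; have : ((phi x * expR (- (c * x)))%:E < 1%:E)%E.
    by apply: le_lt_trans hB; apply: ereal_sup_ubound; exists x.
  by rewrite lte_fin expRN ltr_pdivrMr ?expR_gt0// mul1r => /ltW.
have p0 : 0 <= psi (`|M| + 1) by exact: (phi_ge0 Ypsi).
exists (1 + psi (`|M| + 1)) => [|t t0]; first by lra.
have ct : 1 <= expR (c * t) by rewrite -expR0 ler_expR mulr_ge0// ltW.
have [Mt|tM] := ltP M t.
  rewrite nonneg_extE//; apply: (le_trans (big t Mt)).
  by rewrite ler_peMl ?lerDl//; lra.
have h : psi t <= psi (`|M| + 1).
  by apply: (phi_ndecr Ypsi); have := ler_norm M; lra.
apply: (le_trans h); apply: (@le_trans _ _ (1 + psi (`|M| + 1))); first lra.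
by rewrite ler_peMr//; lra.
Qed.

(** The exponential rate is chosen so that the square of exp (c C (k + 2)) is 2^(n (k + 2)); the
    shift by 2 gives the factor 4^n. *)
Lemma subexponential_sqr (n : nat) (C : R) : (0 < n)%N -> 0 < C ->
  exists2 A, 0 < A & forall k, psi (C * k.+2%:R) ^+ 2 <= A * (2 ^+ k) ^+ n.
Proof.
move=> n0 C0; have n0' : 0 < n%:R :> R by rewrite ltr0n.
have l2 : 0 < ln 2 :> R by rewrite ln_gt0//; lra.
have c0 : 0 < n%:R * ln 2 / (2 * C) by rewrite divr_gt0 ?mulr_gt0.
have [A A0 hA] := subexponential_bound c0.
exists (A ^+ 2 * 4 ^+ n) => [|k]; first by rewrite mulr_gt0 ?exprn_gt0.
have t0 : 0 <= C * k.+2%:R by rewrite mulr_ge0// ltW.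
apply: (@le_trans _ _ ((A * expR (n%:R * ln 2 / (2 * C) * (C * k.+2%:R))) ^+ 2)).
  apply: lerXn2r; rewrite ?nnegrE; [exact: (phi_ge0 Ypsi)| |exact: hA].
  by rewrite mulr_ge0 ?expR_ge0 ?(ltW A0).
rewrite exprMn -[leRHS]mulrA ler_pM2l ?exprn_gt0// -expRM_natl.
rewrite (_ : 2%:R * _ = (k.+2 * n)%:R * ln 2); last first.
  by rewrite natrM; field; rewrite gt_eqF.
rewrite expRM_natl lnK ?posrE// exprM -exprMn (_ : 2 ^+ k.+2 = 4 * 2 ^+ k)//.
by rewrite !exprS; ring.
Qed.

End Subexponential.

Lemma bernoulli_sub (R : realFieldType) (e : R) (m : nat) : 0 <= e -> e <= 1 ->
  1 - m%:R * e <= (1 - e) ^+ m.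
Proof.
move=> e0 e1; elim: m => [|m IH]; first by rewrite mul0r subr0 expr0.
rewrite exprSr -natr1; have m0 := ler0n R m.
have : (1 - m%:R * e) * (1 - e) <= (1 - e) ^+ m * (1 - e).
  by apply: ler_wpM2r => //; lra.
by apply: le_trans; nra.
Qed.

(* De Giorgi iteration along the radii s (1 + q^j) / 2 with q = 1 - 1/(4n), so that q^(2n) >= 1/2. *)
Lemma de_giorgi (R : realType) (n : nat) (C s : R) (f : R -> R) :
  (0 < n)%N -> 0 < C -> 0 < s -> {homo f : x y / x <= y} ->
  (forall r, 0 < r -> 0 < f r) ->
  (forall a b, 0 < a -> a < b -> b <= s -> f b <= 2 * f a ->
    (b - a) ^+ (2 * n) <= C * s ^+ n * f b) ->
  s ^+ n <= C * (8 * n%:R) ^+ (2 * n) * f s.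
Proof.
move=> n0 C0 s0 f_ndecr f_pos step; rewrite leNgt; apply/negP => small.
have n1 : 1 <= n%:R :> R by rewrite ler1n.
pose e : R := (4 * n%:R)^-1.
have e0 : 0 < e by rewrite invr_gt0; lra.
have e1 : e <= 1 by rewrite invf_le1; lra.
have ne : n%:R * e = 4^-1 by rewrite /e; field; rewrite gt_eqF//; lra.
have q0 : 0 < 1 - e.
  rewrite subr_gt0 invf_lt1; lra.
have q1 : 2^-1 <= (1 - e) ^+ (2 * n).
  apply: le_trans (bernoulli_sub (2 * n) (ltW e0) e1).
  by rewrite natrM -mulrA ne; lra.
pose b j := s * (1 + (1 - e) ^+ j) / 2.
have bS j : b j - b j.+1 = s * (1 - e) ^+ j / (8 * n%:R).
  rewrite /b exprS -/e; rewrite (_ : (8 * n%:R)^-1 = e / 2); first by field.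
  by rewrite /e; field; rewrite gt_eqF//; lra.
have qj j : 0 < (1 - e) ^+ j by exact: exprn_gt0.
have bh j : s / 2 < b j by rewrite /b ltr_pM2r// ltr_pMr// ltrDl.
have bs j : b j <= s.
  have : (1 - e) ^+ j <= 1 by apply: exprn_ile1; lra.
  by rewrite /b; move: s0 => ? ?; nra.
(* If f did not halve between b j and b j.+1, the doubling hypothesis would hold there. The gap (b j
   - b j.+1)^(2 n) shrinks no faster than 2^(-j), so [step] would contradict [small]. *)
have decay j : f (b j) <= f s / 2 ^+ j.
  elim: j => [|j IH].
    by rewrite expr0 divr1; apply: f_ndecr; exact: bs.
  rewrite leNgt; apply/negP => h.
  have dbl : f (b j) <= 2 * f (b j.+1).
    apply: (le_trans IH); move: h; rewrite exprS invfM mulrCA.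
    by move: (f s / _) (f (b j.+1)) => u v; lra.
  have bj : 0 < b j.+1 by apply: lt_trans (bh _); rewrite divr_gt0.
  have bb : b j.+1 < b j.
    by rewrite -subr_gt0 bS divr_gt0 ?mulr_gt0//; lra.
  have := step _ _ bj bb (bs j) dbl; rewrite bS leNgt => /negP; apply.
  apply: (@le_lt_trans _ _ (C * s ^+ n * (f s / 2 ^+ j))).
    by rewrite ler_pM2l// mulr_gt0// exprn_gt0.
  have hq : (2 ^+ j)^-1 <= ((1 - e) ^+ j) ^+ (2 * n).
    rewrite exprAC -exprVn; apply: lerXn2r; rewrite ?nnegrE//.
    by rewrite exprn_ge0// ltW.
  have p0 : 0 < ((2 : R) ^+ j)^-1 by rewrite invr_gt0 exprn_gt0.
  have X0 : 0 < (8 * n%:R : R) ^+ (2 * n) by rewrite exprn_gt0//; lra.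
  have sn0 : 0 < s ^+ n by exact: exprn_gt0.
  rewrite expr_div_n exprMn.
  have sE : s ^+ (2 * n) = s ^+ n * s ^+ n by rewrite mulnC exprM expr2.
  apply: (@lt_le_trans _ _ (s ^+ (2 * n) * (2 ^+ j)^-1 / (8 * n%:R) ^+ (2 * n))); last first.
    by rewrite ler_pM2r ?invr_gt0// ler_pM2l// exprn_gt0.
  rewrite ltr_pdivlMr// sE; move: small.
  move: ((8 * n%:R) ^+ _) X0 (s ^+ n) sn0 (_^-1) p0 (f s) => X X0 sn sn0 p p0 fs small.
  rewrite (_ : C * sn * (fs * p) * X = C * X * fs * (sn * p)); last by ring.
  by rewrite -[ltRHS]mulrA ltr_pM2r// mulr_gt0.
(* The radii stay above s / 2, so f cannot tend to 0 along them. *)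
have fs2 : 0 < f (s / 2) by apply: f_pos; rewrite divr_gt0.
have [j hj] := exists_pow2 (f s / f (s / 2)).
have := decay j; rewrite leNgt => /negP; apply.
apply: (@lt_le_trans _ _ (f (s / 2))); last by apply: f_ndecr; exact: ltW.
by rewrite ltr_pdivrMr ?exprn_gt0// mulrC -ltr_pdivrMr.
Qed.

Lemma continuous_dist (R : realType) (V : normedModType R) (p : V) :
  continuous (fun z : V => `|p - z|).
Proof. by move=> z; apply: cvg_norm; apply: cvgB; [exact: cvg_cst|exact: cvg_id]. Qed.

Lemma open_dist_lt (R : realType) (V : normedModType R) (p : V) (t : R) :
  open [set z : V | `|p - z| < t].
Proof.
apply: (@open_comp _ _ (fun z : V => `|p - z|) [set r : R | r < t]); last exact: open_lt.
by move=> z _; exact: continuous_dist.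
Qed.

Lemma closed_dist_le (R : realType) (V : normedModType R) (p : V) (t : R) :
  closed [set z : V | `|p - z| <= t].
Proof.
apply: (@preimage_closed _ _ (fun z : V => `|p - z|) [set r : R | r <= t]); last exact: closed_le.
by move=> z _; exact: continuous_dist.
Qed.

(** * Volume lower bound in extension domains *)

Section Regularity.
Context (R : realType) (n : nat) (phi : R -> R).
Hypothesis n0 : (0 < n)%N.
Hypothesis Yphi : young_function phi.
Hypothesis gfin : (growth_constant n phi < +oo)%E.
Hypothesis sub : subexponential phi.
Local Notation E := (Rn R n).
Local Notation psi := (nonneg_ext phi).
Local Notation D := (@supdist R n).
Local Notation mu := (@lebesgueRn R n).
Let Ypsi := young_nonneg_ext Yphi.
Let BS := Rn_ball_space R n.
Context (Omega : set E).
Hypothesis dO : domain (Omega : set 'rV[R]_n).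

Let moO : metric_open D Omega.
Proof. by have [oO _ _] := dO; exact: open_metric_open. Qed.

Let mO : measurable Omega. Proof. exact: (measurable_metric_open BS moO). Qed.

Definition ball_part (x : E) (r : R) : set E := [set z | Omega z /\ (D x z < r)%R].
Definition ball_vol (x : E) (r : R) : R := fine (mu (ball_part x r)).

Lemma measurable_ball_part x r : measurable (ball_part x r).
Proof. by apply: measurableI => //; exact: (mball BS). Qed.

Lemma le_ball_part x r : 0 < r -> (mu (ball_part x r) <= ((2 * r) ^+ n)%:E)%E.
Proof. by move=> r0; rewrite -(lebesgueRn_supball x r0); apply: le_lebesgueRn => z []. Qed.

Lemma ball_volE x r : mu (ball_part x r) = (ball_vol x r)%:E.
Proof.
rewrite fineK// ge0_fin_numE//.
apply: (@le_lt_trans _ _ (mu (ball_part x (`|r| + 1)))).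
  by apply: le_lebesgueRn => z [Oz xz]; split=> //; apply: (lt_le_trans xz); have := ler_norm r; lra.
by apply: (le_lt_trans (le_ball_part _ _)); rewrite ?ltr_wpDl// ltry.
Qed.

Lemma ball_vol_ndecr x : {homo ball_vol x : r s / r <= s}.
Proof.
move=> r s rs; rewrite -lee_fin -!ball_volE; apply: le_lebesgueRn => z [Oz xz].
by split=> //; exact: lt_le_trans rs.
Qed.

Lemma ball_vol_gt0 x r : Omega x -> 0 < r -> 0 < ball_vol x r.
Proof.
move=> Ox r0; have [e e0 he] := moO Ox.
have m0 : 0 < Num.min e r by rewrite lt_min e0.
rewrite -lte_fin -ball_volE; apply: (@lt_le_trans _ _ (mu [set z | D x z < Num.min e r])).
  by rewrite lebesgueRn_supball// lte_fin exprn_gt0// mulr_gt0.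
by apply: le_lebesgueRn => z /=; rewrite lt_min => /andP[xe xr]; split=> //; exact: he.
Qed.

(** Square the capacity estimate. One factor |B_b| is kept, the other is replaced by 2 |B_a|, and
    psi^2 by A 2^(k n); for the least admissible k, 2^(k n) |B_a| is at most (2 R0)^n, so the loss
    is absorbed. *)
Lemma ball_vol_growth : extension_domain phi Omega -> exists2 C, 0 < C &
  forall (x : E) (a b R0 : R) (Z : set E), Omega x -> 0 < a -> a < b -> b <= R0 ->
    measurable Z -> (forall z, Z z -> [/\ Omega z, D x z < R0 & b <= D x z]) ->
    ((ball_vol x a)%:E <= mu Z)%E -> ball_vol x b <= 2 * ball_vol x a ->
    (b - a) ^+ (2 * n) <= C * R0 ^+ n * ball_vol x b.
Proof.
move=> ext; have [C1 [C2 [C10 C20 cap]]] := capacity n0 Yphi gfin mO ext.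
have [A A0 hA] := subexponential_sqr Yphi sub n0 C20.
exists (2 * C1 ^+ 2 * A * 2 ^+ n) => [|x a b R0 Z Ox a0 ab bR mZ hZ aZ dbl].
  by rewrite !mulr_gt0 ?exprn_gt0.
have R00 : 0 < R0 by apply: lt_le_trans bR; apply: lt_trans ab.
have ma0 := ball_vol_gt0 Ox a0.
have Rn0 : 0 < R0 ^+ n by exact: exprn_gt0.
have pow k : (R0 / 2 ^+ k) ^+ n = R0 ^+ n / (2 ^+ k) ^+ n by rewrite expr_div_n.
have exk : exists k, (R0 / 2 ^+ k) ^+ n <= ball_vol x a.
  have [k hk] := exists_pow2 (R0 ^+ n / ball_vol x a); exists k.
  rewrite pow ler_pdivrMr ?exprn_gt0// mulrC -ler_pdivrMr//.
  apply: (le_trans (ltW hk)); rewrite -[leLHS]expr1; apply: ler_weXn2l => //.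
  by apply: exprn_ege1; lra.
have [k hk kmin] := ex_minnP exk.
(* For k > 0 this is the minimality of k; for k = 0 it is the trivial volume bound of a ball of
   radius a <= R0. *)
have kle : (2 ^+ k) ^+ n * ball_vol x a <= (2 * R0) ^+ n.
  case: k hk kmin => [|k] _ kmin.
    rewrite expr0 expr1n mul1r -lee_fin -ball_volE.
    apply: (le_trans (le_ball_part x a0)); rewrite lee_fin.
    by apply: lerXn2r; rewrite ?nnegrE; lra.
  have : ball_vol x a < (R0 / 2 ^+ k) ^+ n.
    by rewrite ltNge; apply/negP => /kmin; rewrite ltnn.
  rewrite pow ltr_pdivlMr ?exprn_gt0// => /ltW h.
  by rewrite exprS !exprMn -mulrA ler_pM2l ?exprn_gt0// mulrC.
have aR : a <= R0 by lra.
have := cap x a b R0 (ball_vol x a) k Z ab aR R00 hk mZ hZ _ aZ.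
rewrite -/(ball_part x a) -/(ball_part x b) !ball_volE => /(_ (lexx _)).
rewrite -EFinM lee_fin => h.
have p0 : 0 <= psi (C2 * k.+2%:R) by exact: (phi_ge0 Ypsi).
have mb0 : 0 <= ball_vol x b by apply: ltW; apply: lt_le_trans ma0 _; apply: ball_vol_ndecr; exact: ltW.
rewrite mulnC exprM.
apply: (@le_trans _ _ ((C1 * psi (C2 * k.+2%:R) * ball_vol x b) ^+ 2)).
  by apply: lerXn2r; rewrite ?nnegrE ?mulr_ge0 ?exprn_ge0 ?subr_ge0 ?(ltW ab) ?(ltW C10).
rewrite exprMn [(C1 * _) ^+ 2]exprMn [ball_vol x b ^+ 2]expr2.
apply: (@le_trans _ _ (C1 ^+ 2 * (A * (2 ^+ k) ^+ n) * (ball_vol x b * (2 * ball_vol x a)))).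
  apply: ler_pM; rewrite ?mulr_ge0 ?exprn_ge0 ?(ltW C10)//.
    by rewrite ler_pM2l ?exprn_gt0.
  by apply: ler_wpM2l.
have -> : C1 ^+ 2 * (A * (2 ^+ k) ^+ n) * (ball_vol x b * (2 * ball_vol x a)) =
    2 * C1 ^+ 2 * A * ball_vol x b * ((2 ^+ k) ^+ n * ball_vol x a) by ring.
have -> : 2 * C1 ^+ 2 * A * 2 ^+ n * R0 ^+ n * ball_vol x b =
    2 * C1 ^+ 2 * A * ball_vol x b * (2 * R0) ^+ n by rewrite exprMn; ring.
by apply: ler_wpM2l => //; rewrite !mulr_ge0 ?exprn_ge0 ?(ltW C10) ?(ltW A0).
Qed.

(** Otherwise the part of Omega with D x z < t equals the part with D x z <= t, hence is open and
    closed in Omega; it contains x but not y. *)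
Lemma connected_sphere (x y : E) (t : R) : Omega x -> Omega y -> 0 < t -> t < D x y ->
  exists2 z, Omega z & D x z = t.
Proof.
move=> Ox Oy t0 ty; have [_ cO _] := dO; apply: contrapT => no.
have ne z : Omega z -> D x z != t by move=> Oz; apply/eqP => h; apply: no; exists z.
have : [set z : 'rV[R]_n | Omega z /\ `|(x : 'rV[R]_n) - z| < t] = Omega.
  apply: cO.
  - by exists x; split=> //; rewrite subrr normr0.
  - exists [set z : 'rV[R]_n | `|(x : 'rV[R]_n) - z| < t].
      exact: open_dist_lt.
    by [].
  exists [set z : 'rV[R]_n | `|(x : 'rV[R]_n) - z| <= t].
    exact: closed_dist_le.
  apply/seteqP; split=> z [Oz /= h]; split=> //; first exact: ltW.
  by rewrite lt_neqAle h andbT; exact: ne.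
move=> /seteqP[_ /(_ _ Oy)[_ /=]]; rewrite -/(D x y); lra.
Qed.

Theorem extension_domain_regular : extension_domain phi Omega -> ahlfors_regular Omega.
Proof.
move=> /ball_vol_growth[C C0 grow].
have n1 : 1 <= n%:R :> R by rewrite ler1n.
pose K := C * 4 ^+ n * (8 * n%:R) ^+ (2 * n).
have K0 : 0 < K by rewrite !mulr_gt0 ?exprn_gt0//; lra.
(* The smaller of two disjoint balls is compared with the other one. *)
have lower x y s : Omega x -> Omega y -> 0 < s -> D x y = 2 * s ->
    ball_vol x s <= ball_vol y s -> s ^+ n <= K * ball_vol x s.
  move=> Ox Oy s0 xy xsys.
  apply: (de_giorgi n0 _ s0 (@ball_vol_ndecr x)) => //.
  - by rewrite mulr_gt0// exprn_gt0.
  - by move=> r r0; exact: ball_vol_gt0.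
  move=> a b a0 ab bs dbl; rewrite -(mulrA C) -exprMn.
  apply: (grow x a b (4 * s) (ball_part y s) Ox a0 ab _ (measurable_ball_part y s) _ _ dbl).
  - lra.
  - move=> z [Oz yz]; split=> //.
      by have := supdist_tri y x z; lra.
    by have := supdist_tri z x y; rewrite (supdist_sym z y); lra.
  rewrite ball_volE lee_fin; apply: le_trans xsys; apply: ball_vol_ndecr; lra.
exists (K * (8 * n%:R) ^+ n)^-1 => [|x r Ox r0 rd].
  by rewrite invr_gt0 mulr_gt0// exprn_gt0//; lra.
(* As r / 2 is below the diameter, two points of Omega are at Euclidean distance above r / 2, hence
   at sup distance above r / (2 n); one of them is farther than t from x. *)
pose t := r / (4 * n%:R).
have t0 : 0 < t by rewrite divr_gt0//; lra.
have eucl_le (v : 'rV[R]_n) : eucl_norm v <= n%:R * `|v|.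
  rewrite -(@ler_pXn2r _ 2%N) ?nnegrE ?sqrtr_ge0 ?mulr_ge0//.
  apply: (le_trans (eucl_sqr v)); rewrite exprMn; apply: ler_wpM2r; first exact: sqr_ge0.
  by rewrite expr2 ler_peMl//; lra.
have [y Oy ty] : exists2 y, Omega y & t < D x y.
  have : ((r / 2)%:E < diam Omega)%E.
    by rewrite mulrC EFinM lte_pdivrMl.
  move=> /ereal_sup_gt[_ [[p q] [/= Op Oq] <-]]; rewrite lte_fin => pq.
  apply: contrapT => no.
  have far z : Omega z -> D x z <= t.
    by move=> Oz; rewrite leNgt; apply/negP => h; apply: no; exists z.
  have := far p Op; have := far q Oq; have := supdist_tri x p q; rewrite (supdist_sym p x) => h1 h2 h3.
  have : n%:R * D p q <= n%:R * (2 * t) by rewrite ler_pM2l//; lra.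
  have -> : n%:R * (2 * t) = r / 2 by rewrite /t; field; rewrite gt_eqF//; lra.
  by have := eucl_le (p - q); rewrite -/(D p q); lra.
have [x' Ox' xx'] := connected_sphere Ox Oy t0 ty.
pose s := t / 2; have s0 : 0 < s by rewrite divr_gt0.
have xx2 : D x x' = 2 * s by rewrite xx' /s; field.
have hs : s ^+ n <= K * ball_vol x s.
  (* The balls of radius s at x and x' are disjoint. If the one at x' is the smaller, its lower
     bound passes to the larger one at x. *)
  have [h|/ltW h] := leP (ball_vol x s) (ball_vol x' s); first exact: (lower x x').
  have xx3 : D x' x = 2 * s by rewrite supdist_sym.
  by apply: (le_trans (lower x' x s Ox' Ox s0 xx3 h)); rewrite ler_pM2l.
apply: (@le_trans _ _ (mu (ball_part x s))).
  rewrite ball_volE lee_fin.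
  have -> : (K * (8 * n%:R) ^+ n)^-1 * r ^+ n = K^-1 * s ^+ n.
    rewrite (_ : s = r / (8 * n%:R)).
      by rewrite expr_div_n invfM -mulrA [X in _ * X]mulrC.
    by rewrite /s /t; field; rewrite gt_eqF//; lra.
  by rewrite mulrC ler_pdivrMr// mulrC.
apply: le_lebesgueRn => z [Oz xz]; split=> //; rewrite /eucl_ball /=.
apply: (le_lt_trans (eucl_le _)); rewrite -/(D x z).
apply: (@lt_trans _ _ (n%:R * s)); first by rewrite ltr_pM2l//; lra.
have -> : n%:R * s = r / 8 by rewrite /s /t; field; rewrite gt_eqF//; lra.
by lra.
Qed.

End Regularity.

Theorem theorem1p1 (R : realType) (n : nat) (phi : R -> R) :
  (2 <= n)%N -> young_function phi -> (growth_constant n phi < +oo)%E ->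
  (forall Omega : set 'rV[R]_n, domain Omega ->
     ahlfors_regular Omega -> extension_domain phi Omega) /\
  (subexponential phi ->
   forall Omega : set 'rV[R]_n, domain Omega ->
     extension_domain phi Omega -> ahlfors_regular Omega).
Proof.
move=> n2 Yphi gfin; have n0 : (0 < n)%N by exact: ltnW.
split; first by move=> Omega dO rO; exact: regular_extension_domain.
by move=> sub Omega dO eO; exact: (extension_domain_regular n0 Yphi gfin sub dO eO).
Qed.
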